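(* Let $(M,c)$ be a Riemannian conformal structure on a $2$-dimensional manifold $M$, let $g\in c$, let $\alpha\colon\mathbb{R}\to\mathcal{T}_{(1,1)}M$ be an admissible smooth $1$-parameter family with $\mathrm{trace}(\dot\alpha(0))=\mathrm{scal}^g$, let $(\widetilde M,\widetilde g)$ be the Lorentzian manifold constructed from $g$ and $\alpha$, and let $D$ be the Möbius structure for $(M,c)$ given by $D(e^{2u}g)=e^{2u}g(A_{\eta^u}(-),-)$, $u\in C^\infty(M)$. Then, for every $u\in C^\infty(M)$ and the immersion $\Psi^u\colon M\to(\widetilde M,\widetilde g)$, $\Psi^u(x)=(e^{u(x)},0,x)$, with second fundamental form $\mathrm{II}^u$, the Cotton–York tensor $C(g)$ of $D$ satisfies $$C(g)(V,U,W)\,\xi^u=(\nabla_U\mathrm{II}^u)(V,W)-(\nabla_V\mathrm{II}^u)(U,W)$$ for all $U,V,W\in\mathfrak{X}(M)$. Hence the Codazzi equation of $\Psi^u$ reduces to $$\big(\widetilde R(T\Psi^u\cdot U,T\Psi^u\cdot V)\,T\Psi^u\cdot W\big)^\perp=C(g)(V,U,W)\,\xi^u .$$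
   Context: Manifolds are smooth, Hausdorff, second countable, without boundary. A Riemannian conformal structure $(M,c)$ is an equivalence class $c$ of Riemannian metrics on $M$, where $g\sim g'$ iff $g'=e^{2u}g$ for some $u\in C^\infty(M)$. $\mathcal{T}_{(1,1)}M$ denotes the endomorphism fields of $TM$ and $\mathcal{T}_{(0,2)}M$ the covariant 2-tensor fields. $\mathrm{scal}^g$ is the scalar curvature. Möbius structure (dimension $2$). A map $D\colon c\to\mathcal{T}_{(0,2)}M$ such that for every $g\in c$, $D(g)$ is symmetric with $\mathrm{trace}_gD(g)=\frac{\mathrm{scal}^g}{2}$, and $D(e^{2u}g)=D(g)-\frac{\|\nabla^gu\|_g^2}{2}g-\mathrm{Hess}^g(u)+du\otimes du$ for all $u\in C^\infty(M)$. Let $\widehat D(g)$ be defined by $D(g)(V,W)=g(\widehat D(g)(V),W)$. The Cotton–York tensor of $D$ for $g\in c$ is $$C(g)(U,V,W)=g\big((\nabla^g_U\widehat D(g))(V)-(\nabla^g_V\widehat D(g))(U),W\big).$$ Admissible family. A smooth $1$-parameter family $\alpha\colon\mathbb{R}\to\mathcal{T}_{(1,1)}M$ (with derivative $\dot\alpha(\rho)$ in $\rho$) is admissible if each $\alpha(\rho)$ is self-adjoint with respect to any $g\in c$, $\alpha(0)=\mathrm{Id}$, and there is $\delta>0$ such that $\alpha(\rho)$ is nonsingular for $|\rho|<\delta$. Construction. $\widetilde M=\mathbb{R}^+\times(-\delta,\delta)\times M$ with coordinates $(t,\rho)$ on the first two factors, and $$\widetilde g=d(\rho t)\otimes dt+dt\otimes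 d(\rho t)+t^2\,g(\alpha(\rho)(-),-),$$ a Lorentzian metric. The immersion $\Psi^u$ is spacelike with $(\Psi^u)^*\widetilde g=e^{2u}g$, and its normal bundle is spanned by the lightlike fields (with $\widetilde g(\xi^u,\eta^u)=-1$) $$\xi^u=e^u\partial_t|_{\Psi^u},\qquad \eta^u=e^{-u}\tfrac{\|\nabla^gu\|_g^2}{2}\,\partial_t|_{\Psi^u}-e^{-2u}\partial_\rho|_{\Psi^u}+e^{-2u}\nabla^gu|_{\Psi^u},$$ where a vector field on $M$ is identified with its natural lift to $\widetilde M$ and $X|_{\Psi^u}=X\circ\Psi^u$. $\widetilde\nabla$ is (induced by) the Levi-Civita connection of $\widetilde g$; $(\widetilde\nabla_V\eta^u)^\top=-T\Psi^u\cdot A_{\eta^u}V$ defines the Weingarten endomorphism; $\mathrm{II}^u(V,W)=(\widetilde\nabla_V(T\Psi^u\cdot W))^\perp$; $\nabla^\perp_V\zeta=(\widetilde\nabla_V\zeta)^\perp$ for normal $\zeta$; and $$(\nabla_U\mathrm{II}^u)(V,W)=\nabla^\perp_U(\mathrm{II}^u(V,W))-\mathrm{II}^u(\nabla_UV,W)-\mathrm{II}^u(V,\nabla_UW),$$ with $\nabla$ the Levi-Civita connection of the induced metric $e^{2u}g$. Curvature convention: $\widetilde R(X,Y)Z=\widetilde\nabla_X\widetilde\nabla_YZ-\widetilde\nabla_Y\widetilde\nabla_XZ-\widetilde\nabla_{[X,Y]}Z$. The Codazzi equation reads $(\nabla_U\mathrm{II}^u)(V,W)-(\nabla_V\mathrm{II}^u)(U,W)=(\widetilde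 R(T\Psi^u\cdot U,T\Psi^u\cdot V)T\Psi^u\cdot W)^\perp$. It is a fact that $D$ as in the claim is a Möbius structure. *)

(* Defs.v *)
From HB Require Import structures.
From mathcomp Require Import all_boot all_order all_algebra.
From mathcomp Require Import all_classical all_reals all_analysis.

Set Implicit Arguments.
Unset Strict Implicit.
Unset Printing Implicit Defensive.

Import Order.TTheory GRing.Theory Num.Theory.
Import numFieldNormedType.Exports.

#[local] Open Scope classical_set_scope.
#[local] Open Scope ring_scope.

Section SmoothEuclidean.
Context {R : realType} {n : nat} {W : normedModType R}.

Fixpoint class_C (k : nat) (O : set 'rV[R]_n) (f : 'rV[R]_n -> W) : Prop :=
  match k with
  | 0 => forall z, O z -> {for z, continuous f}
  | k'.+1 => forall z, O z -> differentiable f z /\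
               forall v, class_C k' O (fun z => 'D_v f z)
  end.

(* Only meant for open [O]. *)
Definition smooth_on (O : set 'rV[R]_n) (f : 'rV[R]_n -> W) : Prop :=
  forall k, class_C k O f.

End SmoothEuclidean.

(* A family of charts indexed by points, [chart p] being a chart around [p]
   with domain [cdom p], coordinates [cmap p] and parametrization [cinv p]. *)
Record atlas (R : realType) (M : topologicalType) (n : nat) := Atlas {
  cdom : M -> set M;
  cmap : M -> M -> 'rV[R]_n;
  cinv : M -> 'rV[R]_n -> M }.

(* Every smooth manifold carries such an atlas, which determines its smooth
   structure. *)
Definition manifold (R : realType) (M : topologicalType) (n : nat)
    (A : atlas R M n) : Prop :=
  [/\ hausdorff_space M, @second_countable M,
      (forall p, [/\ open (cdom A p), cdom A p p &
                     open (cmap A p @` cdom A p)]),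
      (forall p, [/\ {in cdom A p, cancel (cmap A p) (cinv A p)},
                     (forall q, cdom A p q -> {for q, continuous (cmap A p)}) &
                     (forall z, (cmap A p @` cdom A p) z ->
                        {for z, continuous (cinv A p)})]) &
      (forall p q, smooth_on (cmap A p @` (cdom A p `&` cdom A q))
                             (cmap A q \o cinv A p))].

(* R as a 1-manifold, and products; the chart of M x N at (p, q) is the product
   of the charts at p and q. *)
Definition line_atlas (R : realType) : atlas R R 1 :=
  {| cdom := fun _ => setT;
     cmap := fun _ t => const_mx t;
     cinv := fun _ z => z 0 0 |}.

Definition prod_atlas (R : realType) (M N : topologicalType) (m n : nat)
    (A : atlas R M m) (B : atlas R N n) : atlas R (M * N)%type (m + n) :=
  {| cdom := fun p => [set q | cdom A p.1 q.1 /\ cdom B p.2 q.2];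
     cmap := fun p q => row_mx (cmap A p.1 q.1) (cmap B p.2 q.2);
     cinv := fun p z => (cinv A p.1 (lsubmx z), cinv B p.2 (rsubmx z)) |}.

(* The tangent space T_pM is 'rV[R]_n, through the coordinates of the chart at
   p.  So T_(p,q)(M x N) is T_pM x T_qN via [row_mx]. *)
Section Tangent.
Context {R : realType} {M : topologicalType} {n : nat} (A : atlas R M n).

Definition vfield := M -> 'rV[R]_n.
Definition basis_vec (k : nat) (i : 'I_k) : 'rV[R]_k := delta_mx 0 i.

(* coordinates, in the chart at [x], of a vector [v] of T_qM *)
Definition tocoord (x q : M) (v : 'rV[R]_n) : 'rV[R]_n :=
  'D_v (cmap A x \o cinv A q) (cmap A q q).

(* the vector field with constant coordinates [v] in the chart at [x] *)
Definition const_vfield (x : M) (v : 'rV[R]_n) : vfield :=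
  fun q => 'D_v (cmap A q \o cinv A x) (cmap A x q).

(* df_p(v) *)
Definition dfun (W : normedModType R) (f : M -> W) (p : M) (v : 'rV[R]_n) : W :=
  'D_v (f \o cinv A p) (cmap A p p).

Definition smooth_fun (O : set M) (f : M -> R) : Prop :=
  forall x, smooth_on (cmap A x @` (O `&` cdom A x)) (f \o cinv A x).

End Tangent.

Section Maps.
Context {R : realType} {M N : topologicalType} {m n : nat}.
Variables (A : atlas R M m) (B : atlas R N n).

Definition tmap (Psi : M -> N) (p : M) (v : 'rV[R]_m) : 'rV[R]_n :=
  'D_v (cmap B (Psi p) \o Psi \o cinv A p) (cmap A p p).

(* smoothness on [O] of a vector field [Y] along [Psi], i.e. [Y p] lies in
   T_(Psi p) N *)
Definition smooth_along (Psi : M -> N) (O : set M) (Y : M -> 'rV[R]_n) : Prop :=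
  forall (x : M) (y : N),
    smooth_on (cmap A x @` [set q | [/\ O q, cdom A x q & cdom B y (Psi q)]])
      (fun z => tocoord B y (Psi (cinv A x z)) (Y (cinv A x z))).

End Maps.

Definition bform {R : realType} {n : nat} (B : 'M[R]_n) (v w : 'rV[R]_n) : R :=
  (v *m B *m w^T) 0 0.

Definition form_mx {R : realType} {n : nat} (b : 'rV[R]_n -> 'rV[R]_n -> R) :
  'M[R]_n := \matrix_(i, j) b (basis_vec i) (basis_vec j).

(* A (0,2)-tensor field is a matrix field [B], with B_p(v, w) = [bform (B p) v w];
   an endomorphism field is a matrix field [E], with E_p(v) = [v *m E p]. *)
Section Geometry.
Context {R : realType} {M : topologicalType} {n : nat} (A : atlas R M n).
Local Notation vf := (@vfield R M n).
Local Notation tensor := (M -> 'M[R]_n).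

Definition smooth_vfield (O : set M) (X : vf) : Prop := smooth_along A A id O X.

Definition smooth_form (O : set M) (B : tensor) : Prop :=
  forall (O' : set M) (X Y : vf), open O' -> O' `<=` O ->
    smooth_vfield O' X -> smooth_vfield O' Y ->
    smooth_fun A O' (fun p => bform (B p) (X p) (Y p)).

Definition riemannian_metric (g : tensor) : Prop :=
  smooth_form setT g /\
  forall p, (g p)^T = g p /\ forall v, v != 0 -> 0 < bform (g p) v v.

Definition lie_bracket (X Y : vf) : vf := fun p =>
  dfun A (fun q => tocoord A p q (Y q)) p (X p)
  - dfun A (fun q => tocoord A p q (X q)) p (Y p).

(* [nabla p v Y] is the covariant derivative of [Y] in the direction of [v] in
   T_pM.  The argument [Y] is any function, but only its values near [p]
   matter, and only when it is smooth near [p]; so [nabla] acts on local vector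
   fields. *)
Definition covariant := M -> 'rV[R]_n -> vf -> 'rV[R]_n.

Definition cov (nabla : covariant) (X Y : vf) : vf := fun p => nabla p (X p) Y.

Definition connection (O : set M) (nabla : covariant) : Prop :=
  forall O', open O' -> O' `<=` O ->
  forall Y Z : vf, smooth_vfield O' Y -> smooth_vfield O' Z ->
  [/\ (forall p (a : R) v w, O' p ->
         nabla p (a *: v + w) Y = a *: nabla p v Y + nabla p w Y),
      (forall p v, O' p ->
         nabla p v (fun q => Y q + Z q) = nabla p v Y + nabla p v Z),
      (forall f p v, smooth_fun A O' f -> O' p ->
         nabla p v (fun q => f q *: Y q) = dfun A f p v *: Y p + f p *: nabla p v Y) &
      smooth_vfield O' (cov nabla Y Z)].

(* the Levi-Civita connection of (the restriction to the open set [O] of) [g] *)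
Definition levi_civita (O : set M) (g : tensor) (nabla : covariant) : Prop :=
  connection O nabla /\
  forall O', open O' -> O' `<=` O ->
  forall Y Z : vf, smooth_vfield O' Y -> smooth_vfield O' Z ->
  forall p, O' p ->
    cov nabla Y Z p - cov nabla Z Y p = lie_bracket Y Z p /\
    forall v, dfun A (fun q => bform (g q) (Y q) (Z q)) p v
              = bform (g p) (nabla p v Y) (Z p) + bform (g p) (Y p) (nabla p v Z).

Definition curvature (nabla : covariant) (X Y Z : vf) : vf := fun p =>
  cov nabla X (cov nabla Y Z) p - cov nabla Y (cov nabla X Z) p
  - cov nabla (lie_bracket X Y) Z p.

(* R_p(u, v)w; by tensoriality any local extensions of u, v, w can be used. *)
Definition curv (nabla : covariant) (p : M) (u v w : 'rV[R]_n) : 'rV[R]_n :=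
  curvature nabla (const_vfield A p u) (const_vfield A p v) (const_vfield A p w) p.

Definition trace_form (g B : tensor) (p : M) : R := \tr (invmx (g p) *m B p).

(* Ric(v, w) is the trace of u |-> R(u, v)w. *)
Definition ricci (nabla : covariant) : tensor := fun p =>
  form_mx (fun v w => \sum_k curv nabla p (basis_vec k) v w 0 k).

Definition scal (g : tensor) (nabla : covariant) (p : M) : R :=
  trace_form g (ricci nabla) p.

Definition differential (u : M -> R) (p : M) : 'rV[R]_n :=
  \row_i dfun A u p (basis_vec i).

Definition grad (g : tensor) (u : M -> R) : vf := fun p =>
  differential u p *m invmx (g p).

Definition grad_sqnorm (g : tensor) (u : M -> R) (p : M) : R :=
  bform (g p) (grad g u p) (grad g u p).

Definition hess (g : tensor) (nabla : covariant) (u : M -> R) : tensor := fun p =>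
  form_mx (fun v w => bform (g p) (nabla p v (grad g u)) w).

Definition conformal (u : M -> R) (g : tensor) : tensor := fun p =>
  expR (2 * u p) *: g p.

Definition conformal_structure (c : set tensor) : Prop :=
  exists2 g0, riemannian_metric g0 &
    c = [set g | exists2 u, smooth_fun A setT u & g = conformal u g0].

(* [D] only matters on [c]. *)
Definition mobius_structure (c : set tensor) (D : tensor -> tensor) : Prop :=
  forall g, c g ->
  [/\ smooth_form setT (D g),
      (forall p, (D g p)^T = D g p) &
      forall nabla, levi_civita setT g nabla ->
        (forall p, trace_form g (D g) p = scal g nabla p / 2) /\
        (forall u, smooth_fun A setT u -> forall p,
           D (conformal u g) p
           = D g p - (grad_sqnorm g u p / 2) *: g p - hess g nabla u p
             + (differential u p)^T *m differential u p)].

(* the endomorphism field E with B(V, W) = g(E V, W) *)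
Definition sharp (g B : tensor) : tensor := fun p => B p *m invmx (g p).

Definition cov_endo (nabla : covariant) (E : tensor) (U V : vf) : vf := fun p =>
  nabla p (U p) (fun q => V q *m E q) - cov nabla U V p *m E p.

Definition cotton_york (g : tensor) (nabla : covariant) (D : tensor -> tensor)
    (U V W : vf) (p : M) : R :=
  bform (g p) (cov_endo nabla (sharp g (D g)) U V p
               - cov_endo nabla (sharp g (D g)) V U p) (W p).

(* smoothness is joint in the parameter and the point *)
Definition smooth_family (alpha : R -> tensor) : Prop :=
  forall (O : set M) (X : vf), open O -> smooth_vfield O X ->
    smooth_along (prod_atlas (line_atlas R) A) A snd (snd @^-1` O)
      (fun q => X q.2 *m alpha q.1 q.2).

Definition self_adjoint (g E : tensor) : Prop :=
  forall p v w, bform (g p) (v *m E p) w = bform (g p) v (w *m E p).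

Definition nonsingular_below (delta : R) (alpha : R -> tensor) : Prop :=
  0 < delta /\ forall rho p, `|rho| < delta -> alpha rho p \in unitmx.

Definition admissible (c : set tensor) (alpha : R -> tensor) : Prop :=
  [/\ smooth_family alpha,
      (forall rho g, c g -> self_adjoint g (alpha rho)),
      (forall p, alpha 0 p = 1%:M) &
      exists delta, nonsingular_below delta alpha].

Definition family_deriv (alpha : R -> tensor) (rho : R) : tensor := fun p =>
  derive1 (fun r => alpha r p) rho.

End Geometry.

(* Geometry of an immersion [Psi] into a manifold with metric [gt] and
   connection [nt]; sections along [Psi] are functions on M. *)
Section Immersion.
Context {R : realType} {M N : topologicalType} {m n : nat}.
Variables (A : atlas R M m) (B : atlas R N n).
Variables (gt : N -> 'M[R]_n) (nt : @covariant R N n) (Psi : M -> N).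
Local Notation T := (tmap A B Psi).

(* The induced connection: near p, Y = \sum_i y_i (E_i o Psi) for the coordinate
   frame (E_i) of the chart at Psi p, whence
   nabla_v Y = \sum_i (dy_i(v) E_i + y_i nabla_(T v) E_i). *)
Definition cov_along (p : M) (v : 'rV[R]_m) (Y : M -> 'rV[R]_n) : 'rV[R]_n :=
  dfun A (fun q => tocoord B (Psi p) (Psi q) (Y q)) p v
  + \sum_i Y p 0 i *: nt (Psi p) (T p v) (const_vfield B (Psi p) (basis_vec i)).

(* the vector w of T_pM such that Y^top = T w, for Y in T_(Psi p) N *)
Definition tan_part (p : M) (Y : 'rV[R]_n) : 'rV[R]_m :=
  xget 0 [set w | forall v, bform (gt (Psi p)) (Y - T p w) (T p v) = 0].

Definition normal_part (p : M) (Y : 'rV[R]_n) : 'rV[R]_n :=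
  Y - T p (tan_part p Y).

Definition weingarten (eta : M -> 'rV[R]_n) (p : M) : 'M[R]_m :=
  \matrix_i (- tan_part p (cov_along p (basis_vec i) eta)).

Definition second_ff (V W : @vfield R M m) (p : M) : 'rV[R]_n :=
  normal_part p (cov_along p (V p) (fun q => T q (W q))).

Definition cov_normal (V : @vfield R M m) (zeta : M -> 'rV[R]_n) (p : M) :
  'rV[R]_n := normal_part p (cov_along p (V p) zeta).

(* [nabla]: Levi-Civita connection of the induced metric *)
Definition cov_second_ff (nabla : @covariant R M m) (U V W : @vfield R M m)
    (p : M) : 'rV[R]_n :=
  cov_normal U (second_ff V W) p - second_ff (cov nabla U V) W p
  - second_ff V (cov nabla U W) p.

End Immersion.

(* The ambient space R+ x (-delta, delta) x M, as an open subset of R x (R x M). *)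
Section Ambient.
Context {R : realType} {M : topologicalType} {n : nat} (A : atlas R M n).
Local Notation MT := (R * (R * M))%type.

Definition ambient_atlas : atlas R MT (1 + (1 + n)) :=
  prod_atlas (line_atlas R) (prod_atlas (line_atlas R) A).

Definition ambient (delta : R) : set MT :=
  [set q | 0 < q.1 /\ - delta < q.2.1 < delta].

Definition d_t : 'rV[R]_(1 + (1 + n)) := row_mx 1%:M 0.
Definition d_rho : 'rV[R]_(1 + (1 + n)) := row_mx 0 (row_mx 1%:M 0).
Definition lift_vec (v : 'rV[R]_n) : 'rV[R]_(1 + (1 + n)) :=
  row_mx 0 (row_mx 0 v).

Definition ambient_metric (g : M -> 'M[R]_n) (alpha : R -> M -> 'M[R]_n)
    (q : MT) : 'M[R]_(1 + (1 + n)) :=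
  let dt := dfun ambient_atlas (fun s : MT => s.1 : R) q in
  let drt := dfun ambient_atlas (fun s : MT => s.2.1 * s.1 : R) q in
  let pr v := rsubmx (rsubmx v) in
  form_mx (fun X Y => drt X * dt Y + dt X * drt Y
    + q.1 ^+ 2 * bform (g q.2.2) (pr X *m alpha q.2.1 q.2.2) (pr Y)).

Definition Psi_u (u : M -> R) (x : M) : MT := (expR (u x), (0, x)).

Definition xi_u (u : M -> R) (x : M) : 'rV[R]_(1 + (1 + n)) :=
  expR (u x) *: d_t.

Definition eta_u (g : M -> 'M[R]_n) (u : M -> R) (x : M) :
    'rV[R]_(1 + (1 + n)) :=
  (expR (- u x) * (grad_sqnorm A g u x / 2)) *: d_t
  - expR (- (2 * u x)) *: d_rho
  + expR (- (2 * u x)) *: lift_vec (grad A g u x).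

End Ambient.

(* Main.v *)
(* The normal bundle of Psi^u is spanned by the lightlike frame (xi, eta), and xi is
   parallel up to tangent vectors, nabla_V xi = T V, because nabla_X d_t = X / t for X
   tangent to M along rho = 0.  Differentiating the products of xi, eta and T W gives
   II(V, W) = h(V, W) eta - Dh(V, W) xi with h = e^(2u) g and Dh = D(h) the shape form of
   eta, so both the antisymmetrized covariant derivative of II and the normal part of the
   ambient curvature are the antisymmetrized covariant derivative of Dh times xi.  In
   dimension two the latter is a conformal invariant of the Moebius structure: replacing
   (g, D) by (h, Dh) changes it by the curvature term R(V, U) grad u plus terms in D and
   du, and these cancel because trace D = scal / 2.  At u = 0 it is the Cotton-York
   tensor. *)
Require Import Defs.
From HB Require Import structures.
From mathcomp Require Import all_boot all_order all_algebra.
From mathcomp Require Import all_classical all_reals all_analysis.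
From mathcomp Require Import ring lra.

Set Implicit Arguments.
Unset Strict Implicit.
Unset Printing Implicit Defensive.

Import Order.TTheory GRing.Theory Num.Theory.
Import numFieldNormedType.Exports.

Local Open Scope classical_set_scope.
Local Open Scope ring_scope.

(** * Iterated directional derivatives *)

(** A tangent space is a copy of the row vectors through the chart at its own base point, so the
    components of a field become comparable only in one fixed chart; every differentiation therefore
    starts by rewriting in a coordinate frame. Connections act on local fields, and fields with
    constant coordinates around a point serve as test fields. The Codazzi equation is not invoked:
    the normal part of the curvature is computed by itself, from the commutator of the induced
    covariant derivatives along the immersion. The only ambient covariant derivative that is
    evaluated is that of [d_t]. Everything else follows from the products of [xi], [eta] and [T W],
    and the shape form of [eta] enters through the formula that defines [D]. In the invariance, R(V,
    U) grad u arises from the third derivatives of u. On a surface the curvature is fixed by the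
    scalar curvature, and trace D = scal / 2 makes it minus the Kulkarni-Nomizu product of g and D.
    The change of connection in D(U, nabla_V W), made skew in U and V, produces this same
    product. *)

Section Calculus.
Context {R : realType}.

(** The differential of [f] at [x] also expands [g] to first order there, and uniqueness of the
    differential identifies it with ['d g x]. *)
Lemma near_eq_differentiable (V W : normedModType R) (f g : V -> W) x :
  (\near x, f x = g x) -> differentiable f x -> differentiable g x.
Proof.
move=> fg df; have fgx : f x = g x := nbhs_singleton fg.
have dg : g \o shift x = cst (g x) + 'd f x +o_ 0 id.
  apply/eqaddoP => e e0.
  have /eqaddoP/(_ e e0) := diff_locally df.
  have fg0 : \forall h \near (0 : V), f (h + x) = g (h + x).
    by move: fg; rewrite (near_shift 0 x) subr0.
  move=> H; near=> h.
  have -> : (g \o shift x - (cst (g x) + 'd f x)) h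
          = (f \o shift x - (cst (f x) + 'd f x)) h.
    rewrite /= !fctE /= fgx; congr (_ - _); apply/esym.
    by near: h; apply: fg0.
  by near: h; apply: H.
have cd := diff_continuous df.
have e := diff_unique cd dg.
by apply/diff_locallyP; rewrite e.
Unshelve. all: by end_near. Qed.

Lemma derive_comp_diff (U V W : normedModType R) (f : V -> W) (h : U -> V) x v :
  differentiable h x -> differentiable f (h x) ->
  'D_v (f \o h) x = 'D_('D_v h x) f (h x).
Proof.
move=> dh df; have dfh := differentiable_comp dh df.
by rewrite !deriveE // diff_comp.
Qed.

Lemma derive_lin (V W : normedModType R) (f : V -> W) x (a : R) v w :
  differentiable f x -> 'D_(a *: v + w) f x = a *: 'D_v f x + 'D_w f x.
Proof. by move=> df; rewrite !deriveE // linearP. Qed.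

Lemma derive_sumv (V W : normedModType R) (f : V -> W) x I (r : seq I)
    (c : I -> R) (e : I -> V) : differentiable f x ->
  'D_(\sum_(i <- r) c i *: e i) f x = \sum_(i <- r) c i *: 'D_(e i) f x.
Proof.
move=> df; rewrite deriveE // linear_sum; apply: eq_bigr => i _.
by rewrite linearZ deriveE.
Qed.

Lemma derive_row n (W : normedModType R) (f : 'rV[R]_n -> W) x v :
  differentiable f x -> 'D_v f x = \sum_i v 0 i *: 'D_(delta_mx 0 i) f x.
Proof. by move=> df; rewrite {1}[v]row_sum_delta derive_sumv. Qed.

Lemma differentiable_rV (V : normedModType R) m (f : V -> 'rV[R]_m) x :
  differentiable f x <-> forall i, differentiable (fun z => f z 0 i) x.
Proof.
split=> [df i|df].
  exact: (differentiable_comp df (differentiable_coord _ _ _)).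
have -> : f = \sum_i (fun z => f z 0 i *: delta_mx 0 i).
  by apply/funext => z; rewrite fct_sumE -row_sum_delta.
by apply: differentiable_sum => i; exact: differentiableZl.
Qed.

Lemma derive_coord (V : normedModType R) m (f : V -> 'rV[R]_m) x v i :
  differentiable f x -> ('D_v f x) 0 i = 'D_v (fun z => f z 0 i) x.
Proof. by move=> /(diff_derivable (v := v)) df; rewrite derive_mx // mxE. Qed.

(** The definition places the recursion under a point of [O]. It can be pulled out because each
    condition [class_C k O] itself starts from a point of [O]. *)
Lemma class_CS n (W : normedModType R) k (O : set 'rV[R]_n) (f : 'rV[R]_n -> W) :
  class_C k.+1 O f <-> (forall z, O z -> differentiable f z) /\
                       (forall v, class_C k O ('D_v f)).
Proof.
split=> [cf|[df Df]]; last by move=> z Oz; split; [exact: df|exact: Df].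
split=> [z /cf[]//|v]; case: k cf => [|k] cf z Oz; exact: (cf z Oz).2.
Qed.

(** Openness of [O] makes the agreement persist near each point, so the derivatives agree on [O]
    again and the induction goes on. *)
Lemma class_C_ext n (W : normedModType R) k (O : set 'rV[R]_n)
    (f g : 'rV[R]_n -> W) : open O -> {in O, f =1 g} ->
  class_C k O f -> class_C k O g.
Proof.
move=> oO; elim: k f g => [|k IH] f g fg cf.
  move=> z Oz; have := cf z Oz; rewrite /prop_for /continuous_at -fg ?inE // => fc.
  apply: cvg_trans fc; apply: (@near_eq_cvg _ _ (nbhs z)).
  have nO : \forall y \near z, O y by exact: open_nbhs_nbhs.
  by apply: filterS nO => y Oy; apply: fg; rewrite inE.
have near_fg y : O y -> \near y, f y = g y.
  by move=> Oy; near=> y'; apply: fg; rewrite inE; near: y'; exact: open_nbhs_nbhs.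
have /class_CS[df cDf] := cf; apply/class_CS; split.
  by move=> z Oz; exact: near_eq_differentiable (near_fg z Oz) (df z Oz).
move=> v; apply: IH (cDf v) => y; rewrite inE => Oy.
exact: near_eq_derive (near_fg y Oy).
Unshelve. all: by end_near. Qed.

Lemma class_C_subset n (W : normedModType R) k (O O' : set 'rV[R]_n)
    (f : 'rV[R]_n -> W) : O' `<=` O -> class_C k O f -> class_C k O' f.
Proof.
move=> OO'; elim: k f => [|k IH] f.
  by move=> cf z /OO'; exact: cf.
move=> /class_CS[df cD]; apply/class_CS; split=> [z /OO'|v]; first exact: df.
exact: IH.
Qed.

Lemma class_C_prev n (W : normedModType R) k (O : set 'rV[R]_n)
    (f : 'rV[R]_n -> W) : class_C k.+1 O f -> class_C k O f.
Proof.
elim: k f => [|k IH] f /class_CS[df cD].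
  by move=> z Oz; exact: differentiable_continuous (df z Oz).
by apply/class_CS; split=> // v; exact: IH (cD v).
Qed.

Lemma class_C_local n (W : normedModType R) k (O : set 'rV[R]_n)
    (f : 'rV[R]_n -> W) :
  (forall z, O z -> exists2 O', class_C k O' f & O' z) -> class_C k O f.
Proof.
elim: k f => [|k IH] f H.
  by move=> z Oz; have [Q cQ Qz] := H z Oz; apply: cQ.
apply/class_CS; split=> [z Oz|v].
  by have [Q /class_CS[df _] /df] := H z Oz.
apply: IH => y Oy; have [Q /class_CS[_ Df] Qy] := H y Oy.
by exists Q.
Qed.

Lemma class_C_coordP n m k (O : set 'rV[R]_n) (f : 'rV[R]_n -> 'rV[R]_m) :
  open O -> class_C k O f <-> forall i, class_C k O (fun z => f z 0 i).
Proof.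
move=> oO; elim: k f => [|k IH] f.
  split=> [cf i z Oz|cf z Oz].
    apply: (@continuous_comp _ _ _ f (fun M : 'rV[R]_m => M 0 i)); first exact: cf.
    exact: differentiable_continuous (differentiable_coord _ _ _).
  have -> : f = \sum_i (fun z => f z 0 i *: delta_mx 0 i).
    by apply/funext => y; rewrite fct_sumE -row_sum_delta.
  elim/big_ind : _ => [|a b|i _]; first exact: cst_continuous.
    exact: continuousD.
  apply: (@continuous_comp _ _ _ (fun z => f z 0 i) (fun t => t *: delta_mx 0 i)).
    exact: cf.
  exact: scalel_continuous.
split=> [/class_CS[df cD] i|cf].
  apply/class_CS; split=> [z /df/differentiable_rV//|v].
  have /IH/(_ i) := cD v; apply: class_C_ext => // y; rewrite inE => Oy.
  by rewrite derive_coord //; exact: df.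
have df y : O y -> differentiable f y.
  by move=> Oy; apply/differentiable_rV => i; have /class_CS[+ _] := cf i; exact.
apply/class_CS; split=> // v.
apply/IH => i; have /class_CS[_ /(_ v)] := cf i.
by apply: class_C_ext => // y; rewrite inE => Oy; rewrite derive_coord //; exact: df.
Qed.

Lemma class_C_cst n (W : normedModType R) k (O : set 'rV[R]_n) (a : W) :
  class_C k O (fun _ : 'rV[R]_n => a).
Proof.
elim: k a => [|k IH] a; first by move=> z Oz; exact: cst_continuous.
apply/class_CS; split=> [z _|v]; first exact: differentiable_cst.
have -> : 'D_v (fun _ : 'rV[R]_n => a) = fun _ => 0.
  by apply/funext => y; rewrite derive_cst.
exact: IH.
Qed.

Section RealValued.
Context {n : nat} (O : set 'rV[R]_n) (oO : open O).
Implicit Types f g : 'rV[R]_n -> R.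

Lemma class_C_add k f g :
  class_C k O f -> class_C k O g -> class_C k O (fun z => f z + g z).
Proof.
elim: k f g => [|k IH] f g.
  by move=> cf cg z Oz; exact: continuousD (cf z Oz) (cg z Oz).
move=> /class_CS[df Df] /class_CS[dg Dg]; apply/class_CS.
split=> [z Oz|v]; first exact: differentiableD (df z Oz) (dg z Oz).
apply: class_C_ext (IH _ _ (Df v) (Dg v)) => // y; rewrite inE => Oy.
by rewrite deriveD //; apply: diff_derivable; [exact: df|exact: dg].
Qed.

Lemma class_C_sum k (I : Type) (r : seq I) (F : I -> 'rV[R]_n -> R) :
  (forall i, class_C k O (F i)) -> class_C k O (fun z => \sum_(i <- r) F i z).
Proof.
move=> cF; elim: r => [|i r IH].
  by under eq_fun do rewrite big_nil; exact: class_C_cst.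
by under eq_fun do rewrite big_cons; exact: class_C_add.
Qed.

Lemma class_C_mul k f g :
  class_C k O f -> class_C k O g -> class_C k O (fun z => f z * g z).
Proof.
elim: k f g => [|k IH] f g cf cg.
  by move=> z Oz; exact: continuousM (cf z Oz) (cg z Oz).
have /class_CS[df Df] := cf; have /class_CS[dg Dg] := cg.
apply/class_CS; split=> [z Oz|v]; first exact: differentiableM (df z Oz) (dg z Oz).
have c1 := IH _ _ (class_C_prev cf) (Dg v).
have c2 := IH _ _ (class_C_prev cg) (Df v).
apply: class_C_ext (class_C_add c1 c2) => // y; rewrite inE => Oy.
by rewrite deriveM //; apply: diff_derivable; [exact: df|exact: dg].
Qed.

(** The chain rule gives a sum of products of coordinates of ['D_v h] with partial derivatives of
    [F] composed with [h]; the induction hypothesis, for arbitrary [F], covers the latter. *)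
Lemma class_C_comp m k (O' : set 'rV[R]_m) (h : 'rV[R]_n -> 'rV[R]_m)
    (F : 'rV[R]_m -> R) :
  (forall z, O z -> O' (h z)) ->
  class_C k O h -> class_C k O' F -> class_C k O (fun z => F (h z)).
Proof.
move=> hO; elim: k F => [|k IH] F ch cF.
  move=> z Oz; apply: (@continuous_comp _ _ _ h F); first exact: ch.
  exact: cF (hO z Oz).
have /class_CS[dh Dh] := ch; have /class_CS[dF DF] := cF.
apply/class_CS; split=> [z Oz|v].
  exact: differentiable_comp (dh z Oz) (dF _ (hO z Oz)).
have c : class_C k O (fun z => \sum_i ('D_v h z) 0 i * 'D_(delta_mx 0 i) F (h z)).
  apply: class_C_sum => i; apply: class_C_mul.
    by move/(class_C_coordP _ _ oO) : (Dh v); apply.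
  exact: IH (class_C_prev ch) (DF _).
apply: class_C_ext c => // y; rewrite inE => Oy.
have dFy := dF _ (hO y Oy).
by rewrite (derive_comp_diff v (dh y Oy) dFy) [RHS]derive_row.
Qed.

(** The derivative is the function itself times ['D_v f], so one order of regularity of the
    composite yields the next. Reciprocals are treated in the same way below. *)
Lemma class_C_exp k f : class_C k O f -> class_C k O (fun z => expR (f z)).
Proof.
elim: k => [|k IH] cf.
  move=> z Oz; apply: (@continuous_comp _ _ _ f expR); first exact: cf.
  exact: continuous_expR.
have dexp y : differentiable (expR : R -> R) y.
  by apply/derivable1_diffP; exact: derivable_expR.
have /class_CS[df Df] := cf; apply/class_CS; split=> [z Oz|v].
  by apply: differentiable_comp (dexp _); exact: df.
have c := class_C_mul (Df v) (IH (class_C_prev cf)).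
apply: class_C_ext c => // y; rewrite inE => Oy; have dfy := df y Oy.
rewrite (derive_comp_diff v dfy) // [RHS]deriveE // -[X in 'd _ _ X]mulr1.
by rewrite [RHS]linearZ -deriveE // derive_val.
Qed.

Lemma class_C_inv k f : (forall z, O z -> f z != 0) ->
  class_C k O f -> class_C k O (fun z => (f z)^-1).
Proof.
move=> f0; elim: k => [|k IH] cf.
  by move=> z Oz; exact: (continuousV (f0 z Oz) (cf z Oz)).
have /class_CS[df Df] := cf; apply/class_CS.
split=> [z Oz|v]; first exact: differentiableV (df z Oz) (f0 z Oz).
have c1 := IH (class_C_prev cf).
have c2 := class_C_mul (class_C_mul c1 c1) (Df v).
have c3 := class_C_mul (class_C_cst k O (-1 : R)) c2.
apply: class_C_ext c3 => // y.
rewrite inE => Oy; rewrite deriveV ?f0 //; last exact: diff_derivable (df y Oy).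
by rewrite /GRing.scale /= -exprVn expr2; ring.
Qed.

(** * Symmetry of second derivatives *)

Lemma derive_line (W : normedModType R) (f : 'rV[R]_n -> W) v b s :
  differentiable f (s *: v + b) ->
  is_derive s (1 : R) (fun s => f (s *: v + b)) ('D_v f (s *: v + b)).
Proof.
move=> df; pose l : R -> 'rV[R]_n := fun s => s *: v + b.
have dl : is_diff s l ( *:%R ^~ v).
  rewrite -[X in is_diff _ _ X]addr0; apply: is_diffD.
have dfl : differentiable (f \o l) s by apply: differentiable_comp.
have -> : 'D_v f (s *: v + b) = 'D_1 (f \o l) s.
  have e : 'd (f \o l) s = 'd f (l s) \o 'd l s :> (R -> W) by exact: diff_comp.
  by rewrite [LHS]deriveE // [RHS]deriveE // e /= diff_val scale1r.
exact/derivableP/diff_derivable.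
Qed.

(** Symmetric in [v] and [w]; divided by [h ^+ 2] it approximates both iterated derivatives. *)
Definition second_difference f z v w (h : R) : R :=
  f (h *: v + (h *: w + z)) - f (h *: v + z) - f (h *: w + z) + f z.

(* The mean value theorem applied to s |-> f (z + s v + h w) - f (z + s v). *)
Lemma second_difference_derive f z v w :
  O z -> (forall y, O y -> differentiable f y) -> differentiable ('D_v f) z ->
  forall e, 0 < e -> exists2 d, 0 < d & forall h, 0 < h < d ->
    `|second_difference f z v w h - h ^+ 2 * 'D_w ('D_v f) z| <= e * h ^+ 2.
Proof.
move=> Oz df dDf e e0.
set F : 'rV[R]_n -> R := 'D_v f in dDf *.
(* [h * C] bounds the displacement [s *: v + t *: w] for [s], [t] between 0 and [h]; the summand 1
   keeps [C] positive when both vectors vanish. With [e'] the linearization error of [F] at such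
   points is at most [e / 2 * h], and two such errors occur. *)
pose C : R := `|v| + `|w| + 1.
have C0 : 0 < C by rewrite ltr_wpDl // addr_ge0.

pose e' : R := e / (2 * C).
have e'0 : 0 < e' by rewrite divr_gt0 // mulr_gt0.
have /eqaddoP/(_ e' e'0)/nbhs_ballP[r /= r0 Hr] := diff_locally dDf.
have /nbhs_ballP[r' /= r'0 Hr'] : nbhs z O by exact: open_nbhs_nbhs.
exists (Num.min r r' / C); first by rewrite divr_gt0 // lt_min r0.
move=> h /andP[h0]; rewrite ltr_pdivlMr // lt_min => /andP[hr hr'].
have bound s t : 0 <= s <= h -> 0 <= t <= h -> `|s *: v + t *: w| < h * C.
  move=> /andP[s0 sh] /andP[t0 th]; rewrite (le_lt_trans (ler_normD _ _)) //.
  rewrite !normrZ !ger0_norm // (@le_lt_trans _ _ (h * `|v| + h * `|w|)) //.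
    by rewrite lerD // ler_wpM2r.
  by rewrite -mulrDr ltr_pM2l // ltrDl.
have inO s t : 0 <= s <= h -> 0 <= t <= h -> O (s *: v + (t *: w + z)).
  move=> s0 t0; apply: Hr'; rewrite -ball_normE /= addrA opprD addrCA subrr addr0 normrN.
  exact: lt_trans (bound _ _ s0 t0) hr'.
have h01 : 0 <= h <= h by rewrite lexx ltW.
have h00 : 0 <= (0 : R) <= h by rewrite lexx ltW.
have inO0 s : 0 <= s <= h -> O (s *: v + z).
  by move=> s0; have := inO s 0 s0 h00; rewrite scale0r add0r.
pose phi s := f (s *: v + (h *: w + z)) - f (s *: v + z).
pose dphi s := F (s *: v + (h *: w + z)) - F (s *: v + z).
have Dphi s : 0 <= s <= h -> is_derive s 1 phi (dphi s).
  by move=> sh; apply: is_deriveB; apply: derive_line; apply: df;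
    [exact: inO|exact: inO0].
have [|c|c /[!in_itv]/= /andP[c0 ch]] := @MVT _ phi dphi 0 h h0.
- by move=> s /[!in_itv]/= /andP[s0 sh]; apply: Dphi; rewrite !ltW.
- apply: derivable_within_continuous => s /[!in_itv]/= sh.
  by have [] := Dphi s sh.
have ch' : 0 <= c <= h by rewrite !ltW.
have est t : 0 <= t <= h ->
    `|F (c *: v + (t *: w + z)) - F z - 'd F z (c *: v + t *: w)| <= e / 2 * h.
  move=> th; have := Hr (c *: v + t *: w); rewrite /= -ball_normE /= sub0r normrN.
  move=> /(_ (lt_trans (bound _ _ ch' th) hr)).
  rewrite -[X in `|X|]/(F (c *: v + t *: w + z) - (F z + 'd F z (c *: v + t *: w))).
  rewrite opprD addrA => /le_trans le; rewrite [_ + (_ + z)]addrA; apply: le.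
  rewrite (@le_trans _ _ (e' * (h * C))) //.
    by rewrite ler_pM2l // ltW // bound.
  by rewrite /e' le_eqVlt; apply/orP; left; apply/eqP; field; rewrite gt_eqF.
have := est h h01; have := est 0 h00.
rewrite scale0r add0r addr0; set A := F (_ + z); set B := F (_ + _).
pose D : R := 'D_w F z; pose L : R := 'd F z (c *: v).
have -> : 'd F z (c *: v + h *: w) = L + h * D.
  by rewrite linearD; congr (_ + _); rewrite linearZ /D deriveE.
rewrite -[X in A - F z - X]/L -/D => E0 E1.
rewrite /second_difference subr0 => phi_h.
have -> : f (h *: v + (h *: w + z)) - f (h *: v + z) - f (h *: w + z) + f z
        = h * (B - A).
  have -> : h * (B - A) = dphi c * h by rewrite mulrC.
  rewrite -phi_h /phi !scale0r !add0r.
  have alg (a1 a2 a3 a4 : R) : a1 - a2 - a3 + a4 = a1 - a2 - (a3 - a4) by ring.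
  exact: alg.
have -> : h * (B - A) - h ^+ 2 * D = h * ((B - F z - (L + h * D)) - (A - F z - L)).
  by move: (B) (A) (F z) (L) (D) => a1 a2 a3 a4 a5; ring.
rewrite normrM gtr0_norm // expr2 mulrCA ler_pM2l //.
apply: le_trans (ler_normB _ _) _; apply: le_trans (lerD E1 E0) _.
by rewrite -mulrDl -splitr.
Qed.

(** For one small [h] the symmetric second difference is within [e / 2 * h ^+ 2] of [h ^+ 2] times
    either iterated derivative. *)
Lemma derive_comm f z v w : O z -> class_C 2 O f ->
  'D_w ('D_v f) z = 'D_v ('D_w f) z.
Proof.
move=> Oz /class_CS[df Df].
have DDf u : differentiable ('D_u f) z by have /class_CS[+ _] := Df u; exact.
apply/eqP; rewrite -subr_eq0 -normr_le0; apply/ler_addgt0Pr => e e0; rewrite add0r.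
have e20 : 0 < e / 2 by rewrite divr_gt0.
have [d1 d10 H1] := second_difference_derive w Oz df (DDf v) e20.
have [d2 d20 H2] := second_difference_derive v Oz df (DDf w) e20.
pose h := Num.min d1 d2 / 2.
have h0 : 0 < h by rewrite divr_gt0 // lt_min d10.
have hd : h < Num.min d1 d2 by rewrite /h ltr_pdivrMr // ltr_pMr ?ltr1n // lt_min d10.
move: hd; rewrite lt_min => /andP[hd1 hd2].
have := H1 h; rewrite h0 hd1 => /(_ isT) E1.
have := H2 h; rewrite h0 hd2 => /(_ isT) E2.
have sym : second_difference f z w v h = second_difference f z v w h.
  by rewrite /second_difference addrCA; ring.
rewrite sym in E2; rewrite -(ler_pM2r (exprn_gt0 2 h0)).
have -> : `|'D_w ('D_v f) z - 'D_v ('D_w f) z| * h ^+ 2 =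
  `|(second_difference f z v w h - h ^+ 2 * 'D_v ('D_w f) z) -
    (second_difference f z v w h - h ^+ 2 * 'D_w ('D_v f) z)|.
  rewrite -[h ^+ 2 in LHS]ger0_norm ?exprn_ge0 ?(ltW h0) // -normrM; congr (`| _ |).
  have alg (a b c k : R) : (a - b) * k = c - k * b - (c - k * a) by ring.
  exact: alg.
apply: le_trans (ler_normB _ _) _; apply: le_trans (lerD E2 E1) _.
by rewrite -mulrDl -splitr.
Qed.

End RealValued.
End Calculus.

(** * Charts and smooth functions *)

(** The local conditions of [manifold], isolated because they are established for the line and for
    products, hence for the ambient space. *)
Definition charted (R : realType) (M : topologicalType) n (A : atlas R M n) :=
  [/\ (forall p, [/\ open (cdom A p), cdom A p p &
                     open (cmap A p @` cdom A p)]),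
      (forall p, [/\ {in cdom A p, cancel (cmap A p) (cinv A p)},
                     (forall q, cdom A p q -> {for q, continuous (cmap A p)}) &
                     (forall z, (cmap A p @` cdom A p) z ->
                        {for z, continuous (cinv A p)})]) &
      (forall p q, smooth_on (cmap A p @` (cdom A p `&` cdom A q))
                             (cmap A q \o cinv A p))].

Section Charts.
Context {R : realType} {M : topologicalType} {n : nat} {A : atlas R M n}.
Context (hA : charted A).
Implicit Types (p q x y : M) (O : set M) (v w : 'rV[R]_n).

Lemma cdom_open p : open (cdom A p).
Proof. by case: hA => /(_ p)[]. Qed.

Lemma cdom_refl p : cdom A p p.
Proof. by case: hA => /(_ p)[]. Qed.

Lemma cmapK p q : cdom A p q -> cinv A p (cmap A p q) = q.
Proof. by case: hA => _ /(_ p)[+ _ _] _ => /[swap] pq; apply; rewrite inE. Qed.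

Lemma near_cinv p q O : open O -> O q -> cdom A p q ->
  \forall z \near cmap A p q,
    [/\ O (cinv A p z), cdom A p (cinv A p z) & cmap A p (cinv A p z) = z].
Proof.
move=> oO Oq pq; case: hA => /(_ p)[_ _ oI] /(_ p)[_ _ cI] _.
have Iz : (cmap A p @` cdom A p) (cmap A p q) by exists q.
have nO : \forall z \near cmap A p q, O (cinv A p z).
  by apply: (cI _ Iz); rewrite cmapK //; exact: open_nbhs_nbhs.
have nI : \forall z \near cmap A p q, (cmap A p @` cdom A p) z.
  exact: open_nbhs_nbhs.
near=> z; have Oz : O (cinv A p z) by near: z.
have [q' pq' qz] : (cmap A p @` cdom A p) z by near: z.
by move: Oz; rewrite -qz cmapK.
Unshelve. all: by end_near. Qed.

Lemma image_open p O : open O -> open (cmap A p @` (O `&` cdom A p)).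
Proof.
move=> oO; rewrite openE => _ [q [Oq pq] <-].
apply: filterS (near_cinv oO Oq pq) => z [Oz pz zz].
by exists (cinv A p z).
Qed.

Lemma cmap_continuous p q : cdom A p q -> {for q, continuous (cmap A p)}.
Proof. by case: hA => _ /(_ p)[_ + _] _; apply. Qed.

Lemma transition_diff p q x : cdom A p x -> cdom A q x ->
  differentiable (cmap A q \o cinv A p) (cmap A p x).
Proof.
move=> px qx; case: hA => _ _ /(_ p q 1%N)/class_CS[+ _]; apply.
by exists x.
Qed.

(** The chart at [p] itself is used, the one in which [dfun] takes its derivative. *)
Definition mdiff (W : normedModType R) (f : M -> W) p :=
  differentiable (f \o cinv A p) (cmap A p p).

Lemma chart_near (T : Type) (h : M -> T) p y x : cdom A p x -> cdom A y x ->
  \forall z \near cmap A p x,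
    ((h \o cinv A y) \o (cmap A y \o cinv A p)) z = (h \o cinv A p) z.
Proof.
move=> px yx; apply: filterS (near_cinv (cdom_open y) yx px) => z [yz _ _] /=.
by rewrite cmapK.
Qed.

Lemma chart_change (W : normedModType R) (h : M -> W) p y x v :
  cdom A p x -> cdom A y x ->
  differentiable (h \o cinv A y) (cmap A y x) ->
  differentiable (h \o cinv A p) (cmap A p x) /\
  'D_v (h \o cinv A p) (cmap A p x)
  = 'D_('D_v (cmap A y \o cinv A p) (cmap A p x)) (h \o cinv A y) (cmap A y x).
Proof.
move=> px yx dh; have dt := transition_diff px yx.
have e : (cmap A y \o cinv A p) (cmap A p x) = cmap A y x by rewrite /= cmapK.
have dh' : differentiable (h \o cinv A y) ((cmap A y \o cinv A p) (cmap A p x)).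
  by rewrite e.
split; first exact: near_eq_differentiable (chart_near h px yx) (differentiable_comp dt dh').
by rewrite -(near_eq_derive v (chart_near h px yx)) derive_comp_diff // e.
Qed.

(** [tocoord] and [const_vfield] are the Jacobians of the two transition maps between the charts at
    [p] and at [q], which are inverse to each other. *)
Lemma tocoordK p q v : cdom A p q -> const_vfield A p (tocoord A p q v) q = v.
Proof.
move=> pq; have qq := cdom_refl q.
have [_ e] := chart_change v qq pq (transition_diff pq qq).
rewrite /const_vfield /tocoord -e.
rewrite (near_eq_derive (g := id)) ?derive_id //.
by apply: filterS (near_cinv (cdom_open q) qq qq) => z [].
Qed.

Lemma const_vfieldK p q v : cdom A p q -> tocoord A p q (const_vfield A p v q) = v.
Proof.
move=> pq; have qq := cdom_refl q.
have [_ e] := chart_change v pq qq (transition_diff qq pq).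
rewrite /const_vfield /tocoord -e.
rewrite (near_eq_derive (g := id)) ?derive_id //.
by apply: filterS (near_cinv (cdom_open p) pq pq) => z [].
Qed.

Lemma tocoord_id p v : tocoord A p p v = v.
Proof.
have pp := cdom_refl p.
rewrite /tocoord (near_eq_derive (g := id)) ?derive_id //.
by apply: filterS (near_cinv (cdom_open p) pp pp) => z [].
Qed.

Lemma const_vfield_id p v : const_vfield A p v p = v.
Proof. exact: tocoord_id. Qed.

Lemma tocoord_lin p q a v w : cdom A p q ->
  tocoord A p q (a *: v + w) = a *: tocoord A p q v + tocoord A p q w.
Proof. by move=> pq; apply/derive_lin/transition_diff => //; exact: cdom_refl. Qed.

Lemma tocoord0 p q : tocoord A p q 0 = 0.
Proof. exact: derive0. Qed.

Lemma tocoordD p q v w : cdom A p q ->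
  tocoord A p q (v + w) = tocoord A p q v + tocoord A p q w.
Proof. by move=> pq; rewrite -[v]scale1r tocoord_lin // !scale1r. Qed.

Lemma tocoordZ p q a v : cdom A p q ->
  tocoord A p q (a *: v) = a *: tocoord A p q v.
Proof. by move=> pq; have := tocoord_lin a v 0 pq; rewrite tocoord0 !addr0. Qed.

Lemma const_vfield_sum p q v : cdom A p q ->
  const_vfield A p v q = \sum_i v 0 i *: const_vfield A p (basis_vec i) q.
Proof. by move=> pq; apply/derive_row/transition_diff => //; exact: cdom_refl. Qed.

Lemma frame_sum p q v : cdom A p q ->
  v = \sum_i (tocoord A p q v) 0 i *: const_vfield A p (basis_vec i) q.
Proof. by move=> pq; rewrite -const_vfield_sum // tocoordK. Qed.

Section Dfun.
Context {W : normedModType R}.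
Implicit Types f h : M -> W.

Lemma dfun_lin f p a v w : mdiff f p ->
  dfun A f p (a *: v + w) = a *: dfun A f p v + dfun A f p w.
Proof. exact: derive_lin. Qed.

Lemma dfun0 f p : dfun A f p 0 = 0.
Proof. exact: derive0. Qed.

Lemma near_chart p (P : set M) : (\forall q \near p, P q) ->
  \forall z \near cmap A p p, P (cinv A p z).
Proof.
move=> nP; have Pp : P^° p := nP.
apply: filterS (near_cinv (open_interior P) Pp (cdom_refl p)) => z [Pz _ _].
exact: interior_subset.
Qed.

Lemma mdiff_ext f h p : (\forall q \near p, f q = h q) -> mdiff f p -> mdiff h p.
Proof. by move=> /near_chart fh; exact: near_eq_differentiable. Qed.

Lemma dfun_ext f h p v : (\forall q \near p, f q = h q) ->
  dfun A f p v = dfun A h p v.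
Proof. by move=> /near_chart fh; exact: near_eq_derive. Qed.

Lemma mdiff_cst (a : W) p : mdiff (fun=> a) p.
Proof. exact: differentiable_cst. Qed.

Lemma dfun_cst (a : W) p v : dfun A (fun=> a) p v = 0.
Proof. exact: derive_cst. Qed.

Lemma mdiffD f h p : mdiff f p -> mdiff h p -> mdiff (fun q => f q + h q) p.
Proof. exact: differentiableD. Qed.

Lemma dfunD f h p v : mdiff f p -> mdiff h p ->
  dfun A (fun q => f q + h q) p v = dfun A f p v + dfun A h p v.
Proof.
by move=> df dh; rewrite /dfun -deriveD //; apply: diff_derivable.
Qed.

Lemma mdiff_sum I (r : seq I) (F : I -> M -> W) p :
  (forall i, mdiff (F i) p) -> mdiff (fun q => \sum_(i <- r) F i q) p.
Proof.
move=> dF; elim: r => [|i r IH].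
  by under eq_fun do rewrite big_nil; exact: mdiff_cst.
by under eq_fun do rewrite big_cons; exact: mdiffD.
Qed.

Lemma dfun_sum I (r : seq I) (F : I -> M -> W) p v :
  (forall i, mdiff (F i) p) ->
  dfun A (fun q => \sum_(i <- r) F i q) p v = \sum_(i <- r) dfun A (F i) p v.
Proof.
move=> dF; elim: r => [|i r IH].
  by rewrite big_nil; under eq_fun do rewrite big_nil; exact: dfun_cst.
rewrite big_cons; under eq_fun do rewrite big_cons.
by rewrite dfunD ?IH //; exact: mdiff_sum.
Qed.

Lemma dfun_chart f p q v : cdom A p q -> mdiff f q ->
  differentiable (f \o cinv A p) (cmap A p q) /\
  dfun A f q v = 'D_(tocoord A p q v) (f \o cinv A p) (cmap A p q).
Proof.
move=> pq df; have qq := cdom_refl q.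
have [dfp _] := chart_change v pq qq df; split=> //.
by have [_ e] := chart_change v qq pq dfp; rewrite /dfun e.
Qed.

End Dfun.

Lemma mdiff_coord m (f : M -> 'rV[R]_m) p :
  mdiff f p <-> forall i, mdiff (fun q => f q 0 i) p.
Proof. exact: differentiable_rV. Qed.

Lemma dfun_coord m (f : M -> 'rV[R]_m) p v i : mdiff f p ->
  (dfun A f p v) 0 i = dfun A (fun q => f q 0 i) p v.
Proof. exact: derive_coord. Qed.

Lemma mdiffM (f h : M -> R) p : mdiff f p -> mdiff h p ->
  mdiff (fun q => f q * h q) p.
Proof. exact: differentiableM. Qed.

Lemma dfunM (f h : M -> R) p v : mdiff f p -> mdiff h p ->
  dfun A (fun q => f q * h q) p v = dfun A f p v * h p + f p * dfun A h p v.
Proof.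
move=> df dh; have e := cmapK (cdom_refl p).
rewrite /dfun -[X in 'D_v X _]/((f \o cinv A p) * (h \o cinv A p)).
by rewrite deriveM; [|exact: diff_derivable..]; rewrite /= !e addrC /GRing.scale/= mulrC.
Qed.

Lemma mdiff_exp (f : M -> R) p : mdiff f p -> mdiff (fun q => expR (f q)) p.
Proof.
move=> df; apply: (differentiable_comp df); apply/derivable1_diffP.
exact: derivable_expR.
Qed.

Lemma dfun_exp (f : M -> R) p v : mdiff f p ->
  dfun A (fun q => expR (f q)) p v = expR (f p) * dfun A f p v.
Proof.
move=> df; have de (y : R) : differentiable (expR : R -> R) y.
  by apply/derivable1_diffP; exact: derivable_expR.
rewrite /dfun -[X in 'D_v X _]/(expR \o (f \o cinv A p)) derive_comp_diff //.
rewrite deriveE // -[X in 'd _ _ X]mulr1 linearZ -deriveE // derive_val /= cmapK.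
  by rewrite /GRing.scale/= mulrC.
exact: cdom_refl.
Qed.

End Charts.

(** * Smooth functions and vector fields on a manifold *)

Section SmoothFunctions.
Context {R : realType} {M : topologicalType} {n : nat} {A : atlas R M n}.
Context (hA : charted A).
Implicit Types (p q x y : M) (O : set M) (v w : 'rV[R]_n) (f h : M -> R).

Lemma smooth_mdiff O f p : smooth_fun A O f -> O p -> mdiff (A := A) f p.
Proof.
move=> sf Op; have /class_CS[+ _] := sf p 1%N; apply; exists p => //; split=> //.
exact: cdom_refl.
Qed.

Lemma smooth_fun_ext O f h : open O -> {in O, f =1 h} ->
  smooth_fun A O f -> smooth_fun A O h.
Proof.
move=> oO fh sf x k; apply: class_C_ext (sf x k); first exact: image_open.
move=> z; rewrite inE => -[q [Oq xq] <-] /=.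
by rewrite (cmapK hA xq) fh // inE.
Qed.

Lemma smooth_fun_subset O O1 f : O1 `<=` O -> smooth_fun A O f -> smooth_fun A O1 f.
Proof.
move=> OO1 sf x k; apply: class_C_subset (sf x k) => _ [q [Oq xq] <-].
by exists q; split=> //; exact: OO1.
Qed.

Lemma smooth_fun_local O f :
  (forall p, O p -> exists2 Q, smooth_fun A Q f & Q p) -> smooth_fun A O f.
Proof.
move=> H x k; apply: class_C_local => _ [q [Oq xq] <-].
have [Q sQ Qq] := H q Oq; exists (cmap A x @` (Q `&` cdom A x)); first exact: sQ.
by exists q.
Qed.

(** One chart suffices on its domain, since any other chart only composes the representative with a
    smooth transition map. *)
Lemma smooth_fun_chart O f p : open O ->
  smooth_on (cmap A p @` (O `&` cdom A p)) (f \o cinv A p) ->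
  smooth_fun A (O `&` cdom A p) f.
Proof.
move=> oO sf x k.
have oI : open (cmap A x @` (O `&` cdom A p `&` cdom A x)).
  by apply: (image_open hA); apply: openI => //; exact: (cdom_open hA).
have c : class_C k (cmap A x @` (O `&` cdom A p `&` cdom A x))
           (cmap A p \o cinv A x).
  case: hA => _ _ /(_ x p k); apply: class_C_subset => _ [q [[_ pq] xq] <-].
  by exists q.
apply: class_C_ext oI _ (class_C_comp oI _ c (sf k)).
  by move=> z; rewrite inE => -[q [[_ pq] xq] <-] /=; rewrite (cmapK hA xq) (cmapK hA pq).
by move=> _ [q [[Oq pq] xq] <-] /=; rewrite (cmapK hA xq); exists q.
Qed.

Lemma smooth_cst O (a : R) : smooth_fun A O (fun=> a).
Proof. by move=> x k; exact: class_C_cst. Qed.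

Section OpenSet.
Context {O : set M} (oO : open O).

Lemma smoothD f h : smooth_fun A O f -> smooth_fun A O h ->
  smooth_fun A O (fun q => f q + h q).
Proof. by move=> sf sh x k; apply: class_C_add (sf x k) (sh x k); exact: image_open. Qed.

Lemma smoothM f h : smooth_fun A O f -> smooth_fun A O h ->
  smooth_fun A O (fun q => f q * h q).
Proof. by move=> sf sh x k; apply: class_C_mul (sf x k) (sh x k); exact: image_open. Qed.

Lemma smooth_sum I (r : seq I) (F : I -> M -> R) :
  (forall i, smooth_fun A O (F i)) -> smooth_fun A O (fun q => \sum_(i <- r) F i q).
Proof.
by move=> sF x k; apply: class_C_sum => [|i]; [exact: image_open|exact: sF].
Qed.

Lemma smooth_exp f : smooth_fun A O f -> smooth_fun A O (fun q => expR (f q)).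
Proof. by move=> sf x k; apply: class_C_exp (sf x k); exact: image_open. Qed.

Lemma smooth_inv f : (forall q, O q -> f q != 0) -> smooth_fun A O f ->
  smooth_fun A O (fun q => (f q)^-1).
Proof.
move=> f0 sf x k; apply: class_C_inv (sf x k); first exact: image_open.
by move=> _ [q [Oq xq] <-] /=; rewrite (cmapK hA xq) f0.
Qed.

Lemma smooth_vfieldP (X : M -> 'rV[R]_n) :
  smooth_vfield A O X <-> forall y i,
    smooth_fun A (O `&` cdom A y) (fun q => (tocoord A y q (X q)) 0 i).
Proof.
have oI x y : open (cmap A x @` [set q | [/\ O q, cdom A x q & cdom A y q]]).
  have -> : [set q | [/\ O q, cdom A x q & cdom A y q]] = (O `&` cdom A y) `&` cdom A x.
    by apply/seteqP; split=> q; [case|case=> -[]].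
  by apply: (image_open hA); apply: openI => //; exact: (cdom_open hA).
split=> [sX y i x k|sX x y k].
  have /(class_C_coordP _ _ (oI x y))/(_ i) := sX x y k.
  by apply: class_C_subset => _ [q [[Oq yq] xq] <-]; exists q.
apply/(class_C_coordP _ _ (oI x y)) => i.
by apply: class_C_subset (sX y i x k) => _ [q [Oq xq yq] <-]; exists q.
Qed.

Lemma smooth_vfield_diff X p : smooth_vfield A O X -> O p ->
  mdiff (A := A) (fun q => tocoord A p q (X q)) p.
Proof.
move=> /smooth_vfieldP sX Op; apply/mdiff_coord => i.
by apply: smooth_mdiff (sX p i) _; split=> //; exact: (cdom_refl hA).
Qed.

Lemma smooth_vfieldD X Y : smooth_vfield A O X -> smooth_vfield A O Y ->
  smooth_vfield A O (fun q => X q + Y q).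
Proof.
move=> /smooth_vfieldP sX /smooth_vfieldP sY; apply/smooth_vfieldP => y i.
have oI : open (O `&` cdom A y) by apply: openI => //; exact: (cdom_open hA).
have s : smooth_fun A (O `&` cdom A y)
    (fun q => (tocoord A y q (X q)) 0 i + (tocoord A y q (Y q)) 0 i).
  by move=> x k; apply: class_C_add; [exact: image_open|exact: sX|exact: sY].
apply: smooth_fun_ext s => // q; rewrite inE => -[_ yq].
by rewrite (tocoordD hA) // mxE.
Qed.

Lemma smooth_vfieldZ f X : smooth_fun A O f -> smooth_vfield A O X ->
  smooth_vfield A O (fun q => f q *: X q).
Proof.
move=> sf /smooth_vfieldP sX; apply/smooth_vfieldP => y i.
have oI : open (O `&` cdom A y) by apply: openI => //; exact: (cdom_open hA).
have s : smooth_fun A (O `&` cdom A y) (fun q => f q * (tocoord A y q (X q)) 0 i).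
  move=> x k; apply: class_C_mul; [exact: image_open| |exact: sX].
  by apply: (smooth_fun_subset _ sf) => q [].
apply: smooth_fun_ext s => // q; rewrite inE => -[_ yq].
by rewrite (tocoordZ hA) // mxE.
Qed.

Lemma smooth_vfield0 : smooth_vfield A O (fun=> 0).
Proof.
apply/smooth_vfieldP => y i.
under eq_fun do rewrite tocoord0 mxE.
exact: smooth_cst.
Qed.

Lemma smooth_vfield_sum I (r : seq I) (F : I -> M -> 'rV[R]_n) :
  (forall i, smooth_vfield A O (F i)) ->
  smooth_vfield A O (fun q => \sum_(i <- r) F i q).
Proof.
move=> sF; elim: r => [|i r IH].
  by under eq_fun do rewrite big_nil; exact: smooth_vfield0.
under eq_fun do rewrite big_cons.
exact: (@smooth_vfieldD (F i) (fun q => \sum_(j <- r) F j q)).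
Qed.

Lemma smooth_vfield_ext X Y : {in O, X =1 Y} ->
  smooth_vfield A O X -> smooth_vfield A O Y.
Proof.
move=> XY /smooth_vfieldP sX; apply/smooth_vfieldP => y i.
apply: smooth_fun_ext (sX y i); first by apply: openI => //; exact: (cdom_open hA).
by move=> q; rewrite inE => -[Oq _]; rewrite XY // inE.
Qed.

End OpenSet.

Lemma smooth_vfield_subset O O1 X : O1 `<=` O ->
  smooth_vfield A O X -> smooth_vfield A O1 X.
Proof.
move=> OO1 sX x y k; apply: class_C_subset (sX x y k) => _ [q [Oq xq yq] <-].
by exists q => //; split=> //; exact: OO1.
Qed.

Lemma smooth_vfield_local O X :
  (forall p, O p -> exists2 Q, smooth_vfield A Q X & Q p) -> smooth_vfield A O X.
Proof.
move=> H x y k; apply: class_C_local => _ [q [Oq xq yq] <-].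
have [Q sQ Qq] := H q Oq.
exists (cmap A x @` [set q | [/\ Q q, cdom A x q & cdom A y q]]); first exact: sQ.
by exists q.
Qed.

(** In another chart the coordinates are directional derivatives of the transition map, which is why
    one more order of smoothness of that map is drawn on. *)
Lemma smooth_const_vfield p v : smooth_vfield A (cdom A p) (const_vfield A p v).
Proof.
apply/(smooth_vfieldP (cdom_open hA p)) => y i.
rewrite setIC; apply: smooth_fun_chart; first exact: (cdom_open hA).
move=> k; have oI : open (cmap A p @` (cdom A y `&` cdom A p)).
  exact/(image_open hA)/(cdom_open hA).
have : class_C k (cmap A p @` (cdom A y `&` cdom A p))
   (fun z => ('D_v (cmap A y \o cinv A p) z) 0 i).
  have /class_CS[_ /(_ v)] : class_C k.+1 (cmap A p @` (cdom A y `&` cdom A p))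
      (cmap A y \o cinv A p) by rewrite setIC; case: hA => _ _; exact.
  by move/(class_C_coordP _ _ oI); apply.
apply: class_C_ext => // z; rewrite inE => -[q [yq pq] <-] /=.
rewrite (cmapK hA pq); congr (_ 0 i).
have [_ ->] := chart_change hA v pq (cdom_refl hA q) (transition_diff hA (cdom_refl hA q) yq).
by [].
Qed.

(* Restating directional derivatives of real functions with values in [R] itself,
   rather than in [R] as a normed module, keeps unification fast. *)
Definition der f p v : R := dfun A f p v.

(** Unlike [der], this stays in the chart at [p] while [q] varies. *)
Definition partial p i f q : R := 'D_(basis_vec i) (f \o cinv A p) (cmap A p q).

Lemma der_frame O f X p q : smooth_fun A O f -> O q -> cdom A p q ->
  der f q (X q) = \sum_i (tocoord A p q (X q)) 0 i * partial p i f q.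
Proof.
move=> sf Oq pq; have [d e] := dfun_chart hA (X q) pq (smooth_mdiff sf Oq).
by rewrite /der e derive_row.
Qed.

Lemma smooth_partial O f p i : open O -> smooth_fun A O f ->
  smooth_fun A (O `&` cdom A p) (partial p i f).
Proof.
move=> oO sf; apply: smooth_fun_chart => // k.
have /class_CS[_ /(_ (basis_vec i))] := sf p k.+1.
apply: class_C_ext; first exact: (image_open hA).
by move=> z; rewrite inE => -[q [_ pq] <-] /=; rewrite /partial /= (cmapK hA pq).
Qed.

(** The value at [q] is taken in the chart at [q], which changes with [q]; [der_frame] rewrites it
    near each point in a single chart. *)
Lemma smooth_der O f X : open O -> smooth_fun A O f -> smooth_vfield A O X ->
  smooth_fun A O (fun q => der f q (X q)).
Proof.
move=> oO sf sX; apply: smooth_fun_local => p Op.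
have oI : open (O `&` cdom A p) by apply: openI => //; exact: (cdom_open hA).
exists (O `&` cdom A p); last by split=> //; exact: (cdom_refl hA).
have s : smooth_fun A (O `&` cdom A p)
    (fun q => \sum_i (tocoord A p q (X q)) 0 i * partial p i f q).
  apply: smooth_sum => // i; apply: smoothM => //; last exact: smooth_partial.
  by move/(smooth_vfieldP oO) : sX.
apply: smooth_fun_ext s => // q; rewrite inE => -[Oq pq].
exact/esym/der_frame.
Qed.

Lemma partial_comm O f p i j : open O -> smooth_fun A O f -> O p ->
  der (partial p i f) p (basis_vec j) = der (partial p j f) p (basis_vec i).
Proof.
move=> oO sf Op.
have H k l : der (partial p k f) p (basis_vec l)
    = 'D_(basis_vec l) ('D_(basis_vec k) (f \o cinv A p)) (cmap A p p).
  apply: near_eq_derive.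
  apply: filterS (near_cinv hA oO Op (cdom_refl hA p)) => z [_ _ zz].
  by rewrite /partial /= zz.
rewrite !H; apply: (@derive_comm _ _ (cmap A p @` (O `&` cdom A p))).
- exact: (image_open hA).
- by exists p => //; split=> //; exact: (cdom_refl hA).
- exact: sf.
Qed.

(** Differentiating [Y f] along [X] gives a first-order part [S], with the derivatives of the
    coordinates of [Y], and a second-order part [T]. The latter is symmetric in the two fields
    because partial derivatives commute; the skew part of the former is the bracket. *)
Lemma der_comm O f X Y p : open O -> smooth_fun A O f ->
  smooth_vfield A O X -> smooth_vfield A O Y -> O p ->
  der (fun q => der f q (Y q)) p (X p) - der (fun q => der f q (X q)) p (Y p)
  = der f p (lie_bracket A X Y p).
Proof.
move=> oO sf sX sY Op; have pp := cdom_refl hA p.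
have dP i : mdiff (A := A) (partial p i f) p.
  by apply: smooth_mdiff (smooth_partial p i oO sf) _.
pose T (Z : M -> 'rV[R]_n) v : R := \sum_i (Z p) 0 i * der (partial p i f) p v.
pose S (Z : M -> 'rV[R]_n) v : R :=
  \sum_i (dfun A (fun q => tocoord A p q (Z q)) p v) 0 i * partial p i f p.
have H Z v : smooth_vfield A O Z ->
    der (fun q => der f q (Z q)) p v = S Z v + T Z v.
  move=> sZ; have dZ := smooth_vfield_diff oO sZ Op.
  have dZi i : mdiff (A := A) (fun q => (tocoord A p q (Z q)) 0 i) p.
    by move/mdiff_coord : dZ.
  have -> : der (fun q => der f q (Z q)) p v =
      der (fun q => \sum_i (tocoord A p q (Z q)) 0 i * partial p i f q) p v.
    apply: (dfun_ext hA); have /filterS : nbhs p (O `&` cdom A p).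
      by apply: open_nbhs_nbhs; split=> //; apply: openI => //; exact: (cdom_open hA).
    by apply=> q [Oq pq]; exact: der_frame pq.
  rewrite /der dfun_sum; last by move=> i; exact: mdiffM.
  rewrite /S /T -big_split /=; apply: eq_bigr => i _.
  by rewrite (dfunM hA) // (dfun_coord v i dZ) (tocoord_id hA).
have e Z v : T Z v = \sum_i \sum_j (Z p) 0 i * v 0 j * der (partial p i f) p (basis_vec j).
  apply: eq_bigr => i _.
  have -> : der (partial p i f) p v
          = \sum_j v 0 j * der (partial p i f) p (basis_vec j).
    exact: (derive_row v (dP i)).
  by rewrite mulr_sumr; apply: eq_bigr => j _; exact: mulrA.
have TT : T X (Y p) = T Y (X p).
  rewrite !e exchange_big; apply: eq_bigr => i _; apply: eq_bigr => j _.
  by rewrite (mulrC (X p 0 j)) (partial_comm j i oO sf Op).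
rewrite (H Y _ sY) (H X _ sX) TT (der_frame (lie_bracket A X Y) sf Op pp).
have alg (a b c : R) : a + c - (b + c) = a - b by rewrite opprD addrACA subrr addr0.
rewrite (tocoord_id hA) alg /S -sumrB.
by apply: eq_bigr => i _; rewrite /lie_bracket !mxE -mulrBl.
Qed.

End SmoothFunctions.
Arguments der {R M n} A f p v.
Arguments partial {R M n} A p i f q.

(** * Connections, and fields along maps *)

Section Der.
Context {R : realType} {M : topologicalType} {n : nat} {A : atlas R M n}.
Context (hA : charted A).
Implicit Types (p q : M) (f h : M -> R).
Local Notation mdiff := (mdiff (A := A)).

Lemma derD f h p v : mdiff f p -> mdiff h p ->
  der A (fun q => f q + h q) p v = der A f p v + der A h p v.
Proof. exact: dfunD. Qed.

Lemma derM f h p v : mdiff f p -> mdiff h p ->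
  der A (fun q => f q * h q) p v = der A f p v * h p + f p * der A h p v.
Proof. exact: (dfunM hA). Qed.

Lemma der_cst (a : R) p v : der A (fun=> a) p v = 0.
Proof. exact: dfun_cst. Qed.

Lemma derB f h p v : mdiff f p -> mdiff h p ->
  der A (fun q => f q - h q) p v = der A f p v - der A h p v.
Proof.
move=> df dh; have -> : (fun q => f q - h q) = (fun q => f q + (-1) * h q).
  by apply/funext => q; rewrite mulN1r.
have dc := mdiff_cst (A := A) (-1 : R) p.
by rewrite derD ?derM ?der_cst ?mul0r ?add0r ?mulN1r //; exact: mdiffM.
Qed.

Lemma mdiffB f h p : mdiff f p -> mdiff h p -> mdiff (fun q => f q - h q) p.
Proof. exact: differentiableB. Qed.

Lemma der_sum I (r : seq I) (F : I -> M -> R) p v : (forall i, mdiff (F i) p) ->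
  der A (fun q => \sum_(i <- r) F i q) p v = \sum_(i <- r) der A (F i) p v.
Proof. exact: dfun_sum. Qed.

Lemma der_ext f h p v : (\forall q \near p, f q = h q) -> der A f p v = der A h p v.
Proof. exact: (dfun_ext hA). Qed.

Lemma der_exp f p v : mdiff f p ->
  der A (fun q => expR (f q)) p v = expR (f p) * der A f p v.
Proof. exact: (dfun_exp hA). Qed.

Lemma dfunZ m f (F : M -> 'rV[R]_m) p v : mdiff f p -> mdiff F p ->
  mdiff (fun q => f q *: F q) p /\
  dfun A (fun q => f q *: F q) p v = der A f p v *: F p + f p *: dfun A F p v.
Proof.
move=> df dF; have dFi i := (mdiff_coord F p).1 dF i.
have d : mdiff (fun q => f q *: F q) p.
  apply/mdiff_coord => i; under eq_fun do rewrite mxE.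
  exact: mdiffM.
split=> //; apply/rowP => i; rewrite (dfun_coord v i d).
under [in LHS]eq_fun do rewrite mxE.
by rewrite [LHS]derM // !mxE (dfun_coord v i dF).
Qed.

End Der.

Lemma bformDl (R : realType) n (B : 'M[R]_n) u v w :
  bform B (u + v) w = bform B u w + bform B v w.
Proof. by rewrite /bform !mulmxDl mxE. Qed.

Lemma bformDr (R : realType) n (B : 'M[R]_n) u v w :
  bform B u (v + w) = bform B u v + bform B u w.
Proof. by rewrite /bform linearD mulmxDr mxE. Qed.

Lemma bformZl (R : realType) n (B : 'M[R]_n) a v w :
  bform B (a *: v) w = a * bform B v w.
Proof. by rewrite /bform -!scalemxAl mxE. Qed.

Lemma bformZr (R : realType) n (B : 'M[R]_n) a v w :
  bform B v (a *: w) = a * bform B v w.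
Proof. by rewrite /bform linearZ -scalemxAr mxE. Qed.

Lemma bform0l (R : realType) n (B : 'M[R]_n) w : bform B 0 w = 0.
Proof. by rewrite /bform !mul0mx mxE. Qed.

Lemma bform0r (R : realType) n (B : 'M[R]_n) w : bform B w 0 = 0.
Proof. by rewrite /bform linear0 mulmx0 mxE. Qed.

Lemma bformNl (R : realType) n (B : 'M[R]_n) v w : bform B (- v) w = - bform B v w.
Proof. by rewrite -scaleN1r bformZl mulN1r. Qed.

Lemma bformNr (R : realType) n (B : 'M[R]_n) v w : bform B v (- w) = - bform B v w.
Proof. by rewrite -scaleN1r bformZr mulN1r. Qed.

Lemma bformBl (R : realType) n (B : 'M[R]_n) u v w :
  bform B (u - v) w = bform B u w - bform B v w.
Proof. by rewrite bformDl bformNl. Qed.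

Lemma bformBr (R : realType) n (B : 'M[R]_n) u v w :
  bform B u (v - w) = bform B u v - bform B u w.
Proof. by rewrite bformDr bformNr. Qed.

Lemma bform_suml (R : realType) n (B : 'M[R]_n) I (r : seq I) (F : I -> 'rV[R]_n) w :
  bform B (\sum_(i <- r) F i) w = \sum_(i <- r) bform B (F i) w.
Proof.
by elim: r => [|i r IH]; rewrite ?big_nil ?bform0l // !big_cons bformDl IH.
Qed.

Lemma bform_sumr (R : realType) n (B : 'M[R]_n) I (r : seq I) (F : I -> 'rV[R]_n) w :
  bform B w (\sum_(i <- r) F i) = \sum_(i <- r) bform B w (F i).
Proof.
by elim: r => [|i r IH]; rewrite ?big_nil ?bform0r // !big_cons bformDr IH.
Qed.

Lemma bform_sym (R : realType) n (B : 'M[R]_n) v w : B^T = B -> bform B v w = bform B w v.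
Proof.
move=> symB; rewrite /bform -[LHS]/((v *m B *m w^T) 0 0).
have -> : v *m B *m w^T = (w *m B *m v^T)^T by rewrite !trmx_mul trmxK symB mulmxA.
by rewrite mxE.
Qed.

Section Connection.
Context {R : realType} {N : topologicalType} {m : nat} {B : atlas R N m}.
Context (hB : charted B) {O : set N} {nt : @covariant R N m}.
Context (cn : connection B O nt).
Implicit Types (P Q : N) (Y Z : N -> 'rV[R]_m) (v w : 'rV[R]_m).

Section OpenSet.
Context {O1 : set N} (oO1 : open O1) (O1O : O1 `<=` O).
Local Notation svf := (smooth_vfield B O1).

Lemma conn_lin P a v w Y : svf Y -> O1 P ->
  nt P (a *: v + w) Y = a *: nt P v Y + nt P w Y.
Proof. by move=> sY O1P; have [H _ _ _] := cn oO1 O1O sY sY; exact: H. Qed.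

Lemma conn0v P Y : svf Y -> O1 P -> nt P 0 Y = 0.
Proof.
move=> sY O1P; have := conn_lin 1 0 0 sY O1P; rewrite !scale1r addr0 => /eqP.
by rewrite eq_sym -subr_eq0 addrK => /eqP.
Qed.

Lemma conn_sumv P I (r : seq I) (c : I -> R) (e : I -> 'rV[R]_m) Y : svf Y -> O1 P ->
  nt P (\sum_(i <- r) c i *: e i) Y = \sum_(i <- r) c i *: nt P (e i) Y.
Proof.
move=> sY O1P; elim: r => [|i r IH]; first by rewrite !big_nil conn0v.
by rewrite !big_cons conn_lin // IH.
Qed.

Lemma connD P v Y Z : svf Y -> svf Z -> O1 P ->
  nt P v (fun q => Y q + Z q) = nt P v Y + nt P v Z.
Proof. by move=> sY sZ O1P; have [_ H _ _] := cn oO1 O1O sY sZ; exact: H. Qed.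

Lemma connZ P v (f : N -> R) Y : smooth_fun B O1 f -> svf Y -> O1 P ->
  nt P v (fun q => f q *: Y q) = der B f P v *: Y P + f P *: nt P v Y.
Proof. by move=> sf sY O1P; have [_ _ H _] := cn oO1 O1O sY sY; exact: H. Qed.

Lemma smooth_cov Y Z : svf Y -> svf Z -> svf (cov nt Y Z).
Proof. by move=> sY sZ; have [_ _ _] := cn oO1 O1O sY sZ. Qed.

(** The difference [D] of the fields vanishes on [O1] and equals [f *: D] for the indicator [f] of
    the complement of [O1]. Both factors vanish on [O1], hence are smooth there, and the Leibniz
    rule gives derivative zero; the indicator takes the place of a bump function. *)
Lemma conn_local P v Y Z : svf Y -> {in O1, Y =1 Z} -> O1 P -> nt P v Y = nt P v Z.
Proof.
move=> sY YZ O1P; pose D q := Z q - Y q.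
have D0 q : O1 q -> D q = 0 by move=> O1q; rewrite /D YZ ?subrr // inE.
pose f q : R := (q \notin O1)%:R.
have f0 q : O1 q -> f q = 0 by rewrite /f -in_setE => ->.
have sD : svf D.
  apply: (smooth_vfield_ext hB oO1) (smooth_vfield0 hB oO1) => q.
  by rewrite inE => /D0 ->.
have sf : smooth_fun B O1 f.
  apply: (smooth_fun_ext hB oO1) (smooth_cst O1 0) => q; rewrite inE => /f0 -> //.
have -> : Z = (fun q => Y q + D q) by apply/funext => q; rewrite addrC subrK.
have fD : D = fun q => f q *: D q.
  apply/funext => q; rewrite /f; case: (boolP (q \in O1)) => [/set_mem/D0 ->|_].
    by rewrite scaler0.
  by rewrite scale1r.
have D0P : nt P v D = 0 by rewrite fD connZ // D0 // f0 // scaler0 scale0r addr0.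
by rewrite connD // D0P addr0.
Qed.

Lemma conn0 P v : O1 P -> nt P v (fun=> 0) = 0.
Proof.
move=> O1P; have s0 := smooth_vfield0 hB oO1.
have := connD v s0 s0 O1P; rewrite (_ : (fun _ : N => 0 + 0) = fun=> 0).
  by move/eqP; rewrite eq_sym -subr_eq0 addrK => /eqP.
by apply/funext => q; rewrite addr0.
Qed.

Lemma conn_sum P v I (r : seq I) (f : I -> N -> R) (F : I -> N -> 'rV[R]_m) :
  (forall i, smooth_fun B O1 (f i)) -> (forall i, svf (F i)) -> O1 P ->
  nt P v (fun q => \sum_(i <- r) f i q *: F i q)
  = \sum_(i <- r) (der B (f i) P v *: F i P + f i P *: nt P v (F i)).
Proof.
move=> sf sF O1P; elim: r => [|i r IH].
  by rewrite big_nil; under eq_fun do rewrite big_nil; exact: conn0.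
rewrite big_cons; under eq_fun do rewrite big_cons.
have sfF j : svf (fun q => f j q *: F j q) by exact: smooth_vfieldZ.
by rewrite (connD _ (sfF i) (smooth_vfield_sum hB oO1 r sfF)) // IH connZ.
Qed.

End OpenSet.

Lemma conn_frame O1 P Q v Y : open O1 -> O1 `<=` O -> smooth_vfield B O1 Y ->
  O1 Q -> cdom B P Q ->
  nt Q v Y = \sum_b (der B (fun q => (tocoord B P q (Y q)) 0 b) Q v
                       *: const_vfield B P (basis_vec b) Q
                     + (tocoord B P Q (Y Q)) 0 b
                       *: nt Q v (const_vfield B P (basis_vec b))).
Proof.
move=> oO1 O1O sY O1Q PQ.
have oI : open (O1 `&` cdom B P) by apply: openI => //; exact: (cdom_open hB).
have IO : O1 `&` cdom B P `<=` O by move=> q [/O1O].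
have IQ : (O1 `&` cdom B P) Q by [].
have sf b : smooth_fun B (O1 `&` cdom B P) (fun q => (tocoord B P q (Y q)) 0 b).
  by move/(smooth_vfieldP hB oO1) : sY; apply.
have sE b : smooth_vfield B (O1 `&` cdom B P) (const_vfield B P (basis_vec b)).
  by apply: (smooth_vfield_subset _ (smooth_const_vfield hB P _)) => q [].
rewrite -(conn_sum oI IO v _ sf sE IQ); apply: (conn_local oI IO _ _ _ IQ).
  by apply: smooth_vfield_subset sY => q [].
by move=> q; rewrite inE => -[_ Pq]; exact: (frame_sum hB).
Qed.

Lemma lie_bracket_const P v w :
  lie_bracket B (const_vfield B P v) (const_vfield B P w) P = 0.
Proof.
have H u z : dfun B (fun q => tocoord B P q (const_vfield B P u q)) P z = 0.
  rewrite (dfun_ext hB (h := fun=> u)) ?dfun_cst //.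
  have /filterS : nbhs P (cdom B P).
    by apply: open_nbhs_nbhs; split; [exact: (cdom_open hB)|exact: (cdom_refl hB)].
  by apply=> q Pq; exact: (const_vfieldK hB).
rewrite /lie_bracket -[RHS](subrr 0); congr (_ - _); exact: H.
Qed.

(** Constant-coordinate fields have constant coefficients and vanishing brackets, so only second
    covariant derivatives of frame fields remain. The skewness is left in the coefficients, so that
    these terms match the double derivatives along a map one by one. *)
Lemma curv_frame P u v w : O P -> open O ->
  curv B nt P u v w = \sum_a \sum_b \sum_c
    (w 0 a * (v 0 b * u 0 c) - w 0 a * (u 0 b * v 0 c)) *:
      nt P (basis_vec c) (cov nt (const_vfield B P (basis_vec b))
                                 (const_vfield B P (basis_vec a))).
Proof.
move=> OP oO; have PP := cdom_refl hB P.
have oI : open (O `&` cdom B P) by apply: openI => //; exact: (cdom_open hB).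
have IO : O `&` cdom B P `<=` O by move=> q [].
have IP : (O `&` cdom B P) P by [].
have sE x : smooth_vfield B (O `&` cdom B P) (const_vfield B P x).
  by apply: (smooth_vfield_subset _ (smooth_const_vfield hB P x)) => q [].
pose E (a : 'I_m) := const_vfield B P (basis_vec a).
have sZ b a : smooth_vfield B (O `&` cdom B P) (cov nt (E b) (E a)).
  exact: (smooth_cov oI IO (sE _) (sE _)).
have covE x y Q : (O `&` cdom B P) Q ->
    cov nt (const_vfield B P x) (const_vfield B P y) Q
    = \sum_a \sum_b (y 0 a * x 0 b) *: cov nt (E b) (E a) Q.
  move=> IQ; have [OQ PQ] := IQ.
  have e : {in O `&` cdom B P, const_vfield B P y =1 fun q => \sum_a y 0 a *: E a q}.
    by move=> q; rewrite inE => -[_ Pq]; exact: (const_vfield_sum hB).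
  rewrite /cov (conn_local oI IO _ (sE y) e IQ).
  have sy a : smooth_fun B (O `&` cdom B P) (fun=> y 0 a) by exact: smooth_cst.
  rewrite (conn_sum oI IO _ _ sy (fun a => sE _) IQ); apply: eq_bigr => a _.
  rewrite der_cst scale0r add0r (const_vfield_sum hB x PQ).
  rewrite (conn_sumv oI IO _ _ _ (sE _) IQ) scaler_sumr; apply: eq_bigr => b _.
  by rewrite scalerA.
have H x y z : nt P x (cov nt (const_vfield B P y) (const_vfield B P z))
    = \sum_a \sum_b \sum_c (z 0 a * (y 0 b * x 0 c)) *: nt P (basis_vec c) (cov nt (E b) (E a)).
  have sS a : smooth_vfield B (O `&` cdom B P)
      (fun Q => \sum_b (z 0 a * y 0 b) *: cov nt (E b) (E a) Q).
    apply: (smooth_vfield_sum hB oI) => b.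
    by apply: (smooth_vfieldZ hB oI) => //; exact: smooth_cst.
  have e : {in O `&` cdom B P, cov nt (const_vfield B P y) (const_vfield B P z) =1
      fun q => \sum_a 1 *: (\sum_b (z 0 a * y 0 b) *: cov nt (E b) (E a) q)}.
    by move=> q /set_mem/covE ->; apply: eq_bigr => a _; rewrite scale1r.
  rewrite (conn_local oI IO x (smooth_cov oI IO (sE y) (sE z)) e IP).
  rewrite (conn_sum oI IO x _ (fun _ => smooth_cst _ (1 : R)) sS IP).
  apply: eq_bigr => a _; rewrite der_cst scale0r add0r scale1r.
  rewrite (conn_sum oI IO x _ (fun b => smooth_cst _ (z 0 a * y 0 b)) (fun b => sZ b a) IP).
  apply: eq_bigr => b _; rewrite der_cst scale0r add0r {1}[x]row_sum_delta.
  rewrite (conn_sumv oI IO _ _ _ (sZ b a) IP) scaler_sumr; apply: eq_bigr => c _.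
  by rewrite scalerA mulrA.
have -> : curv B nt P u v w = nt P u (cov nt (const_vfield B P v) (const_vfield B P w))
    - nt P v (cov nt (const_vfield B P u) (const_vfield B P w)).
  rewrite /curv /curvature /(cov nt (lie_bracket _ _ _)) lie_bracket_const.
  rewrite (conn0v oI IO (sE w) IP) subr0; congr (_ - _); rewrite /cov.
    by rewrite (const_vfield_id hB).
  by rewrite (const_vfield_id hB).
rewrite (H u v w) (H v u w) -sumrB; apply: eq_bigr => a _.
rewrite -sumrB; apply: eq_bigr => b _; rewrite -sumrB; apply: eq_bigr => c _.
by rewrite scalerBl.
Qed.

End Connection.

(** * Fields along a smooth map and the induced connection *)

Definition smooth_map (R : realType) (M N : topologicalType) n m
    (A : atlas R M n) (B : atlas R N m) (Psi : M -> N) :=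
  continuous Psi /\ forall y i,
    smooth_fun A (Psi @^-1` cdom B y) (fun q => (cmap B y (Psi q)) 0 i).

Definition along_coord (R : realType) (M N : topologicalType) m (B : atlas R N m)
    (Psi : M -> N) (y : N) (Y : M -> 'rV[R]_m) (b : 'I_m) (q : M) : R :=
  (tocoord B y (Psi q) (Y q)) 0 b.

(** The components are those in the chart at [Psi p], in which [cov_along] at [p] is defined. *)
Definition along_diff (R : realType) (M N : topologicalType) n m
    (A : atlas R M n) (B : atlas R N m) (Psi : M -> N) (Y : M -> 'rV[R]_m) p :=
  mdiff (A := A) (fun q => tocoord B (Psi p) (Psi q) (Y q)) p.

Section Along.
Context {R : realType} {M N : topologicalType} {n m : nat}.
Context {A : atlas R M n} {B : atlas R N m} (hA : charted A) (hB : charted B).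
Context {O : set N} (oO : open O) {nt : @covariant R N m} (cn : connection B O nt).
Context {Psi : M -> N} (sPsi : smooth_map A B Psi) (PsiO : forall q, O (Psi q)).
Implicit Types (p q : M) (v w : 'rV[R]_n) (Y Z : M -> 'rV[R]_m).
Local Notation T := (tmap A B Psi).
Local Notation ca := (cov_along A B nt Psi).
Local Notation E y a := (const_vfield B y (basis_vec a)).
Local Notation comp := (along_coord B Psi).
Local Notation along_diff := (along_diff A B Psi).

Lemma along_open y : open (Psi @^-1` cdom B y).
Proof.
case: sPsi => cP _; apply: open_comp; first by move=> q _; exact: cP.
exact: (cdom_open hB).
Qed.

Lemma along_near y q : cdom B y (Psi q) -> \forall q' \near q, cdom B y (Psi q').
Proof. by move=> yq; apply: open_nbhs_nbhs; split; [exact: along_open|]. Qed.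

Lemma mdiff_map y q : cdom B y (Psi q) ->
  mdiff (A := A) (fun q' => cmap B y (Psi q')) q.
Proof.
move=> yq; apply/mdiff_coord => i; case: sPsi => _ sP.
exact: (smooth_mdiff hA (sP y i)).
Qed.

Lemma dfun_along (W : normedModType R) (F : N -> W) p v :
  mdiff (A := B) F (Psi p) ->
  mdiff (A := A) (fun q => F (Psi q)) p /\
  dfun A (fun q => F (Psi q)) p v = dfun B F (Psi p) (T p v).
Proof.
move=> dF; set P := Psi p; have PP := cdom_refl hB P.
have nF : \forall z \near cmap A p p,
    ((F \o cinv B P) \o (cmap B P \o Psi \o cinv A p)) z
    = ((fun q => F (Psi q)) \o cinv A p) z.
  have := near_chart hA (along_near PP).
  by apply: filterS => z Pz /=; rewrite (cmapK hB Pz).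
have dP : differentiable (cmap B P \o Psi \o cinv A p) (cmap A p p).
  exact: (mdiff_map PP).
have e : (cmap B P \o Psi \o cinv A p) (cmap A p p) = cmap B P P.
  by rewrite /= (cmapK hA (cdom_refl hA p)).
have dF' : differentiable (F \o cinv B P) ((cmap B P \o Psi \o cinv A p) (cmap A p p)).
  by rewrite e.
split; first exact: near_eq_differentiable nF (differentiable_comp dP dF').
by rewrite /dfun -(near_eq_derive v nF) (derive_comp_diff v dP dF') e.
Qed.

Lemma mdiff_cmap y Q : cdom B y Q -> mdiff (A := B) (cmap B y) Q.
Proof. by move=> yQ; apply: (transition_diff hB) => //; exact: (cdom_refl hB). Qed.

Lemma tmap_coord y q v b : cdom B y (Psi q) ->
  (tocoord B y (Psi q) (T q v)) 0 b = der A (fun q' => (cmap B y (Psi q')) 0 b) q v.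
Proof.
move=> yq; have [d e] := dfun_along v (mdiff_cmap yq).
by rewrite -[tocoord _ _ _ _]/(dfun B (cmap B y) (Psi q) (T q v)) -e dfun_coord.
Qed.

Lemma tmap_lin q a v w : T q (a *: v + w) = a *: T q v + T q w.
Proof. by apply: (derive_lin _ _ _ (mdiff_map _)); exact: (cdom_refl hB). Qed.

Lemma chart_set y : [/\ open (O `&` cdom B y), O `&` cdom B y `<=` O &
  forall a, smooth_vfield B (O `&` cdom B y) (E y a)].
Proof.
split; [by apply: openI => //; exact: (cdom_open hB)|by move=> q []|move=> a].
by apply: (smooth_vfield_subset _ (smooth_const_vfield hB y _)) => q [].
Qed.

Lemma cov_along_lin p a v w Y : along_diff Y p ->
  ca p (a *: v + w) Y = a *: ca p v Y + ca p w Y.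
Proof.
move=> dY; rewrite /cov_along (dfun_lin _ _ _ dY) scalerDr addrACA; congr (_ + _).
rewrite scaler_sumr -big_split /=; apply: eq_bigr => i _.
have [oI IO sE] := chart_set (Psi p).
have IP : (O `&` cdom B (Psi p)) (Psi p) by split=> //; exact: (cdom_refl hB).
by rewrite tmap_lin (conn_lin cn oI IO a _ _ (sE i) IP) scalerDr !scalerA mulrC.
Qed.

Lemma cov_along0v p Y : along_diff Y p -> ca p 0 Y = 0.
Proof.
move=> dY; have := cov_along_lin 1 0 0 dY; rewrite !scale1r addr0 => /eqP.
by rewrite eq_sym -subr_eq0 addrK => /eqP.
Qed.

Lemma cov_along_ext p v Y Z : (\forall q \near p, Y q = Z q) -> ca p v Y = ca p v Z.
Proof.
move=> YZ; have e : Y p = Z p := nbhs_singleton YZ.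
have nYZ : \forall q \near p,
    tocoord B (Psi p) (Psi q) (Y q) = tocoord B (Psi p) (Psi q) (Z q).
  by apply: filterS YZ => q ->.
by rewrite /cov_along e (dfun_ext hA v nYZ).
Qed.

Lemma along_diff_ext p Y Z : (\forall q \near p, Y q = Z q) ->
  along_diff Y p -> along_diff Z p.
Proof. by move=> YZ; apply: (mdiff_ext hA); apply: filterS YZ => q ->. Qed.

Lemma along_diffD p Y Z : along_diff Y p -> along_diff Z p ->
  along_diff (fun q => Y q + Z q) p.
Proof.
move=> dY dZ; apply: (mdiff_ext hA _ (mdiffD dY dZ)).
apply: filterS (along_near (cdom_refl hB (Psi p))) => q Pq.
by rewrite (tocoordD hB).
Qed.

Lemma cov_alongD p v Y Z : along_diff Y p -> along_diff Z p ->
  ca p v (fun q => Y q + Z q) = ca p v Y + ca p v Z.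
Proof.
move=> dY dZ; rewrite /cov_along.
rewrite (@dfun_ext _ _ _ _ hA _ _ (fun q => tocoord B (Psi p) (Psi q) (Y q)
    + tocoord B (Psi p) (Psi q) (Z q))).
  rewrite (dfunD v dY dZ) addrACA -big_split /=; congr (_ + _).
  by apply: eq_bigr => i _; rewrite mxE scalerDl.
apply: filterS (along_near (cdom_refl hB (Psi p))) => q Pq.
by rewrite (tocoordD hB).
Qed.

Lemma cov_alongZ p v (f : M -> R) Y : mdiff (A := A) f p -> along_diff Y p ->
  along_diff (fun q => f q *: Y q) p /\
  ca p v (fun q => f q *: Y q) = der A f p v *: Y p + f p *: ca p v Y.
Proof.
move=> df dY; have [d e] := dfunZ hA v df dY.
have nZ : \forall q \near p, f q *: tocoord B (Psi p) (Psi q) (Y q)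
                           = tocoord B (Psi p) (Psi q) (f q *: Y q).
  apply: filterS (along_near (cdom_refl hB (Psi p))) => q Pq.
  by rewrite (tocoordZ hB).
split; first exact: (mdiff_ext hA nZ d).
rewrite /cov_along -(dfun_ext hA v nZ) e (tocoord_id hB) scalerDr addrA.
rewrite scaler_sumr; congr (_ + _); apply: eq_bigr => i _.
by rewrite mxE scalerA.
Qed.

Lemma along_diff0 p : along_diff (fun=> 0) p.
Proof.
apply: (mdiff_ext hA _ (mdiff_cst 0 p)).
by apply: filterE => q; rewrite tocoord0.
Qed.

Lemma cov_along0 p v : ca p v (fun=> 0) = 0.
Proof.
rewrite /cov_along big1 ?addr0; last by move=> i _; rewrite mxE scale0r.
rewrite (@dfun_ext _ _ _ _ hA _ _ (fun=> 0)) ?dfun_cst //.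
by apply: filterE => q; rewrite tocoord0.
Qed.

Lemma along_diff_sum p I (r : seq I) (F : I -> M -> 'rV[R]_m) :
  (forall i, along_diff (F i) p) -> along_diff (fun q => \sum_(i <- r) F i q) p.
Proof.
move=> dF; elim: r => [|i r IH].
  by under eq_fun do rewrite big_nil; exact: along_diff0.
under eq_fun do rewrite big_cons.
exact: (along_diffD (dF i) IH).
Qed.

Lemma cov_along_sum p v I (r : seq I) (F : I -> M -> 'rV[R]_m) :
  (forall i, along_diff (F i) p) ->
  ca p v (fun q => \sum_(i <- r) F i q) = \sum_(i <- r) ca p v (F i).
Proof.
move=> dF; elim: r => [|i r IH].
  by rewrite big_nil; under eq_fun do rewrite big_nil; exact: cov_along0.
rewrite big_cons; under eq_fun do rewrite big_cons.
by rewrite (cov_alongD v (dF i) (along_diff_sum r dF)) IH.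
Qed.

(** This, with the Leibniz rule, characterizes the induced connection: on restrictions of ambient
    fields it is the ambient derivative, and every field along [Psi] is a combination of such
    restrictions near a point. *)
Lemma cov_along_comp O1 p v (Z : N -> 'rV[R]_m) : open O1 -> O1 `<=` O ->
  smooth_vfield B O1 Z -> O1 (Psi p) ->
  along_diff (fun q => Z (Psi q)) p /\
  ca p v (fun q => Z (Psi q)) = nt (Psi p) (T p v) Z.
Proof.
move=> oO1 O1O sZ O1p; set P := Psi p.
have dZ := smooth_vfield_diff hB oO1 sZ O1p.
have [d e] := dfun_along v dZ; split; first exact: d.
rewrite (conn_frame hB cn (T p v) oO1 O1O sZ O1p (cdom_refl hB P)) /cov_along e.
rewrite big_split /=; congr (_ + _); last first.
  by apply: eq_bigr => b _; rewrite (tocoord_id hB).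
rewrite [LHS]row_sum_delta; apply: eq_bigr => b _.
by rewrite (const_vfield_id hB) (dfun_coord _ _ dZ).
Qed.

Section Frame.
Context {y : N} {q : M} (yq : cdom B y (Psi q)) {Y : M -> 'rV[R]_m}.
Context (dY : forall b, mdiff (A := A) (comp y Y b) q).

(** [cov_along] at [q] is defined in the chart at [Psi q]; the same formula holds in any chart [y]
    around [Psi q]. Only with a frame fixed near the point can [q |-> ca q (X q) Y] be
    differentiated again. *)
Lemma cov_along_frame v :
  along_diff Y q /\
  ca q v Y = \sum_a (der A (comp y Y a) q v *: E y a (Psi q)
                     + comp y Y a q *: nt (Psi q) (T q v) (E y a)).
Proof.
have [oI IO sE] := chart_set y; have Iq : (O `&` cdom B y) (Psi q) by [].
have H a : along_diff (fun q' => comp y Y a q' *: E y a (Psi q')) q /\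
    ca q v (fun q' => comp y Y a q' *: E y a (Psi q'))
    = der A (comp y Y a) q v *: E y a (Psi q)
                     + comp y Y a q *: nt (Psi q) (T q v) (E y a).
  have [d e] := cov_along_comp v oI IO (sE a) Iq.
  by have [d' ->] := cov_alongZ v (dY a) d; rewrite e.
have nY : \forall q' \near q, \sum_a comp y Y a q' *: E y a (Psi q') = Y q'.
  by apply: filterS (along_near yq) => q' yq'; rewrite -(frame_sum hB).
have dS := @along_diff_sum q _ (index_enum _) _ (fun a => (H a).1).
split; first exact: along_diff_ext nY dS.
rewrite -(cov_along_ext v nY) cov_along_sum; last by move=> a; exact: (H a).1.
by apply: eq_bigr => a _; exact: (H a).2.
Qed.

End Frame.

Lemma along_diff_comp p Y b : along_diff Y p ->
  mdiff (A := A) (comp (Psi p) Y b) p.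
Proof. by move=> dY; exact: ((mdiff_coord _ _).1 dY b). Qed.

Lemma along_diffP y q Y : cdom B y (Psi q) ->
  (forall b, mdiff (A := A) (comp y Y b) q) -> along_diff Y q.
Proof. by move=> yq dY; have [] := cov_along_frame yq dY 0. Qed.

Lemma tmap_frame y q v : cdom B y (Psi q) ->
  T q v = \sum_b der A (fun q' => (cmap B y (Psi q')) 0 b) q v *: E y b (Psi q).
Proof.
move=> yq; rewrite {1}(frame_sum hB (T q v) yq); apply: eq_bigr => b _.
by rewrite tmap_coord.
Qed.

Lemma nt_tmap y q v (Z : N -> 'rV[R]_m) : cdom B y (Psi q) ->
  smooth_vfield B (O `&` cdom B y) Z ->
  nt (Psi q) (T q v) Z =
  \sum_b der A (fun q' => (cmap B y (Psi q')) 0 b) q v *: cov nt (E y b) Z (Psi q).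
Proof.
move=> yq sZ; have [oI IO _] := chart_set y.
by rewrite (tmap_frame v yq) (conn_sumv cn oI IO _ _ _ sZ) //; split=> //; exact: PsiO.
Qed.

End Along.

Section AlongMetric.
Context {R : realType} {M N : topologicalType} {n m : nat}.
Context {A : atlas R M n} {B : atlas R N m} (hA : charted A) (hB : charted B).
Context {O : set N} (oO : open O) {gt : N -> 'M[R]_m} {nt : @covariant R N m}.
Context (lc : levi_civita B O gt nt).
Context {Psi : M -> N} (sPsi : smooth_map A B Psi) (PsiO : forall q, O (Psi q)).
Implicit Types (p q : M) (v w : 'rV[R]_n) (Y Z : M -> 'rV[R]_m).
Local Notation T := (tmap A B Psi).
Local Notation ca := (cov_along A B nt Psi).
Local Notation E y a := (const_vfield B y (basis_vec a)).
Local Notation comp := (along_coord B Psi).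
Local Notation along_diff := (along_diff A B Psi).

Lemma levi_civita_connection : connection B O nt. Proof. by case: lc. Qed.
Let cn := levi_civita_connection.

(** In the frame at [Psi p] the product is a combination of Gram functions, which live on [N], so
    the ambient compatibility applies to them. Their differentiability is a separate hypothesis
    because [levi_civita] only states the values of derivatives. *)
Lemma cov_along_metric p v Y Z :
  (forall a b, mdiff (A := B)
     (fun Q => bform (gt Q) (E (Psi p) a Q) (E (Psi p) b Q)) (Psi p)) ->
  along_diff Y p -> along_diff Z p ->
  mdiff (A := A) (fun q => bform (gt (Psi q)) (Y q) (Z q)) p /\
  der A (fun q => bform (gt (Psi q)) (Y q) (Z q)) p v
  = bform (gt (Psi p)) (ca p v Y) (Z p) + bform (gt (Psi p)) (Y p) (ca p v Z).
Proof.
set P := Psi p => dG dY dZ; have PP := cdom_refl hB P.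
have [oI IO sE] := chart_set hB oO P.
have IP : (O `&` cdom B P) P by split=> //; exact: PsiO.
pose G a b q := bform (gt (Psi q)) (E P a (Psi q)) (E P b (Psi q)).
have dY' := along_diff_comp _ dY; have dZ' := along_diff_comp _ dZ.
have HG a b : mdiff (A := A) (G a b) p /\ der A (G a b) p v
    = bform (gt P) (nt P (T p v) (E P a)) (E P b P)
      + bform (gt P) (E P a P) (nt P (T p v) (E P b)).
  have [d e] := dfun_along hA hB sPsi v (dG a b); split; first exact: d.
  have [_ H] := lc; have [_ /(_ (T p v)) h] := H _ oI IO _ _ (sE a) (sE b) P IP.
  by rewrite -[RHS]h; exact: e.
have nG : \forall q \near p, \sum_a \sum_b (comp P Y a q * comp P Z b q) * G a b q
    = bform (gt (Psi q)) (Y q) (Z q).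
  apply: filterS (along_near hB sPsi PP) => q Pq.
  rewrite [in RHS](frame_sum hB (Y q) Pq) [in RHS](frame_sum hB (Z q) Pq).
  rewrite bform_suml; apply: eq_bigr => a _; rewrite bform_sumr.
  apply: eq_bigr => b _; rewrite bformZl bformZr mulrA.
  by [].
have dG' a b := (HG a b).1.
have dYZ a b : mdiff (A := A) (fun q => comp P Y a q * comp P Z b q) p.
  exact: mdiffM (dY' a) (dZ' b).
have dYZG a b := mdiffM (dYZ a b) (dG' a b).
have dS a := mdiff_sum (index_enum _) (dYZG a).
split; first exact: (mdiff_ext hA nG (mdiff_sum _ dS)).
rewrite -(der_ext hA v nG) der_sum //.
have [_ ->] := cov_along_frame hA hB oO cn sPsi PsiO PP dY' v.
have [_ ->] := cov_along_frame hA hB oO cn sPsi PsiO PP dZ' v.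
rewrite (frame_sum hB (Y p) PP) (frame_sum hB (Z p) PP).
rewrite !bform_suml -big_split; apply: eq_bigr => a _ /=.
rewrite !bform_sumr -big_split der_sum //; apply: eq_bigr => b _ /=.
rewrite (derM hA v (dYZ a b) (dG' a b)) (derM hA v (dY' a) (dZ' b)) (HG a b).2.
rewrite !bformDl !bformDr !bformZl !bformZr.
rewrite /G -/P -/(along_coord B Psi P Y a p) -/(along_coord B Psi P Z b p).
move: (der A _ _ _) (der A _ _ _) (comp _ _ _ _) (comp _ _ _ _) => y' z' y z.
move: (bform _ _ _) (bform _ _ _) (bform _ _ _) => g1 g2 g3.
ring.
Qed.

Lemma levi_civita_frame P a b : O P ->
  cov nt (E P a) (E P b) P = cov nt (E P b) (E P a) P.
Proof.
move=> OP; have [oI IO sE] := chart_set hB oO P; have [_ H] := lc.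
have IP : (O `&` cdom B P) P by split=> //; exact: (cdom_refl hB).
have [+ _] := H _ oI IO _ _ (sE a) (sE b) P IP.
by rewrite (lie_bracket_const hB) => /eqP; rewrite subr_eq0 => /eqP.
Qed.

Section Fields.
Context {O0 : set M} (oO0 : open O0).
Context {U V : M -> 'rV[R]_n} (sU : smooth_vfield A O0 U) (sV : smooth_vfield A O0 V).
Context {p : M} (O0p : O0 p).
Local Notation P := (Psi p).
Local Notation tau X b := (fun q => der A (fun q' => (cmap B P (Psi q')) 0 b) q (X q)).
Let O2 := O0 `&` Psi @^-1` cdom B P.

Lemma along_set : [/\ open O2, O2 p &
  forall b, smooth_fun A O2 (fun q => (cmap B P (Psi q)) 0 b)].
Proof.
split; first by apply: openI => //; exact: (along_open hB sPsi).
  by split=> //; exact: (cdom_refl hB).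
by move=> b; case: sPsi => _ /(_ P b); apply: smooth_fun_subset => q [].
Qed.

Lemma smooth_tau X b : smooth_vfield A O0 X -> smooth_fun A O2 (tau X b).
Proof.
move=> sX; have [oO2 _ sc] := along_set.
have sX2 : smooth_vfield A O2 X by apply: smooth_vfield_subset sX => q [].
exact: (smooth_der hA oO2 (sc b) sX2).
Qed.

Lemma along_coord_tmap X : smooth_vfield A O0 X ->
  forall b, smooth_fun A O2 (comp P (fun q => T q (X q)) b).
Proof.
move=> sX b; have [oO2 _ _] := along_set.
apply: (smooth_fun_ext hA oO2) (smooth_tau b sX) => q; rewrite inE => -[_ Pq].
by rewrite /along_coord (tmap_coord hA hB sPsi).
Qed.

(** The components of [T V] are the derivatives along [V] of the coordinates of [Psi]. Their skew
    second derivatives give [T] of the bracket by [der_comm], and the connection terms cancel by the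
    symmetry of the Christoffel symbols. *)
Lemma cov_along_torsion :
  ca p (U p) (fun q => T q (V q)) - ca p (V p) (fun q => T q (U q))
  = T p (lie_bracket A U V p).
Proof.
have PP := cdom_refl hB P; have [oO2 O2p sc] := along_set.
have [oI IO sE] := chart_set hB oO P.
have H X v : smooth_vfield A O0 X -> ca p v (fun q => T q (X q)) =
    \sum_b der A (tau X b) p v *: E P b P
    + \sum_b \sum_c (tau X b p * der A (fun q => (cmap B P (Psi q)) 0 c) p v)
               *: cov nt (E P c) (E P b) P.
  move=> sX; have dX b := smooth_mdiff hA (along_coord_tmap sX b) O2p.
  have [_ ->] := cov_along_frame hA hB oO cn sPsi PsiO PP dX v.
  rewrite big_split /=; congr (_ + _); apply: eq_bigr => b _.
    congr (_ *: _); apply: (der_ext hA).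
    apply: filterS (along_near hB sPsi PP) => q Pq.
    by rewrite /along_coord (tmap_coord hA hB sPsi).
  rewrite (nt_tmap hA hB oO cn sPsi PsiO v PP (sE b)) scaler_sumr; apply: eq_bigr => c _.
  by rewrite scalerA /along_coord (tmap_coord hA hB sPsi).
rewrite (H V (U p) sV) (H U (V p) sU) opprD addrACA -sumrB.
rewrite [X in _ + (_ - X)]exchange_big -sumrB [X in _ + X]big1 ?addr0.
  rewrite (tmap_frame hA hB sPsi _ PP); apply: eq_bigr => b _; rewrite -scalerBl; congr (_ *: _).
  have sU2 : smooth_vfield A O2 U by apply: smooth_vfield_subset sU => q [].
  have sV2 : smooth_vfield A O2 V by apply: smooth_vfield_subset sV => q [].
  exact: (der_comm hA oO2 (sc b) sU2 sV2 O2p).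
move=> b _; rewrite -sumrB big1 // => c _.
by rewrite (levi_civita_frame b c (PsiO p)) mulrC subrr.
Qed.

End Fields.
End AlongMetric.

(** * Curvature along a map *)

Lemma row_alg1 (R : realType) m (f1 f2 : R) (e S1 S2 S3 : 'rV[R]_m) :
  f1 *: e + S1 - (f2 *: e + S2) - ((f1 - f2) *: e + S3) = S1 - S2 - S3.
Proof. by apply/rowP => k; rewrite !mxE; ring. Qed.

Lemma row_alg2 (R : realType) m (k1 k2 y l : R) (e S1 S2 : 'rV[R]_m) :
  k1 - k2 = y * l -> k1 *: e + S1 - (k2 *: e + S2) - y *: (l *: e) = S1 - S2.
Proof.
move=> h; have -> : k1 = k2 + y * l by rewrite -h addrC subrK.
by apply/rowP => k; rewrite !mxE; ring.
Qed.

Section AlongCurvature.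
Context {R : realType} {M N : topologicalType} {n m : nat}.
Context {A : atlas R M n} {B : atlas R N m} (hA : charted A) (hB : charted B).
Context {O : set N} (oO : open O) {nt : @covariant R N m} (cn : connection B O nt).
Context {Psi : M -> N} (sPsi : smooth_map A B Psi) (PsiO : forall q, O (Psi q)).
Implicit Types (p q : M) (v w : 'rV[R]_n).
Local Notation T := (tmap A B Psi).
Local Notation ca := (cov_along A B nt Psi).
Local Notation E y a := (const_vfield B y (basis_vec a)).
Local Notation comp := (along_coord B Psi).
Local Notation along_diff := (along_diff A B Psi).

Context {O0 : set M} (oO0 : open O0) {p : M} (O0p : O0 p) {Y : M -> 'rV[R]_m}.
Local Notation P := (Psi p).
Context (sY : forall b, smooth_fun A (O0 `&` Psi @^-1` cdom B P) (comp P Y b)).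
Let O2 := O0 `&` Psi @^-1` cdom B P.
Let cm b q := (cmap B P (Psi q)) 0 b.
Let Zf b a := cov nt (E P b) (E P a).

(** Near [p] the inner derivative is written in the frame at [Psi p] and differentiated by the
    Leibniz rule. The products of first derivatives of [Y] and of [Psi] come in a pair symmetric in
    [v] and [X p]. *)
Lemma cov_along_twice X v : smooth_vfield A O0 X ->
  along_diff (fun q => ca q (X q) Y) p /\
  ca p v (fun q => ca q (X q) Y) =
  \sum_a (der A (fun q => der A (comp P Y a) q (X q)) p v *: E P a P
    + \sum_b ((der A (comp P Y a) p (X p) * der A (cm b) p v
               + (der A (comp P Y a) p v * der A (cm b) p (X p)
               + comp P Y a p * der A (fun q => der A (cm b) q (X q)) p v))
                *: Zf b a P
              + \sum_c (comp P Y a p * (der A (cm b) p (X p) * der A (cm c) p v))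
                  *: nt P (basis_vec c) (Zf b a))).
Proof.
move=> sX; have PP := cdom_refl hB P.
have [oI IO sE] := chart_set hB oO P.
have IP : (O `&` cdom B P) P by split=> //; exact: PsiO.
have [oO2 O2p sc] := along_set hB sPsi oO0 O0p.
have sX2 : smooth_vfield A O2 X by apply: smooth_vfield_subset sX => q [].
have sZ b a : smooth_vfield B (O `&` cdom B P) (Zf b a).
  exact: (smooth_cov cn oI IO (sE b) (sE a)).
pose f a q := der A (comp P Y a) q (X q).
pose t b q := der A (cm b) q (X q).
have sf a : smooth_fun A O2 (f a) by exact: (smooth_der hA oO2 (sY a) sX2).
have st b : smooth_fun A O2 (t b) by exact: (smooth_der hA oO2 (sc b) sX2).
have df a := smooth_mdiff hA (sf a) O2p.
have dt b := smooth_mdiff hA (st b) O2p.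
have dy a := smooth_mdiff hA (sY a) O2p.
have nF : \forall q \near p, \sum_a (f a q *: E P a (Psi q)
    + \sum_b (comp P Y a q * t b q) *: Zf b a (Psi q)) = ca q (X q) Y.
  have nO2 : \forall q \near p, O2 q by exact: open_nbhs_nbhs.
  apply: filterS nO2 => q O2q; have [_ Pq] := O2q.
  have dyq a := smooth_mdiff hA (sY a) O2q.
  have [_ ->] := cov_along_frame hA hB oO cn sPsi PsiO Pq dyq (X q).
  apply: eq_bigr => a _; congr (_ + _).
  rewrite (nt_tmap hA hB oO cn sPsi PsiO (X q) Pq (sE a)) scaler_sumr.
  by apply: eq_bigr => b _; rewrite scalerA.
have dE a : along_diff (fun q => E P a (Psi q)) p.
  exact: (cov_along_comp hA hB cn sPsi v oI IO (sE a) IP).1.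
have eE a : ca p v (fun q => E P a (Psi q)) = \sum_b der A (cm b) p v *: Zf b a P.
  rewrite (cov_along_comp hA hB cn sPsi v oI IO (sE a) IP).2.
  exact: (nt_tmap hA hB oO cn sPsi PsiO v PP (sE a)).
have dZ b a : along_diff (fun q => Zf b a (Psi q)) p.
  exact: (cov_along_comp hA hB cn sPsi v oI IO (sZ b a) IP).1.
have eZ b a : ca p v (fun q => Zf b a (Psi q))
    = \sum_c der A (cm c) p v *: nt P (basis_vec c) (Zf b a).
  rewrite (cov_along_comp hA hB cn sPsi v oI IO (sZ b a) IP).2.
  rewrite (nt_tmap hA hB oO cn sPsi PsiO v PP (sZ b a)).
  by apply: eq_bigr => c _; rewrite /cov (const_vfield_id hB).
have [dfE efE] : (forall a, along_diff (fun q => f a q *: E P a (Psi q)) p) /\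
    forall a, ca p v (fun q => f a q *: E P a (Psi q)) =
      der A (f a) p v *: E P a P + f a p *: \sum_b der A (cm b) p v *: Zf b a P.
  split=> a; first exact: (cov_alongZ hA hB sPsi v (df a) (dE a)).1.
  by rewrite (cov_alongZ hA hB sPsi v (df a) (dE a)).2 eE.
have dyt a b : mdiff (A := A) (fun q => comp P Y a q * t b q) p.
  exact: mdiffM (dy a) (dt b).
have [dgZ egZ] : (forall a b, along_diff
       (fun q => (comp P Y a q * t b q) *: Zf b a (Psi q)) p) /\
    forall a b, ca p v (fun q => (comp P Y a q * t b q) *: Zf b a (Psi q)) =
      (der A (comp P Y a) p v * t b p + comp P Y a p * der A (t b) p v) *: Zf b a P
      + (comp P Y a p * t b p) *: \sum_c der A (cm c) p v *: nt P (basis_vec c) (Zf b a).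
  split=> a b; first exact: (cov_alongZ hA hB sPsi v (dyt a b) (dZ b a)).1.
  rewrite (cov_alongZ hA hB sPsi v (dyt a b) (dZ b a)).2 eZ.
  by rewrite (derM hA v (dy a) (dt b)).
have dS a := along_diff_sum hA hB sPsi (index_enum _) (dgZ a).
have dT a := along_diffD hA hB sPsi (dfE a) (dS a).
split; first exact: (along_diff_ext hA nF (along_diff_sum hA hB sPsi _ dT)).
rewrite -(cov_along_ext hA v nF) (cov_along_sum hA hB sPsi v _ dT).
apply: eq_bigr => a _.
rewrite (cov_alongD hA hB sPsi v (dfE a) (dS a)) efE -addrA; congr (_ + _).
rewrite (cov_along_sum hA hB sPsi v _ (dgZ a)) scaler_sumr -big_split /=.
apply: eq_bigr => b _; rewrite egZ addrA scalerA -scalerDl; congr (_ + _).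
by rewrite scaler_sumr; apply: eq_bigr => c _; rewrite scalerA mulrA.
Qed.

(** In the skew part the second derivatives of the components of [Y] and of [Psi] combine with the
    bracket term by [der_comm], the mixed products of first derivatives cancel, and the double
    derivatives of the frame are those of [curv_frame]. *)
Lemma cov_along_curvature U V : smooth_vfield A O0 U -> smooth_vfield A O0 V ->
  curv B nt P (T p (U p)) (T p (V p)) (Y p)
  = ca p (U p) (fun q => ca q (V q) Y) - ca p (V p) (fun q => ca q (U q) Y)
    - ca p (lie_bracket A U V p) Y.
Proof.
move=> sU sV; have PP := cdom_refl hB P.
have [oI IO sE] := chart_set hB oO P.
have [oO2 O2p sc] := along_set hB sPsi oO0 O0p.
have sU2 : smooth_vfield A O2 U by apply: smooth_vfield_subset sU => q [].
have sV2 : smooth_vfield A O2 V by apply: smooth_vfield_subset sV => q [].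
have dy a := smooth_mdiff hA (sY a) O2p.
have [_ ->] := cov_along_twice (U p) sV.
have [_ ->] := cov_along_twice (V p) sU.
have [_ ->] := cov_along_frame hA hB oO cn sPsi PsiO PP dy (lie_bracket A U V p).
rewrite (curv_frame hB cn _ _ _ (PsiO p) oO) -!sumrB; apply: eq_bigr => a _.
have Tc w b : (T p w) 0 b = der A (cm b) p w.
  by have := tmap_coord hA hB sPsi w b PP; rewrite (tocoord_id hB).
have Yc b : (Y p) 0 b = comp P Y b p by rewrite /along_coord (tocoord_id hB).
rewrite -(der_comm hA oO2 (sY a) sU2 sV2 O2p).
rewrite (nt_tmap hA hB oO cn sPsi PsiO _ PP (sE a)).
rewrite row_alg1 scaler_sumr -!sumrB; apply: eq_bigr => b _.
rewrite row_alg2.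
  rewrite -sumrB; apply: eq_bigr => c _.
  by rewrite !Tc Yc -scalerBl; congr (_ *: _).
rewrite -(der_comm hA oO2 (sc b) sU2 sV2 O2p).
move: (der A _ _ _) (der A _ _ _) (comp _ _ _ _) (der A _ _ _) (der A _ _ _).
by move=> x1 x2 x3 x4 x5; move: (der A _ _ _) => x6; ring.
Qed.

End AlongCurvature.

(** * Riemannian metrics and surfaces *)

Section SmoothMatrix.
Context {R : realType} {M : topologicalType} {n : nat} {A : atlas R M n}.
Context (hA : charted A) {O : set M} (oO : open O).

Lemma smooth_prod I (r : seq I) (F : I -> M -> R) :
  (forall i, smooth_fun A O (F i)) -> smooth_fun A O (fun q => \prod_(i <- r) F i q).
Proof.
move=> sF; elim: r => [|i r IH].
  by under eq_fun do rewrite big_nil; exact: smooth_cst.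
by under eq_fun do rewrite big_cons; exact: (smoothM hA oO).
Qed.

Lemma smooth_det k (F : M -> 'M[R]_k) :
  (forall i j, smooth_fun A O (fun q => F q i j)) ->
  smooth_fun A O (fun q => \det (F q)).
Proof.
move=> sF; apply: (smooth_sum hA oO) => s; apply: (smoothM hA oO); first exact: smooth_cst.
exact: smooth_prod.
Qed.

(** By Cramer's rule the entries are polynomials in those of [F] and [b], divided by the
    determinant. *)
Lemma smooth_invmx k (F : M -> 'M[R]_k) (b : M -> 'rV[R]_k) :
  (forall i j, smooth_fun A O (fun q => F q i j)) ->
  (forall j, smooth_fun A O (fun q => b q 0 j)) ->
  (forall q, O q -> F q \in unitmx) ->
  forall j, smooth_fun A O (fun q => (b q *m invmx (F q)) 0 j).
Proof.
move=> sF sb uF j.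
have s : smooth_fun A O
    (fun q => \sum_i b q 0 i * ((\det (F q))^-1 * cofactor (F q) j i)).
  apply: (smooth_sum hA oO) => i; apply: (smoothM hA oO) => //.
  apply: (smoothM hA oO).
    apply: (smooth_inv hA) => //; last exact: smooth_det.
    by move=> q /uF; rewrite unitmxE unitfE.
  apply: (smoothM hA oO); first exact: smooth_cst.
  by apply: smooth_det => i' j'; under eq_fun do rewrite !mxE; exact: sF.
apply: (smooth_fun_ext hA oO) s => q /set_mem/uF uq.
by rewrite mxE; apply: eq_bigr => i _; rewrite /invmx uq !mxE.
Qed.

End SmoothMatrix.

Lemma bform_form_mx (R : realType) n (b : 'rV[R]_n -> 'rV[R]_n -> R) :
  (forall a v v' w, b (a *: v + v') w = a * b v w + b v' w) ->
  (forall a v w w', b v (a *: w + w') = a * b v w + b v w') ->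
  forall v w, bform (form_mx b) v w = b v w.
Proof.
move=> bl br v w; have b0l x : b 0 x = 0.
  by have /eqP := bl 1 0 0 x; rewrite scaler0 addr0 mul1r eq_sym -subr_eq0 addrK => /eqP.
have b0r x : b x 0 = 0.
  by have /eqP := br 1 x 0 0; rewrite scaler0 addr0 mul1r eq_sym -subr_eq0 addrK => /eqP.
rewrite [in RHS](row_sum_delta v) [in RHS](row_sum_delta w) /bform -mulmxA mxE.
rewrite (big_morph (fun x => b x _) (id1 := 0) (op1 := +%R)) //; last first.
  by move=> x y; have := bl 1 x y; rewrite scale1r => ->; rewrite mul1r.
apply: eq_bigr => i _; rewrite mxE.
have -> : b (v 0 i *: delta_mx 0 i) (\sum_j w 0 j *: delta_mx 0 j)
    = v 0 i * b (delta_mx 0 i) (\sum_j w 0 j *: delta_mx 0 j).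
  by have := bl (v 0 i) (delta_mx 0 i) 0; rewrite addr0 => ->; rewrite b0l addr0.
congr (_ * _).
rewrite (big_morph (fun x => b _ x) (id1 := 0) (op1 := +%R)) //; last first.
  by move=> x y; have := br 1 (delta_mx 0 i) x y; rewrite scale1r => ->; rewrite mul1r.
apply: eq_bigr => j _; rewrite !mxE.
have := br (w 0 j) (delta_mx 0 i) (delta_mx 0 j) 0; rewrite addr0 => ->.
by rewrite b0r addr0 mulrC.
Qed.

Section Riemannian.
Context {R : realType} {M : topologicalType} {n : nat} {A : atlas R M n}.
Context (hA : charted A) {g : M -> 'M[R]_n} (rg : riemannian_metric A g).
Implicit Types (p q : M) (v w : 'rV[R]_n) (X Y Z U V W : M -> 'rV[R]_n).

Lemma metric_sym p v w : bform (g p) v w = bform (g p) w v.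
Proof. by apply: bform_sym; have [_ /(_ p)[]] := rg. Qed.

Lemma metric_eq0 p v : (forall w, bform (g p) v w = 0) -> v = 0.
Proof.
move=> v0; apply/eqP; apply: contraT => vn0; have [_ /(_ p)[_ /(_ v vn0)]] := rg.
by rewrite v0 ltxx.
Qed.

Lemma metric_inj p v w : (forall x, bform (g p) v x = bform (g p) w x) -> v = w.
Proof.
move=> vw; apply/eqP; rewrite -subr_eq0; apply/eqP/(@metric_eq0 p) => x.
by rewrite bformBl vw subrr.
Qed.

Lemma metric_unit p : g p \in unitmx.
Proof.
rewrite -row_free_unit; apply: inj_row_free => v vg; apply: (@metric_eq0 p) => w.
by rewrite /bform vg mul0mx mxE.
Qed.

Lemma smooth_metric O X Y : open O -> smooth_vfield A O X -> smooth_vfield A O Y ->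
  smooth_fun A O (fun q => bform (g q) (X q) (Y q)).
Proof. by have [sg _] := rg; move=> oO; apply: sg. Qed.

(** The components of [Z] in a coordinate frame solve a linear system whose matrix is the Gram
    matrix of the frame and whose right-hand side consists of the given pairings. Smoothness of
    gradients and of [sharp] fields rests on this. *)
Lemma musical_smooth Z :
  (forall O X, open O -> smooth_vfield A O X ->
    smooth_fun A O (fun q => bform (g q) (Z q) (X q))) ->
  smooth_vfield A setT Z.
Proof.
move=> sZ; apply: smooth_vfield_local => p _.
exists (cdom A p); last exact: (cdom_refl hA).
have oI := cdom_open hA p; pose E i := const_vfield A p (basis_vec i).
have sE i : smooth_vfield A (cdom A p) (E i) by exact: smooth_const_vfield.
pose G q : 'M[R]_n := \matrix_(i, j) bform (g q) (E i q) (E j q).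
pose b q : 'rV[R]_n := \row_j bform (g q) (Z q) (E j q).
(* A vector killed by the Gram matrix is the coordinate vector of a tangent vector orthogonal to the
   whole frame. *)
have uG q : cdom A p q -> G q \in unitmx.
  move=> pq; rewrite -row_free_unit; apply: inj_row_free => v vG.
  rewrite -[v](const_vfieldK hA _ pq); rewrite (_ : const_vfield _ _ _ _ = 0) ?tocoord0 //.
  apply: (@metric_eq0 q) => w; rewrite (frame_sum hA w pq) bform_sumr big1 // => j _.
  rewrite bformZr (_ : bform _ _ _ = 0) ?mulr0 //.
  have /rowP/(_ j) := vG; rewrite !mxE => <-; rewrite (const_vfield_sum hA v pq) bform_suml.
  by apply: eq_bigr => i _; rewrite bformZl mxE.
have sG i j : smooth_fun A (cdom A p) (fun q => G q i j).
  by under eq_fun do rewrite mxE; exact: smooth_metric.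
have sb j : smooth_fun A (cdom A p) (fun q => b q 0 j).
  by under eq_fun do rewrite mxE; exact: sZ.
have zE q : cdom A p q -> tocoord A p q (Z q) = b q *m invmx (G q).
  move=> pq; rewrite -[LHS](mulmxK (uG q pq)); congr (_ *m _); apply/rowP => j.
  rewrite !mxE [in RHS](frame_sum hA (Z q) pq) bform_suml; apply: eq_bigr => i _.
  by rewrite bformZl mxE.
have s : smooth_vfield A (cdom A p) (fun q => \sum_i (b q *m invmx (G q)) 0 i *: E i q).
  apply: (smooth_vfield_sum hA oI) => i; apply: (smooth_vfieldZ hA oI) => //.
  exact: (smooth_invmx hA oI sG sb uG).
apply: (smooth_vfield_ext hA oI) s => q /set_mem pq.
by rewrite -zE // -(frame_sum hA).
Qed.

Lemma metric_grad (u : M -> R) p v : mdiff (A := A) u p ->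
  bform (g p) (grad A g u p) v = der A u p v.
Proof.
move=> du; rewrite /bform /grad mulmxKV ?metric_unit // mxE.
have -> : der A u p v = \sum_i v 0 i * dfun A u p (basis_vec i).
  exact: (derive_row v du).
by apply: eq_bigr => i _; rewrite !mxE mulrC.
Qed.

Lemma smooth_grad (u : M -> R) : smooth_fun A setT u -> smooth_vfield A setT (grad A g u).
Proof.
move=> su; apply: musical_smooth => O X oO sX.
have suO : smooth_fun A O u by apply: smooth_fun_subset su.
apply: (smooth_fun_ext hA oO) (smooth_der hA oO suO sX) => q /set_mem Oq.
by rewrite metric_grad //; exact: (smooth_mdiff hA suO).
Qed.

Lemma metric_sharp (D : M -> 'M[R]_n) p v w :
  bform (g p) (v *m sharp g D p) w = bform (D p) v w.
Proof. by rewrite /bform /sharp mulmxA mulmxKV ?metric_unit. Qed.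

Lemma smooth_sharp D X : smooth_form A setT D -> smooth_vfield A setT X ->
  smooth_vfield A setT (fun q => X q *m sharp g D q).
Proof.
move=> sD sX; apply: musical_smooth => O Y oO sY.
under eq_fun do rewrite metric_sharp.
exact: (sD _ _ _ oO (fun _ _ => I) (smooth_vfield_subset (fun _ _ => I) sX) sY).
Qed.

End Riemannian.

Lemma conformal_riemannian (R : realType) (M : topologicalType) n (A : atlas R M n)
    (hA : charted A) (g : M -> 'M[R]_n) (u : M -> R) :
  riemannian_metric A g -> smooth_fun A setT u ->
  riemannian_metric A (conformal u g).
Proof.
move=> [sg pg] su; split=> [ O X Y oO _ sX sY|p].
  have suO : smooth_fun A O u by apply: smooth_fun_subset su.
  have bE q : bform (conformal u g q) (X q) (Y q)
            = expR (2 * u q) * bform (g q) (X q) (Y q).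
    by rewrite /bform /conformal -scalemxAr -scalemxAl mxE.
  under eq_fun do rewrite bE.
  apply: (smoothM hA oO); last exact: sg.
  by apply: (smooth_exp hA oO); apply: (smoothM hA oO) => //; exact: smooth_cst.
have [gs gp] := pg p; split=> [|v v0]; first by rewrite /conformal linearZ /= gs.
by rewrite /bform /conformal -scalemxAr -scalemxAl mxE mulr_gt0 ?expR_gt0 //; exact: gp.
Qed.

Lemma bform_conformal (R : realType) (M : topologicalType) n (g : M -> 'M[R]_n)
    (u : M -> R) p v w :
  bform (conformal u g p) v w = expR (2 * u p) * bform (g p) v w.
Proof. by rewrite /bform /conformal -scalemxAr -scalemxAl mxE. Qed.

(** * Levi-Civita connections and symmetries of the curvature *)

Section LeviCivita.
Context {R : realType} {M : topologicalType} {n : nat} {A : atlas R M n}.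
Context (hA : charted A) {g : M -> 'M[R]_n} {nabla : @covariant R M n}.
Context {O0 : set M} (lc : levi_civita A O0 g nabla).
Implicit Types (p q : M) (v w : 'rV[R]_n) (X Y Z U V W : M -> 'rV[R]_n).

Section Open.
Context {O : set M} (oO : open O) (OO0 : O `<=` O0).

Lemma lc_torsion U V p : smooth_vfield A O U -> smooth_vfield A O V -> O p ->
  cov nabla U V p - cov nabla V U p = lie_bracket A U V p.
Proof. by move=> sU sV Op; have [_ /(_ _ oO OO0 _ _ sU sV p Op)[]] := lc. Qed.

Lemma lc_metric V W p v : smooth_vfield A O V -> smooth_vfield A O W -> O p ->
  der A (fun q => bform (g q) (V q) (W q)) p v
  = bform (g p) (nabla p v V) (W p) + bform (g p) (V p) (nabla p v W).
Proof.
by move=> sV sW Op; have [_ /(_ _ oO OO0 _ _ sV sW p Op)[_ /(_ v)]] := lc.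
Qed.

End Open.
End LeviCivita.

(** [aVWX] stands for g(nabla_V W, X), and so on. The sums come from metric compatibility, the
    differences from vanishing torsion. *)
Lemma koszul_unique (R : numFieldType) (aVWX aVXW aWVX aWXV aXVW aXWV : R) :
  2 * aVWX = (aVWX + aVXW) + (aWVX + aWXV) - (aXVW + aXWV)
    + (aVWX - aWVX) - (aVXW - aXVW) - (aWXV - aXWV).
Proof. ring. Qed.

Section Identity.
Context {R : realType} {M : topologicalType} {n : nat} {A : atlas R M n}.
Context (hA : charted A) {nabla : @covariant R M n} (cn : connection A setT nabla).
Implicit Types (p q : M) (v w : 'rV[R]_n) (U V W Y : M -> 'rV[R]_n).

Lemma smooth_map_id : smooth_map A A id.
Proof.
split=> [q|y i]; first exact: cvg_id.
have oI : open (cdom A y) by exact: (cdom_open hA).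
have H : smooth_fun A (setT `&` cdom A y) (fun q => (cmap A y q) 0 i).
  apply: (smooth_fun_chart hA openT) => k; rewrite setTI.
  have : class_C k (cmap A y @` cdom A y) (cmap A y \o cinv A y).
    case: hA => _ _ /(_ y y k); apply: class_C_subset => _ [q yq <-].
    by exists q => //; split.
  have oJ : open (cmap A y @` cdom A y) by have [/(_ y)[]] := hA.
  by move=> /(class_C_coordP _ _ oJ)/(_ i).
by rewrite setTI in H.
Qed.

Lemma tmap_id p v : tmap A A id p v = v.
Proof. exact: tocoord_id. Qed.

Lemma cov_along_id p v Y : smooth_vfield A setT Y ->
  cov_along A A nabla id p v Y = nabla p v Y.
Proof.
move=> sY; have [_ ->] := cov_along_comp hA hA cn smooth_map_id v openT
  (fun _ _ => I) sY (I : setT p).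
by rewrite tmap_id.
Qed.

(** [curv] is defined with constant-coordinate extensions; that arbitrary fields may be used is the
    curvature formula along a map, for the identity. *)
Lemma curv_vfields p U V W : smooth_vfield A setT U -> smooth_vfield A setT V ->
  smooth_vfield A setT W ->
  curv A nabla p (U p) (V p) (W p)
  = nabla p (U p) (cov nabla V W) - nabla p (V p) (cov nabla U W)
    - nabla p (lie_bracket A U V p) W.
Proof.
move=> sU sV sW.
have sC b : smooth_fun A (setT `&` id @^-1` cdom A p) (along_coord A id p W b).
  by move/(smooth_vfieldP hA openT) : sW; apply.
have := cov_along_curvature hA hA openT cn smooth_map_id (fun _ => I) openT
  (I : setT p) sC sU sV.
rewrite !tmap_id => ->.
have H X : smooth_vfield A setT X ->
    (fun q => cov_along A A nabla id q (X q) W) = cov nabla X W.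
  by move=> sX; apply/funext => q; rewrite cov_along_id.
have sc X : smooth_vfield A setT X -> smooth_vfield A setT (cov nabla X W).
  by move=> sX; exact: (smooth_cov cn openT (fun _ _ => I) sX sW).
congr (_ - _ - _); last exact: (cov_along_id p _ sW).
  by rewrite (H V sV); exact: (cov_along_id p _ (sc _ sV)).
by rewrite (H U sU); exact: (cov_along_id p _ (sc _ sU)).
Qed.

End Identity.

Lemma skew_alg (R : realFieldType) (x1 x2 x3 x4 m1 m2 : R) :
  x1 + m1 + (m2 + x2) - (x3 + m2 + (m1 + x4)) = 0 -> x1 - x3 = - (x2 - x4).
Proof. lra. Qed.

Section Curvature.
Context {R : realType} {M : topologicalType} {n : nat} {A : atlas R M n}.
Context (hA : charted A) {g : M -> 'M[R]_n} (rg : riemannian_metric A g).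
Context {nabla : @covariant R M n} (lc : levi_civita A setT g nabla).
Implicit Types (p q : M) (v w : 'rV[R]_n).

(** The commuting fields [E u] and [E v] are applied to g(E w, E x) in both orders. In the
    difference the products of first covariant derivatives cancel, which leaves the two curvature
    terms with sum zero. *)
Lemma curv_skew p u v w x :
  bform (g p) (curv A nabla p u v w) x = - bform (g p) (curv A nabla p u v x) w.
Proof.
have pp := cdom_refl hA p; have oI := cdom_open hA p; have [cn _] := lc.
pose E y := const_vfield A p y.
have sE y : smooth_vfield A (cdom A p) (E y) by exact: smooth_const_vfield.
have IT : cdom A p `<=` setT by [].
have sc y z : smooth_vfield A (cdom A p) (cov nabla (E y) (E z)).
  exact: (smooth_cov cn oI IT).
have sG X Y : smooth_vfield A (cdom A p) X -> smooth_vfield A (cdom A p) Y ->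
    smooth_fun A (cdom A p) (fun q => bform (g q) (X q) (Y q)).
  exact: (smooth_metric rg oI).
pose f q := bform (g q) (E w q) (E x q).
have Df y q : cdom A p q -> der A f q (E y q)
    = bform (g q) (cov nabla (E y) (E w) q) (E x q)
    + bform (g q) (E w q) (cov nabla (E y) (E x) q).
  by move=> pq; exact: (lc_metric lc oI IT).
pose S y z : R := bform (g p) (nabla p z (cov nabla (E y) (E w))) x
      + bform (g p) (nabla p y (E w)) (nabla p z (E x))
      + (bform (g p) (nabla p z (E w)) (nabla p y (E x))
         + bform (g p) w (nabla p z (cov nabla (E y) (E x)))).
have DDf y z : der A (fun q => der A f q (E y q)) p z = S y z.
  have nI : \forall q \near p, cdom A p q by exact: open_nbhs_nbhs.
  rewrite (der_ext hA z (filterS (Df y) nI)).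
  rewrite derD; [|exact: (smooth_mdiff hA (sG _ _ (sc y w) (sE x)))
                 |exact: (smooth_mdiff hA (sG _ _ (sE w) (sc y x)))].
  rewrite (lc_metric lc oI IT z (sc y w) (sE x) pp).
  rewrite (lc_metric lc oI IT z (sE w) (sc y x) pp).
  by rewrite /S /cov /E !(const_vfield_id hA).
have Ep y : E y p = y := const_vfield_id hA p y.
have H : S v u - S u v = 0.
  rewrite -(DDf v u) -(DDf u v) -{1}(Ep u) -{2}(Ep v).
  rewrite (der_comm hA oI (sG _ _ (sE w) (sE x)) (sE u) (sE v) pp).
  by rewrite (lie_bracket_const hA); exact: dfun0.
have cE y : curv A nabla p u v y = nabla p u (cov nabla (E v) (E y))
    - nabla p v (cov nabla (E u) (E y)).
  rewrite /curv /curvature /(cov nabla (lie_bracket _ _ _)) (lie_bracket_const hA).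
  rewrite (conn0v cn oI IT (sE y) pp) subr0; congr (_ - _); rewrite /cov.
    by rewrite (const_vfield_id hA).
  by rewrite (const_vfield_id hA).
have alg N1 N2 N3 N4 m1 m2 :
    bform (g p) N1 x + m1 + (m2 + bform (g p) w N2)
    - (bform (g p) N3 x + m2 + (m1 + bform (g p) w N4)) = 0 ->
    bform (g p) (N1 - N3) x = - bform (g p) (N2 - N4) w.
  rewrite !bformBl (metric_sym rg p w N2) (metric_sym rg p w N4).
  exact: skew_alg.
rewrite (cE w) (cE x); exact: (alg _ _ _ _ _ _ H).
Qed.

End Curvature.

(** * Curvature of surfaces *)

Lemma sum_ord2 (V : nmodType) (F : 'I_2 -> V) : \sum_i F i = F 0 + F 1.
Proof. by rewrite !big_ord_recl big_ord0 addr0; congr (_ + F _); exact: val_inj. Qed.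

Lemma bform2E (R : realType) (B : 'M[R]_2) v w :
  bform B v w = v 0 0 * B 0 0 * w 0 0 + v 0 0 * B 0 1 * w 0 1
              + v 0 1 * B 1 0 * w 0 0 + v 0 1 * B 1 1 * w 0 1.
Proof.
rewrite /bform mxE sum_ord2 !mxE !sum_ord2.
by rewrite !mulrDl addrACA addrA.
Qed.

Lemma det_trace_invmx2 (R : realType) (G X : 'M[R]_2) : G \in unitmx ->
  \det G * \tr (invmx G *m X)
  = G 1 1 * X 0 0 - G 0 1 * X 1 0 - G 1 0 * X 0 1 + G 0 0 * X 1 1.
Proof.
move=> uG; have dG : \det G != 0 by move: uG; rewrite unitmxE unitfE.
rewrite /invmx uG -scalemxAl mxtraceZ mulrA divff // mul1r.
rewrite /mxtrace sum_ord2 !mxE !sum_ord2 !mxE /cofactor !det_mx11 !mxE /=.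
have l0 : lift (0 : 'I_2) 0 = 1 by exact: val_inj.
have l1 : lift (1 : 'I_2) 0 = 0 by exact: val_inj.
by rewrite l0 l1 /=; ring.
Qed.

Lemma basis_vecE (R : realType) k (i j : 'I_k) :
  (basis_vec i : 'rV[R]_k) 0 j = (j == i)%:R.
Proof. by rewrite mxE eqxx. Qed.

Lemma row_sum2 (R : realType) (w : 'rV[R]_2) :
  w = w 0 0 *: basis_vec 0 + w 0 1 *: basis_vec 1.
Proof. by rewrite {1}[w]row_sum_delta sum_ord2. Qed.

(* The first factor of the right-hand side is det G * tr (G^-1 D), so that for a surface
   it is a multiple of the scalar curvature when D is a Moebius structure. *)
Lemma trace_identity2 (R : realType) (G D : 'M[R]_2) (u v w x : 'rV[R]_2) :
  G 1 0 = G 0 1 -> D 1 0 = D 0 1 ->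
  bform G x v * bform D u w - bform G x u * bform D v w
    - bform G v w * bform D u x + bform G u w * bform D v x
  = (G 1 1 * D 0 0 - G 0 1 * D 1 0 - G 1 0 * D 0 1 + G 0 0 * D 1 1)
    * ((v 0 0 * u 0 1 - v 0 1 * u 0 0) * (x 0 0 * w 0 1 - x 0 1 * w 0 0)).
Proof. by move=> G10 D10; rewrite !bform2E G10 D10; ring. Qed.

Lemma row_alg3 (R : realType) (u0 u1 v0 v1 wa : R) (N00 N01 N10 N11 : 'rV[R]_2) :
  (wa * (v0 * u0) - wa * (u0 * v0)) *: N00 + (wa * (v0 * u1) - wa * (u0 * v1)) *: N10
  + ((wa * (v1 * u0) - wa * (u1 * v0)) *: N01 + (wa * (v1 * u1) - wa * (u1 * v1)) *: N11)
  = (u0 * v1 - u1 * v0) *: (wa *: (N01 - N10)).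
Proof. by apply/rowP => k; rewrite !mxE; ring. Qed.

(** [r0] and [r1] are the images of the basis vectors under R(e0, e1), [k] is their one independent
    entry, and [s] is the determinant of the two vectors that span the plane. *)
Lemma surface_alg (R : realType) (G : 'M[R]_2) (r0 r1 w x : 'rV[R]_2) (k s : R) :
  bform G r0 (basis_vec 0) = 0 -> bform G r1 (basis_vec 1) = 0 ->
  bform G r0 (basis_vec 1) = k -> bform G r1 (basis_vec 0) = - k ->
  bform G (s *: (w 0 0 *: r0 + w 0 1 *: r1)) x
  = k * (s * (w 0 0 * x 0 1 - w 0 1 * x 0 0)).
Proof.
move=> h00 h11 h01 h10.
rewrite bformZl bformDl !bformZl [in LHS](row_sum2 x) !bformDr !bformZr.
by rewrite h00 h11 h01 h10; ring.
Qed.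

Lemma scal_alg (R : comRingType) (k a0 a1 b0 b1 g00 g01 g10 g11 : R) :
  k = a0 * g01 + a1 * g11 -> - k = b0 * g00 + b1 * g10 ->
  g11 * (0 * a0 - 1 * a1) - g01 * (1 * a0 - 0 * a1)
  - g10 * (0 * b0 - 1 * b1) + g00 * (1 * b0 - 0 * b1) = - (2 * k).
Proof.
move=> h1 h2; have -> : - (2 * k) = - k + - k by ring.
by rewrite {1}h1 h2; ring.
Qed.

Section Surface.
Context {R : realType} {M : topologicalType} {A : atlas R M 2} (hA : charted A).
Context {g : M -> 'M[R]_2} (rg : riemannian_metric A g).
Context {nabla : @covariant R M 2} (lc : levi_civita A setT g nabla).
Implicit Types (p q : M) (u v w x : 'rV[R]_2).
Local Notation e0 := (basis_vec (0 : 'I_2)).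
Local Notation e1 := (basis_vec (1 : 'I_2)).
Let r p a := curv A nabla p e0 e1 (basis_vec a).

(** The coefficients in [curv_frame] are skew in [u] and [v], so on a surface only their determinant
    survives. *)
Lemma surface_curv p u v w : curv A nabla p u v w
  = (u 0 0 * v 0 1 - u 0 1 * v 0 0) *: (w 0 0 *: r p 0 + w 0 1 *: r p 1).
Proof.
have [cn _] := lc.
pose N c b a := nabla p (basis_vec c) (cov nabla
   (const_vfield A p (basis_vec b)) (const_vfield A p (basis_vec a))).
have H u' v' w' : curv A nabla p u' v' w' = (u' 0 0 * v' 0 1 - u' 0 1 * v' 0 0) *:
    \sum_a w' 0 a *: (N 0 1 a - N 1 0 a).
  rewrite (curv_frame hA cn u' v' w' I openT) scaler_sumr; apply: eq_bigr => a _.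
  rewrite sum_ord2 [X in X + _]sum_ord2 [X in _ + X]sum_ord2; exact: row_alg3.
have rE a : r p a = N 0 1 a - N 1 0 a.
  rewrite /r H !basis_vecE !eqxx /= mulr1 mul0r subr0 scale1r.
  rewrite (bigD1 a) //= basis_vecE eqxx scale1r big1 ?addr0 // => b ba.
  by rewrite basis_vecE (negbTE ba) scale0r.
by rewrite H sum_ord2 !rE.
Qed.

(** The one independent component of the curvature; with this sign it is minus the Gauss curvature
    times [\det (g p)]. *)
Let kappa p := bform (g p) (r p 0) e1.

Lemma surface_curv_metric p u v w x : bform (g p) (curv A nabla p u v w) x
  = kappa p * ((u 0 0 * v 0 1 - u 0 1 * v 0 0) * (w 0 0 * x 0 1 - w 0 1 * x 0 0)).
Proof.
have sk a b : bform (g p) (r p a) (basis_vec b) = - bform (g p) (r p b) (basis_vec a).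
  exact: (curv_skew hA rg lc).
have s0 a : bform (g p) (r p a) (basis_vec a) = 0.
  by have := sk a a; lra.
by rewrite surface_curv; apply: surface_alg => //; exact: sk.
Qed.

Lemma surface_scal p : \det (g p) * scal A g nabla p = - (2 * kappa p).
Proof.
rewrite /scal /trace_form det_trace_invmx2; last exact: (metric_unit rg).
have ricE i j : ricci A nabla p i j = (i == 1)%:R * (r p j) 0 0 - (i == 0)%:R * (r p j) 0 1.
  have vE : (basis_vec j : 'rV[R]_2) 0 0 *: r p 0 + (basis_vec j : 'rV[R]_2) 0 1 *: r p 1 = r p j.
    rewrite !basis_vecE; case: j => -[|[|//]] jlt /=.
      by rewrite scale1r scale0r addr0; congr (r p _); exact: val_inj.
    by rewrite scale1r scale0r add0r; congr (r p _); exact: val_inj.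
  rewrite mxE sum_ord2 !surface_curv vE ![(_ *: r p j) _ _]mxE !basis_vecE /=.
  by rewrite !(eq_sym _ i); ring.
rewrite !ricE /=.
have k0 : kappa p = (r p 0) 0 0 * (g p) 0 1 + (r p 0) 0 1 * (g p) 1 1.
  by rewrite /kappa bform2E !basis_vecE /=; ring.
have k1 : - kappa p = (r p 1) 0 0 * (g p) 0 0 + (r p 1) 0 1 * (g p) 1 0.
  rewrite /kappa -[bform _ _ _]opprK -(curv_skew hA rg lc p e0 e1 e1 e0) opprK.
  by rewrite -/(r p 1) bform2E !basis_vecE /=; ring.
exact: scal_alg k0 k1.
Qed.

Lemma surface_trace (D : M -> 'M[R]_2) p : trace_form g D p = scal A g nabla p / 2 ->
  kappa p = - ((g p) 1 1 * (D p) 0 0 - (g p) 0 1 * (D p) 1 0 - (g p) 1 0 * (D p) 0 1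
               + (g p) 0 0 * (D p) 1 1).
Proof.
move=> h; rewrite -(det_trace_invmx2 _ (metric_unit rg p)) -[\tr _]/(trace_form g D p).
by rewrite h mulrA surface_scal; field.
Qed.

(** The bracket on the right is the Kulkarni-Nomizu product of [g] and [D]. On a surface it is a
    multiple of the determinants of [v], [u] and of [x], [w], as the curvature is, and the trace
    condition identifies the factors. *)
Lemma surface_curv_trace (D : M -> 'M[R]_2) p v u x w :
  trace_form g D p = scal A g nabla p / 2 -> (D p)^T = D p ->
  bform (g p) (curv A nabla p v u x) w =
  - (bform (g p) x v * bform (D p) u w - bform (g p) x u * bform (D p) v w
    - bform (g p) v w * bform (D p) u x + bform (g p) u w * bform (D p) v x).
Proof.
move=> trD symD; rewrite trace_identity2; last 2 first.
- by have [_ /(_ p)[/matrixP/(_ 0 1) + _]] := rg; rewrite mxE.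
- by have /matrixP/(_ 0 1) := symD; rewrite mxE.
by rewrite surface_curv_metric (surface_trace trD) mulNr.
Qed.

End Surface.

(** * Conformal invariance *)

(* D.., H.., g.. and x. stand for values of D, of Hess u, of g and of du, with x for grad u,
   N for its squared norm, a for a covariant derivative of W, b and c for those of U along V
   and of V along U, and l for [V, U].  The first hypothesis expresses R(V, U) grad u
   through D; it is the only one that needs dimension two. *)
Lemma invariance_alg (R : realFieldType)
    (D1 D2 D3 DUa DVa DUW DVW DUV DUx DVx N gUW gVW gUV gbW gcW gUa gVa : R)
    (HUW HVW HUV HUx HVx HUa HVa R1 R2 R3 xU xV xW xa xa' xb xc gl xl : R) :
  R1 - R2 - R3 = - (xV * DUW - xU * DVW - gVW * DUx + gUW * DVx) ->
  gl = gbW - gcW -> xl = xb - xc ->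
  (D1 - (HVx * gUW + N / 2 * (gbW + gUa)) - (R1 + HUa)
    + ((HUV + xb) * xW + xU * (HVW + xa)))
  - (D2 - (HUx * gVW + N / 2 * (gcW + gVa)) - (R2 + HVa)
    + ((HUV + xc) * xW + xV * (HUW + xa')))
  - (DUa - N / 2 * gUa - HUa + xU * xa
     + (xV * (DUW - N / 2 * gUW - HUW + xU * xW)
        + xW * (DUV - N / 2 * gUV - HUV + xU * xV)
        - gVW * (DUx - N / 2 * xU - HUx + xU * N)))
  + (DVa - N / 2 * gVa - HVa + xV * xa'
     + (xU * (DVW - N / 2 * gVW - HVW + xV * xW)
        + xW * (DUV - N / 2 * gUV - HUV + xV * xU)
        - gUW * (DVx - N / 2 * xV - HVx + xV * N)))
  - (D3 - N / 2 * gl - R3 + xl * xW)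
  = D1 - D2 - DUa + DVa - D3.
Proof.
move=> h1 -> ->; have -> : R1 = R1 - R2 - R3 + R2 + R3 by ring.
by rewrite h1; field.
Qed.

Lemma hess_alg (R : realFieldType) (x1 x2 x3 x4 : R) :
  x4 + x3 - (x2 + x1) = x3 - x1 -> x4 = x2.
Proof. lra. Qed.

(** Koszul's formulas for two metrics: [dV], [b1] and their kin belong to g, the capitals to e g,
    and [uV], [uW], [uX] are values of du. The numbers [a] and [b] are the g-products of the two
    covariant derivatives with X. *)
Lemma conformal_alg (R : realFieldType)
    (e a b dV dW dX gVW gVX gWX b1 b2 b3 uV uW uX B B1 B2 B3 DV DW DX : R) : e != 0 ->
  2 * B = DV + DW - DX + B1 - B2 - B3 ->
  B = e * b -> B1 = e * b1 -> B2 = e * b2 -> B3 = e * b3 ->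
  DV = e * (2 * uV * gWX + dV) -> DW = e * (2 * uW * gVX + dW) ->
  DX = e * (2 * uX * gVW + dX) ->
  2 * a = dV + dW - dX + b1 - b2 - b3 ->
  b = a + (uV * gWX + uW * gVX - gVW * uX).
Proof.
move=> e0 h1 h3 h4 h5 h6 h7 h8 h9; rewrite h3 h4 h5 h6 h7 h8 h9 in h1.
move=> h2; apply: (mulfI e0); apply: (@mulfI _ 2); first by rewrite pnatr_eq0.
have -> : a = (dV + dW - dX + b1 - b2 - b3) / 2 by rewrite -h2; field.
by rewrite h1; field.
Qed.

Section SkewDerivative.
Context {R : realType} {M : topologicalType} {n : nat} (A : atlas R M n).
Implicit Types (U V W : M -> 'rV[R]_n) (nabla : @covariant R M n) (D : M -> 'M[R]_n).

(* (nabla_V D)(U, W) - (nabla_U D)(V, W) for a torsion-free [nabla] *)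
Definition skew_derivative nabla D V U W p : R :=
  der A (fun q => bform (D q) (U q) (W q)) p (V p)
  - der A (fun q => bform (D q) (V q) (W q)) p (U p)
  - bform (D p) (U p) (nabla p (V p) W) + bform (D p) (V p) (nabla p (U p) W)
  - bform (D p) (lie_bracket A V U p) (W p).

Context (hA : charted A) {g : M -> 'M[R]_n} (rg : riemannian_metric A g).
Context {nabla : @covariant R M n} (lc : levi_civita A setT g nabla).
Local Notation svf := (smooth_vfield A setT).
Let sT : (setT : set M) `<=` setT. Proof. by []. Qed.

(** Since the metric is parallel, the derivative of the endomorphism passes to the bilinear form;
    the terms with nabla_V U and nabla_U V then combine into the bracket. *)
Lemma cotton_york_skew (D : (M -> 'M[R]_n) -> M -> 'M[R]_n) U V W p :
  smooth_form A setT (D g) -> svf U -> svf V -> svf W ->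
  cotton_york g nabla D V U W p = skew_derivative nabla (D g) V U W p.
Proof.
move=> sD sU sV sW; rewrite /cotton_york.
have H X Y : svf X -> svf Y -> bform (g p) (cov_endo nabla (sharp g (D g)) X Y p) (W p)
    = der A (fun q => bform (D g q) (Y q) (W q)) p (X p)
      - bform (D g p) (Y p) (nabla p (X p) W) - bform (D g p) (cov nabla X Y p) (W p).
  move=> sX sY; rewrite bformBl (metric_sharp rg).
  have := lc_metric lc openT sT (X p) (smooth_sharp hA rg sD sY) sW (I : setT p).
  rewrite (metric_sharp rg).
  have -> : (fun q => bform (g q) (Y q *m sharp g (D g) q) (W q))
          = (fun q => bform (D g q) (Y q) (W q)).
    by apply/funext => q; rewrite (metric_sharp rg).
  by move=> ->; rewrite addrK.
rewrite bformBl (H V U sV sU) (H U V sU sV) /skew_derivative.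
rewrite -(lc_torsion lc openT sT sV sU (I : setT p)) bformBl.
move: (der _ _ _ _) (der _ _ _ _) (bform _ _ _) (bform _ _ _) => x1 x2 x3 x4.
by move: (bform _ _ _) (bform _ _ _) => x5 x6; ring.
Qed.

Lemma hess_form (u : M -> R) q v w : smooth_fun A setT u ->
  bform (hess A g nabla u q) v w = bform (g q) (nabla q v (grad A g u)) w.
Proof.
move=> su; have sg := smooth_grad hA rg su; have [cn _] := lc.
rewrite bform_form_mx // => [a x x' y|a x y y'].
  by rewrite (conn_lin cn openT sT a x x' sg I) bformDl bformZl.
by rewrite bformDr bformZr.
Qed.

Lemma grad_sqnorm_der (u : M -> R) p v : smooth_fun A setT u ->
  der A (grad_sqnorm A g u) p v
  = 2 * bform (g p) (nabla p v (grad A g u)) (grad A g u p).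
Proof.
move=> su; have sg := smooth_grad hA rg su.
rewrite (lc_metric lc openT sT v sg sg (I : setT p)) (metric_sym rg p (grad A g u p)).
by rewrite mulr_natl.
Qed.

(** Differentiating du(Y) = g(grad u, Y) expresses the second derivatives of [u] through the
    Hessian. Their skew part is the derivative along the bracket, which vanishing torsion
    cancels. *)
Lemma hess_sym (u : M -> R) U V p : smooth_fun A setT u -> svf U -> svf V ->
  bform (g p) (nabla p (V p) (grad A g u)) (U p)
  = bform (g p) (nabla p (U p) (grad A g u)) (V p).
Proof.
move=> su sU sV; have sg := smooth_grad hA rg su.
have du q : mdiff (A := A) u q by exact: (smooth_mdiff hA su).
have H X Y : svf X -> svf Y -> der A (fun q => der A u q (Y q)) p (X p)
    = bform (g p) (nabla p (X p) (grad A g u)) (Y p)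
      + der A u p (nabla p (X p) Y).
  move=> sX sY; rewrite -(metric_grad rg _ (du p)).
  rewrite -(lc_metric lc openT sT (X p) sg sY (I : setT p)).
  by congr (der A _ p _); apply/funext => q; rewrite (metric_grad rg _ (du q)).
have := der_comm hA openT su sV sU (I : setT p).
rewrite (H V U sV sU) (H U V sU sV) -(lc_torsion lc openT sT sV sU (I : setT p)).
rewrite -!(metric_grad rg _ (du p)) bformBr /cov.
move: (bform _ _ _) (bform _ _ _) (bform _ _ _) (bform _ _ _) => x1 x2 x3 x4.
exact: hess_alg.
Qed.

End SkewDerivative.

(** * The Koszul formula and conformal change of the connection *)

Section Koszul.
Context {R : realType} {M : topologicalType} {n : nat} {A : atlas R M n}.
Context {h : M -> 'M[R]_n} (symh : forall p v w, bform (h p) v w = bform (h p) w v).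
Context {nabla : @covariant R M n} {O0 : set M} (lc : levi_civita A O0 h nabla).
Context {O : set M} (oO : open O) (OT : O `<=` O0).

Lemma koszul (V W X : M -> 'rV[R]_n) p : smooth_vfield A O V -> smooth_vfield A O W ->
  smooth_vfield A O X -> O p ->
  2 * bform (h p) (nabla p (V p) W) (X p) =
    der A (fun q => bform (h q) (W q) (X q)) p (V p)
  + der A (fun q => bform (h q) (V q) (X q)) p (W p)
  - der A (fun q => bform (h q) (V q) (W q)) p (X p)
  + bform (h p) (lie_bracket A V W p) (X p) - bform (h p) (lie_bracket A V X p) (W p)
  - bform (h p) (lie_bracket A W X p) (V p).
Proof.
move=> sV sW sX Op.
rewrite (lc_metric lc oO OT _ sW sX Op) (lc_metric lc oO OT _ sV sX Op).
rewrite (lc_metric lc oO OT _ sV sW Op).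
rewrite -(lc_torsion lc oO OT sV sW Op) -(lc_torsion lc oO OT sV sX Op).
rewrite -(lc_torsion lc oO OT sW sX Op) !bformBl /cov.
rewrite (symh p (W p) (nabla p (V p) X)) (symh p (V p) (nabla p (W p) X)).
rewrite (symh p (V p) (nabla p (X p) W)).
exact: koszul_unique.
Qed.

End Koszul.

Section ConformalConnection.
Context {R : realType} {M : topologicalType} {n : nat} {A : atlas R M n}.
Context (hA : charted A) {g : M -> 'M[R]_n} (rg : riemannian_metric A g).
Context {nabla : @covariant R M n} (lc : levi_civita A setT g nabla).
Context {u : M -> R} (su : smooth_fun A setT u).
Context {nablau : @covariant R M n} (lcu : levi_civita A setT (conformal u g) nablau).

Lemma der_conformal O X Y p v : open O -> smooth_vfield A O X -> smooth_vfield A O Y ->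
  O p -> der A (fun q => bform (conformal u g q) (X q) (Y q)) p v
  = expR (2 * u p) * (2 * der A u p v * bform (g p) (X p) (Y p)
                      + der A (fun q => bform (g q) (X q) (Y q)) p v).
Proof.
move=> oO sX sY Op; have du := smooth_mdiff hA su (I : setT p).
have d2 : mdiff (A := A) (fun q => 2 * u q) p by exact: mdiffM (mdiff_cst _ _) du.
have -> : (fun q => bform (conformal u g q) (X q) (Y q))
        = (fun q => expR (2 * u q) * bform (g q) (X q) (Y q)).
  by apply/funext => q; rewrite bform_conformal.
rewrite (derM hA v (mdiff_exp d2) (smooth_mdiff hA (smooth_metric rg oO sX sY) Op)).
rewrite (der_exp hA v d2) (derM hA v (mdiff_cst _ _) du) der_cst mul0r add0r.
by rewrite mulrDr !mulrA.
Qed.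

(** Koszul's formula is written for both metrics against a local extension of [x]. The bracket terms
    scale by [expR (2 * u p)], so only the derivatives of the metric contribute terms in du. *)
Lemma conformal_connection V W p :
  smooth_vfield A setT V -> smooth_vfield A setT W ->
  nablau p (V p) W = nabla p (V p) W + (der A u p (V p) *: W p
    + der A u p (W p) *: V p - bform (g p) (V p) (W p) *: grad A g u p).
Proof.
move=> sV sW; apply: (metric_inj rg (p := p)) => x.
have pp := cdom_refl hA p; have oI := cdom_open hA p.
have du := smooth_mdiff hA su (I : setT p).
have rgu := conformal_riemannian hA rg su.
have sV' : smooth_vfield A (cdom A p) V by exact: smooth_vfield_subset sV.
have sW' : smooth_vfield A (cdom A p) W by exact: smooth_vfield_subset sW.
have [X sX <-] : exists2 X, smooth_vfield A (cdom A p) X & X p = x.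
  by exists (const_vfield A p x); [exact: smooth_const_vfield|exact: const_vfield_id].
have IT : cdom A p `<=` setT by [].
have h2 := koszul (metric_sym rg) lc oI IT sV' sW' sX pp.
have h1 := koszul (metric_sym rgu) lcu oI IT sV' sW' sX pp.
have cE := bform_conformal g u p. rewrite bformDl bformBl bformDl !bformZl (metric_grad rg _ du).
exact: (conformal_alg (lt0r_neq0 (expR_gt0 _)) h1 (cE _ _) (cE _ _) (cE _ _) (cE _ _)
  (der_conformal _ oI sW' sX pp) (der_conformal _ oI sV' sX pp)
  (der_conformal _ oI sV' sW' pp) h2).
Qed.

End ConformalConnection.

(** * Invariance of the skew derivative on a surface *)

Section Invariance.
Context {R : realType} {M : topologicalType} {A : atlas R M 2}.
Context (hA : charted A) {g : M -> 'M[R]_2} (rg : riemannian_metric A g).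
Context {nabla : @covariant R M 2} (lc : levi_civita A setT g nabla).
Context {u : M -> R} (su : smooth_fun A setT u).
Context {nablau : @covariant R M 2} (lcu : levi_civita A setT (conformal u g) nablau).
Context {D Dh : M -> 'M[R]_2} (sD : smooth_form A setT D).
Context (symD : forall p, (D p)^T = D p).
Context (trD : forall p, trace_form g D p = scal A g nabla p / 2).
Context (DhE : forall p, Dh p = D p - (grad_sqnorm A g u p / 2) *: g p
    - hess A g nabla u p + (differential A u p)^T *m differential A u p).
Implicit Types (p q : M) (v w : 'rV[R]_2) (U V W X Y Z : M -> 'rV[R]_2).
Local Notation svf := (smooth_vfield A setT).
Local Notation G := (grad A g u).
Let sT : (setT : set M) `<=` setT. Proof. by []. Qed.

Lemma bform_transformed q v w : bform (Dh q) v w = bform (D q) v w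
  - grad_sqnorm A g u q / 2 * bform (g q) v w
  - bform (g q) (nabla q v G) w + bform (g q) (G q) v * bform (g q) (G q) w.
Proof.
have du := smooth_mdiff hA su (I : setT q).
have dE x : (differential A u q *m x^T) 0 0 = bform (g q) (G q) x.
  by rewrite /bform /grad mulmxKV ?(metric_unit rg).
have dd : bform ((differential A u q)^T *m differential A u q) v w
        = bform (g q) (G q) v * bform (g q) (G q) w.
  rewrite /bform mulmxA -[_ *m _ *m w^T]mulmxA mxE big_ord1 dE; congr (_ * _).
  have -> : v *m (differential A u q)^T = (differential A u q *m v^T)^T.
    by rewrite trmx_mul trmxK.
  by rewrite mxE dE.
rewrite DhE -dd -(hess_form hA rg lc q v w su) /bform.
by rewrite !(mulmxDl, mulmxDr, mulmxN, mulNmx) -scalemxAr -scalemxAl !mxE.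
Qed.

(** The Hessian is written as the product of [cov nabla X G] with [Y], so that its derivative
    contains the second covariant derivative of the gradient in the form used by [curv_vfields]. *)
Lemma der_transformed X Y Z p : svf X -> svf Y -> svf Z ->
  der A (fun q => bform (Dh q) (X q) (Y q)) p (Z p) =
  der A (fun q => bform (D q) (X q) (Y q)) p (Z p)
  - (bform (g p) (nabla p (Z p) G) (G p) * bform (g p) (X p) (Y p)
     + grad_sqnorm A g u p / 2 * (bform (g p) (nabla p (Z p) X) (Y p)
                                + bform (g p) (X p) (nabla p (Z p) Y)))
  - (bform (g p) (nabla p (Z p) (cov nabla X G)) (Y p)
     + bform (g p) (nabla p (X p) G) (nabla p (Z p) Y))
  + ((bform (g p) (nabla p (Z p) G) (X p) + bform (g p) (G p) (nabla p (Z p) X))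
       * bform (g p) (G p) (Y p)
     + bform (g p) (G p) (X p)
       * (bform (g p) (nabla p (Z p) G) (Y p) + bform (g p) (G p) (nabla p (Z p) Y))).
Proof.
move=> sX sY sZ; have sG := smooth_grad hA rg su; have [cn _] := lc.
have sc := smooth_cov cn openT sT sX sG.
have Tp : setT p by [].
have sm V W : svf V -> svf W -> mdiff (A := A) (fun q => bform (g q) (V q) (W q)) p.
  by move=> sV sW; exact: (smooth_mdiff hA (smooth_metric rg openT sV sW) Tp).
have dD : mdiff (A := A) (fun q => bform (D q) (X q) (Y q)) p.
  exact: (smooth_mdiff hA (sD openT sT sX sY) Tp).
have dN : mdiff (A := A) (fun q => grad_sqnorm A g u q / 2) p.
  exact: mdiffM (sm _ _ sG sG) (mdiff_cst _ _).
have -> : (fun q => bform (Dh q) (X q) (Y q)) = (fun q => bform (D q) (X q) (Y q)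
  - grad_sqnorm A g u q / 2 * bform (g q) (X q) (Y q)
  - bform (g q) (cov nabla X G q) (Y q)
  + bform (g q) (G q) (X q) * bform (g q) (G q) (Y q)).
  by apply/funext => q; exact: bform_transformed.
have d1 := mdiffM dN (sm _ _ sX sY).
have d2 := mdiffB dD d1.
have d3 := mdiffB d2 (sm _ _ sc sY).
have d4 := mdiffM (sm _ _ sG sX) (sm _ _ sG sY).
rewrite (derD _ d3 d4) (derB hA _ d2 (sm _ _ sc sY)) (derB hA _ dD d1).
rewrite (derM hA _ dN (sm _ _ sX sY)) (derM hA _ (sm _ _ sG sX) (sm _ _ sG sY)).
have -> : der A (fun q => grad_sqnorm A g u q / 2) p (Z p)
        = bform (g p) (nabla p (Z p) G) (G p).
  rewrite (derM hA _ (sm _ _ sG sG) (mdiff_cst _ _)) der_cst mulr0 addr0.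
  by rewrite (grad_sqnorm_der hA rg lc p (Z p) su) mulrAC divff ?mul1r // pnatr_eq0.
rewrite (lc_metric lc openT sT _ sX sY Tp) (lc_metric lc openT sT _ sc sY Tp).
by rewrite (lc_metric lc openT sT _ sG sX Tp) (lc_metric lc openT sT _ sG sY Tp).
Qed.

(** [nablau] acts only on [W], the other connection terms having been collected in the bracket.
    There [conformal_connection] replaces it, while [R123] turns the curvature of the gradient into
    values of [D]. *)
Lemma skew_derivative_invariant U V W p : svf U -> svf V -> svf W ->
  skew_derivative A nablau Dh V U W p = skew_derivative A nabla D V U W p.
Proof.
move=> sU sV sW; have sG := smooth_grad hA rg su; have [cn _] := lc.
have du := smooth_mdiff hA su (I : setT p).
rewrite /skew_derivative (der_transformed p sU sW sV) (der_transformed p sV sW sU).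
rewrite (conformal_connection hA rg lc su lcu p sV sW).
rewrite (conformal_connection hA rg lc su lcu p sU sW).
have lieE := lc_torsion lc openT sT sV sU (I : setT p).
have curvE := curv_vfields hA cn p sV sU sG.
have R123 := surface_curv_trace hA rg lc (V p) (U p) (G p) (W p) (trD p) (symD p).
rewrite curvE !bformBl in R123.
rewrite !(bformDr (Dh p)) !(bformNr (Dh p)) !(bformZr (Dh p)) !bform_transformed.
(* Symmetry of the Hessian, of [D] and of the metric brings equal quantities to one form, so that
   each is a single letter of [invariance_alg]. *)
rewrite (hess_sym hA rg lc p su sU sV).
rewrite -!(metric_grad rg _ du).
rewrite (bform_sym (V p) (U p) (symD p)) (metric_sym rg p (V p) (U p)).
rewrite (metric_sym rg p (U p) (G p)) (metric_sym rg p (V p) (G p)).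
rewrite -[grad_sqnorm A g u p]/(bform (g p) (G p) (G p)).
have lieg := bformBl (g p) (cov nabla V U p) (cov nabla U V p) (W p).
have liex := bformBr (g p) (G p) (cov nabla V U p) (cov nabla U V p).
rewrite lieE /cov in lieg; rewrite lieE /cov in liex.
exact: (invariance_alg _ _ _ _ _ _ _ _ _ _ _ _ _ _ _ _ _ _ _ _ R123 lieg liex).
Qed.

End Invariance.

(** * Products and the ambient metric *)

Section Products.
Context {R : realType}.

Lemma continuous_coord (T : topologicalType) m (f : T -> 'rV[R]_m) x i :
  {for x, continuous f} -> {for x, continuous (fun y => f y 0 i)}.
Proof.
move=> cf; apply: (@continuous_comp _ _ _ f (fun v : 'rV[R]_m => v 0 i)) => //.
exact: differentiable_continuous (differentiable_coord _ _ _).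
Qed.

Lemma continuous_rV (T : topologicalType) m (f : T -> 'rV[R]_m) x :
  (forall i, {for x, continuous (fun y => f y 0 i)}) -> {for x, continuous f}.
Proof.
move=> cf; have -> : f = \sum_i (fun y => f y 0 i *: delta_mx 0 i).
  by apply/funext => y; rewrite fct_sumE -row_sum_delta.
elim/big_ind : _ => [|a b|i _]; [exact: cst_continuous|exact: continuousD|].
apply: (@continuous_comp _ _ _ (fun y => f y 0 i) (fun t => t *: delta_mx 0 i)).
  exact: cf.
exact: scalel_continuous.
Qed.

(** Serves the projections [lsubmx] and [rsubmx], through which product charts are read. *)
Lemma class_C_linear n m k (O : set 'rV[R]_n) (f : {linear 'rV[R]_n -> 'rV[R]_m}) :
  open O -> class_C k O f.
Proof.
move=> oO; apply/(class_C_coordP _ _ oO) => i.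
have -> : (fun z : 'rV[R]_n => (f z) 0 i)
        = fun z => \sum_j z 0 j * (f (delta_mx 0 j)) 0 i.
  apply/funext => z; rewrite {1}[z]row_sum_delta linear_sum summxE.
  by apply: eq_bigr => j _; rewrite linearZ mxE.
apply: (class_C_sum oO) => j; apply: (class_C_mul oO); last exact: class_C_cst.
case: k => [|k].
  move=> z _; exact: differentiable_continuous (differentiable_coord _ _ _).
apply/class_CS; split=> [z _|v]; first exact: differentiable_coord.
have -> : 'D_v (fun z : 'rV[R]_n => z 0 j) = fun=> v 0 j.
  apply/funext => z; rewrite -(derive_coord (f := id)); last exact: ex_diff.
  by rewrite derive_id.
exact: class_C_cst.
Qed.

Lemma linear_rV_diff n m (f : {linear 'rV[R]_n -> 'rV[R]_m}) z : differentiable f z.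
Proof. by have /class_CS[+ _] := class_C_linear 1 f openT; exact. Qed.

Lemma linear_rV_continuous n m (f : {linear 'rV[R]_n -> 'rV[R]_m}) : continuous f.
Proof. by move=> z; exact: (class_C_linear 0 f openT). Qed.

Lemma linear_rV_derive n m (f : {linear 'rV[R]_n -> 'rV[R]_m}) z v : 'D_v f z = f v.
Proof.
rewrite deriveE; last exact: linear_rV_diff.
by rewrite diff_lin //; exact: linear_rV_continuous.
Qed.

Lemma row_mx_coord n m (a : 'rV[R]_n) (b : 'rV[R]_m) i :
  (row_mx a b) 0 i = match fintype.split i with inl j => a 0 j | inr j => b 0 j end.
Proof. by rewrite mxE. Qed.

Lemma charted_line : charted (line_atlas R).
Proof.
have imT : (cmap (line_atlas R) 0 @` setT : set 'rV[R]_1) = setT.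
  apply/seteqP; split=> // z _; exists (z 0 0) => //.
  by apply/rowP => i; rewrite mxE ord1.
split=> [t|t|s t k].
- split; [exact: openT|by []|].
  by rewrite -[X in open X]/(cmap (line_atlas R) 0 @` setT) imT; exact: openT.
- split=> [s _|s _|z _].
  + by rewrite /= mxE.
  + have -> : cmap (line_atlas R) t = fun s : R => s *: (const_mx 1 : 'rV[R]_1).
      by apply/funext => x; apply/rowP => i; rewrite !mxE mulr1.
    exact: scalel_continuous.
  + exact: differentiable_continuous (differentiable_coord _ _ _).
have -> : cmap (line_atlas R) t \o cinv (line_atlas R) s = id.
  by apply/funext => z; apply/rowP => i; rewrite /= mxE ord1.
rewrite setIT; apply: (class_C_linear _ idfun).
by rewrite -[X in open X]/(cmap (line_atlas R) 0 @` setT) imT; exact: openT.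
Qed.

Context {M N : topologicalType} {m n : nat} {A : atlas R M m} {B : atlas R N n}.
Context (hA : charted A) (hB : charted B).
Local Notation AB := (prod_atlas A B).

Lemma derive_row_mx i j (f : 'rV[R]_m -> 'rV[R]_i) (h : 'rV[R]_n -> 'rV[R]_j) z v :
  differentiable f (lsubmx z) -> differentiable h (rsubmx z) ->
  differentiable (fun z => row_mx (f (lsubmx z)) (h (rsubmx z))) z /\
  'D_v (fun z => row_mx (f (lsubmx z)) (h (rsubmx z))) z
  = row_mx ('D_(lsubmx v) f (lsubmx z)) ('D_(rsubmx v) h (rsubmx z)).
Proof.
move=> df dh.
have dl : differentiable (lsubmx : 'rV[R]_(m + n) -> _) z by exact: linear_rV_diff.
have dr : differentiable (rsubmx : 'rV[R]_(m + n) -> _) z by exact: linear_rV_diff.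
have dfl := differentiable_comp dl df; have dhr := differentiable_comp dr dh.
have d : differentiable (fun z => row_mx (f (lsubmx z)) (h (rsubmx z))) z.
  apply/differentiable_rV => k; under eq_fun do rewrite row_mx_coord.
  case: (fintype.split k) => l; first exact: ((differentiable_rV _ _).1 dfl l).
  exact: ((differentiable_rV _ _).1 dhr l).
split=> //; apply/rowP => k; rewrite derive_coord //.
under [in LHS]eq_fun do rewrite row_mx_coord.
rewrite row_mx_coord; case: (fintype.split k) => l.
  rewrite -(derive_coord v l dfl) (derive_comp_diff v dl df).
  by rewrite (linear_rV_derive lsubmx).
rewrite -(derive_coord v l dhr) (derive_comp_diff v dr dh).
by rewrite (linear_rV_derive rsubmx).
Qed.

Lemma image_prod p (U : set M) (V : set N) :
  cmap AB p @` [set q | U q.1 /\ V q.2]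
  = [set z | (cmap A p.1 @` U) (lsubmx z) /\ (cmap B p.2 @` V) (rsubmx z)].
Proof.
apply/seteqP; split=> [_ [q [Uq Vq] <-]|z [[x Ux xz] [y Vy yz]]] /=.
  by rewrite row_mxKl row_mxKr; split; [exists q.1|exists q.2].
by exists (x, y) => //=; rewrite xz yz hsubmxK.
Qed.

Lemma charted_prod : charted AB.
Proof.
have copen U V : open U -> open V ->
    open [set z : 'rV[R]_(m + n) | U (lsubmx z) /\ V (rsubmx z)].
  move=> oU oV; apply: openI; apply: open_comp => // z _; exact: linear_rV_continuous.
split=> [p|p|p q k].
- have [/(_ p.1)[oA pA iA] _ _] := hA; have [/(_ p.2)[oB pB iB] _ _] := hB.
  split; [|by split|rewrite image_prod; exact: copen].
  apply: openI; apply: open_comp => // x _; [exact: cvg_fst|exact: cvg_snd].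
- have [_ /(_ p.1)[KA cA cA'] _] := hA; have [_ /(_ p.2)[KB cB cB'] _] := hB.
  split=> [q /set_mem[qA qB]|q [qA qB]|z].
  + by rewrite /= row_mxKl row_mxKr KA ?KB ?inE //; case: q {qA qB}.
  + apply: continuous_rV => k.
    have -> : (fun y => (cmap AB p y) 0 k) = match fintype.split k with
        | inl j => fun y : M * N => (cmap A p.1 y.1) 0 j
        | inr j => fun y : M * N => (cmap B p.2 y.2) 0 j end.
      by apply/funext => y; rewrite /= row_mx_coord; case: (fintype.split k).
    case: (fintype.split k) => j; apply: continuous_coord.
      by apply: (@continuous_comp _ _ _ fst (cmap A p.1)); [exact: cvg_fst|exact: cA].
    by apply: (@continuous_comp _ _ _ snd (cmap B p.2)); [exact: cvg_snd|exact: cB].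
  + rewrite image_prod => -[zA zB].
    have cl : {for z, continuous (fun z : 'rV[R]_(m + n) => cinv A p.1 (lsubmx z))}.
      apply: (@continuous_comp _ _ _ lsubmx (cinv A p.1)); last exact: cA'.
      exact: linear_rV_continuous.
    have cr : {for z, continuous (fun z : 'rV[R]_(m + n) => cinv B p.2 (rsubmx z))}.
      apply: (@continuous_comp _ _ _ rsubmx (cinv B p.2)); last exact: cB'.
      exact: linear_rV_continuous.
    exact: (@cvg_pair _ _ _ (nbhs z) _ _ _ _ _ _ _ cl cr).
have -> : cdom AB p `&` cdom AB q = [set x | (cdom A p.1 `&` cdom A q.1) x.1 /\
    (cdom B p.2 `&` cdom B q.2) x.2].
  by apply/seteqP; split=> x [] [? ?] [].
have oA : open (cmap A p.1 @` (cdom A p.1 `&` cdom A q.1)).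
  by rewrite setIC; exact/(image_open hA)/(cdom_open hA).
have oB : open (cmap B p.2 @` (cdom B p.2 `&` cdom B q.2)).
  by rewrite setIC; exact/(image_open hB)/(cdom_open hB).
rewrite image_prod; have oI := copen _ _ oA oB.
apply/(class_C_coordP _ _ oI) => i.
have -> : (fun z => ((cmap AB q \o cinv AB p) z) 0 i) = match fintype.split i with
    | inl j => fun z : 'rV[R]_(m + n) => ((cmap A q.1 \o cinv A p.1) (lsubmx z)) 0 j
    | inr j => fun z : 'rV[R]_(m + n) => ((cmap B q.2 \o cinv B p.2) (rsubmx z)) 0 j end.
  by apply/funext => y; rewrite /= row_mx_coord; case: (fintype.split i).
case: (fintype.split i) => j.
  have [_ _ /(_ p.1 q.1 k)] := hA; move/(class_C_coordP _ _ oA)/(_ j) => sA.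
  by apply: (class_C_comp oI _ (class_C_linear k lsubmx oI) sA) => z [].
have [_ _ /(_ p.2 q.2 k)] := hB; move/(class_C_coordP _ _ oB)/(_ j) => sB.
by apply: (class_C_comp oI _ (class_C_linear k rsubmx oI) sB) => z [].
Qed.

(** The transition maps of a product are products, so their Jacobians are block diagonal. *)
Lemma tocoord_prod y q v : cdom AB y q ->
  tocoord AB y q v = row_mx (tocoord A y.1 q.1 (lsubmx v)) (tocoord B y.2 q.2 (rsubmx v)).
Proof.
move=> [yA yB]; have dA := transition_diff hA (cdom_refl hA q.1) yA.
have dB := transition_diff hB (cdom_refl hB q.2) yB.
have el : lsubmx (cmap AB q q) = cmap A q.1 q.1 by rewrite /= row_mxKl.
have er : rsubmx (cmap AB q q) = cmap B q.2 q.2 by rewrite /= row_mxKr.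
rewrite -el in dA; rewrite -er in dB.
by have [_ e] := derive_row_mx v dA dB; rewrite el er in e; exact: e.
Qed.

Lemma const_vfield_prod y q v : cdom AB y q ->
  const_vfield AB y v q
  = row_mx (const_vfield A y.1 (lsubmx v) q.1) (const_vfield B y.2 (rsubmx v) q.2).
Proof.
move=> [yA yB]; have dA := transition_diff hA yA (cdom_refl hA q.1).
have dB := transition_diff hB yB (cdom_refl hB q.2).
have el : lsubmx (cmap AB y q) = cmap A y.1 q.1 by rewrite /= row_mxKl.
have er : rsubmx (cmap AB y q) = cmap B y.2 q.2 by rewrite /= row_mxKr.
rewrite -el in dA; rewrite -er in dB.
by have [_ e] := derive_row_mx v dA dB; rewrite el er in e; exact: e.
Qed.

Lemma dfun_fst (W : normedModType R) (f : M -> W) p v : mdiff (A := A) f p.1 ->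
  mdiff (A := AB) (fun q => f q.1) p /\
  dfun AB (fun q => f q.1) p v = dfun A f p.1 (lsubmx v).
Proof.
move=> df; have el : lsubmx (cmap AB p p) = cmap A p.1 p.1 by rewrite /= row_mxKl.
have dl : differentiable (lsubmx : 'rV[R]_(m + n) -> _) (cmap AB p p).
  exact: linear_rV_diff.
have df' : differentiable (f \o cinv A p.1) (lsubmx (cmap AB p p)) by rewrite el.
split; first exact: differentiable_comp dl df'.
have := derive_comp_diff v dl df'; rewrite (linear_rV_derive lsubmx) el; exact.
Qed.

Lemma dfun_snd (W : normedModType R) (f : N -> W) p v : mdiff (A := B) f p.2 ->
  mdiff (A := AB) (fun q => f q.2) p /\
  dfun AB (fun q => f q.2) p v = dfun B f p.2 (rsubmx v).
Proof.
move=> df; have er : rsubmx (cmap AB p p) = cmap B p.2 p.2 by rewrite /= row_mxKr.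
have dr : differentiable (rsubmx : 'rV[R]_(m + n) -> _) (cmap AB p p).
  exact: linear_rV_diff.
have df' : differentiable (f \o cinv B p.2) (rsubmx (cmap AB p p)) by rewrite er.
split; first exact: differentiable_comp dr df'.
have := derive_comp_diff v dr df'; rewrite (linear_rV_derive rsubmx) er; exact.
Qed.

End Products.

Lemma line_tocoord (R : realType) (s t : R) v : tocoord (line_atlas R) s t v = v.
Proof.
rewrite /tocoord (_ : _ \o _ = id) ?derive_id //.
by apply/funext => z; apply/rowP => i; rewrite /= mxE ord1.
Qed.

Lemma line_const_vfield (R : realType) (s t : R) v :
  const_vfield (line_atlas R) s v t = v.
Proof. exact: line_tocoord. Qed.

Lemma line_dfun (R : realType) (t : R) v :
  mdiff (A := line_atlas R) (id : R -> R) t /\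
  dfun (line_atlas R) (id : R -> R) t v = v 0 0.
Proof.
split; first exact: differentiable_coord.
have d : differentiable (id : 'rV[R]_1 -> 'rV[R]_1) (const_mx t) by exact: ex_diff.
by have := derive_coord v 0 d; rewrite derive_id => ->.
Qed.

(** Koszul's formula for nabla_X d_t against y where rho = 0. Here [tX], [ty], [ry] are components
    along [d_t] and [d_rho], [h] is the g-product of the parts tangent to M, and the zeros and ones
    come from the components of [d_t] and from the vanishing [d_rho] component of X. *)
Lemma nabla_dt_alg (F : realFieldType) (h ry tX ty t : F) : t != 0 -> forall k d1 d2 d3 : F,
  2 * k = d1 + d2 - d3 ->
  d1 = (0 * 1 + tX * 0) * ty + 1 * (0 * ty + tX * ry) + (2 * t * tX * 0 + t ^+ 2 * 0) ->
  d2 = (0 * tX + 1 * 0) * ty + tX * (0 * ty + 1 * ry) + (2 * t * 1 * h + t ^+ 2 * 0) ->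
  d3 = (ry * tX + ty * 0) * 1 + tX * (ry * 1 + ty * 0) + (2 * t * ty * 0 + t ^+ 2 * 0) ->
  k = t * (t^-1 * 0 * ty + t^-1 * 0 * ry) + t ^+ 2 * (t^-1 * h).
Proof.
move=> tn k d1 d2 d3 kE e1 e2 e3; apply: (@mulfI F 2); first by rewrite pnatr_eq0.
by rewrite kE e1 e2 e3; field.
Qed.

Section KoszulFrame.
Context {R : realType} {M : topologicalType} {n : nat} {A : atlas R M n} (hA : charted A).
Context {h : M -> 'M[R]_n} (symh : forall p v w, bform (h p) v w = bform (h p) w v).
Context {nabla : @covariant R M n} {O : set M} (oO : open O) (lc : levi_civita A O h nabla).

Lemma koszul_frame p v w x : O p -> let E := const_vfield A p in
  2 * bform (h p) (nabla p v (E w)) x =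
    der A (fun q => bform (h q) (E w q) (E x q)) p v
  + der A (fun q => bform (h q) (E v q) (E x q)) p w
  - der A (fun q => bform (h q) (E v q) (E w q)) p x.
Proof.
move=> Op E.
have oI : open (cdom A p `&` O) by apply: openI oO; exact: (cdom_open hA).
have Ip : (cdom A p `&` O) p by split=> //; exact: (cdom_refl hA).
have sE y : smooth_vfield A (cdom A p `&` O) (E y).
  exact: (smooth_vfield_subset (@subIsetl _ _ _) (smooth_const_vfield hA p y)).
have k := koszul symh lc oI (@subIsetr _ _ _) (sE v) (sE w) (sE x) Ip.
have Ep y : E y p = y := const_vfield_id hA p y.
have br y z : lie_bracket A (E y) (E z) p = 0 := lie_bracket_const hA p y z.
rewrite (br v w) (br v x) (br w x) !bform0l addr0 !subr0 in k.
rewrite (Ep v) (Ep w) (Ep x) in k; exact: k.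
Qed.

End KoszulFrame.

(** * The ambient metric in coordinates *)

Section AmbientCoordinates.
Context {R : realType} {n : nat}.
Implicit Types (X Y : 'rV[R]_(1 + (1 + n))).

Definition tcomp X : R := (lsubmx X) 0 0.
Definition rcomp X : R := (lsubmx (rsubmx X)) 0 0.
Definition mcomp X : 'rV[R]_n := rsubmx (rsubmx X).

Lemma ambient_vec_eq X Y :
  tcomp X = tcomp Y -> rcomp X = rcomp Y -> mcomp X = mcomp Y -> X = Y.
Proof.
move=> tXY rXY mXY; rewrite -[X]hsubmxK -[Y]hsubmxK; congr row_mx.
  by apply/rowP => i; rewrite ord1.
rewrite -[LHS]hsubmxK -[RHS]hsubmxK; congr row_mx => //.
by apply/rowP => i; rewrite ord1.
Qed.

Lemma tcompD X Y : tcomp (X + Y) = tcomp X + tcomp Y.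
Proof. by rewrite /tcomp linearD mxE. Qed.
Lemma rcompD X Y : rcomp (X + Y) = rcomp X + rcomp Y.
Proof. by rewrite /rcomp !linearD mxE. Qed.
Lemma mcompD X Y : mcomp (X + Y) = mcomp X + mcomp Y.
Proof. by rewrite /mcomp !linearD. Qed.
Lemma tcompZ a X : tcomp (a *: X) = a * tcomp X.
Proof. by rewrite /tcomp linearZ mxE. Qed.
Lemma rcompZ a X : rcomp (a *: X) = a * rcomp X.
Proof. by rewrite /rcomp !linearZ mxE. Qed.
Lemma mcompZ a X : mcomp (a *: X) = a *: mcomp X.
Proof. by rewrite /mcomp !linearZ. Qed.

Lemma tcomp_row (a : 'rV[R]_1) b (v : 'rV[R]_n) : tcomp (row_mx a (row_mx b v)) = a 0 0.
Proof. by rewrite /tcomp row_mxKl. Qed.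
Lemma rcomp_row (a : 'rV[R]_1) b (v : 'rV[R]_n) : rcomp (row_mx a (row_mx b v)) = b 0 0.
Proof. by rewrite /rcomp row_mxKr row_mxKl. Qed.
Lemma mcomp_row (a : 'rV[R]_1) b (v : 'rV[R]_n) : mcomp (row_mx a (row_mx b v)) = v.
Proof. by rewrite /mcomp !row_mxKr. Qed.

Lemma tcomp_dt : tcomp (d_t : 'rV[R]_(1 + (1 + n))) = 1.
Proof. by rewrite /tcomp /d_t row_mxKl mxE. Qed.
Lemma rcomp_dt : rcomp (d_t : 'rV[R]_(1 + (1 + n))) = 0.
Proof. by rewrite /rcomp /d_t row_mxKr linear0 mxE. Qed.
Lemma mcomp_dt : mcomp (d_t : 'rV[R]_(1 + (1 + n))) = 0.
Proof. by rewrite /mcomp /d_t row_mxKr linear0. Qed.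
Lemma tcomp_drho : tcomp (d_rho : 'rV[R]_(1 + (1 + n))) = 0.
Proof. by rewrite /d_rho tcomp_row mxE. Qed.
Lemma rcomp_drho : rcomp (d_rho : 'rV[R]_(1 + (1 + n))) = 1.
Proof. by rewrite /d_rho rcomp_row mxE. Qed.
Lemma mcomp_drho : mcomp (d_rho : 'rV[R]_(1 + (1 + n))) = 0.
Proof. by rewrite /d_rho mcomp_row. Qed.
Lemma tcomp_lift (v : 'rV[R]_n) : tcomp (lift_vec v) = 0.
Proof. by rewrite /lift_vec tcomp_row mxE. Qed.
Lemma rcomp_lift (v : 'rV[R]_n) : rcomp (lift_vec v) = 0.
Proof. by rewrite /lift_vec rcomp_row mxE. Qed.
Lemma mcomp_lift (v : 'rV[R]_n) : mcomp (lift_vec v) = v.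
Proof. by rewrite /lift_vec mcomp_row. Qed.

Definition compE := (tcompD, rcompD, mcompD, tcompZ, rcompZ, mcompZ, tcomp_dt, rcomp_dt,
  mcomp_dt, tcomp_drho, rcomp_drho, mcomp_drho, tcomp_lift, rcomp_lift, mcomp_lift).

End AmbientCoordinates.

Section AmbientMetric.
Context {R : realType} {M : topologicalType} {n : nat} {A : atlas R M n}.
Context (hA : charted A) {g : M -> 'M[R]_n} (rg : riemannian_metric A g).
Context {alpha : R -> M -> 'M[R]_n} (salpha : smooth_family A alpha).
Context (selfa : forall rho, self_adjoint g (alpha rho)).
Context (alpha0 : forall p, alpha 0 p = 1%:M).
Local Notation LA := (prod_atlas (line_atlas R) A).
Local Notation B := (ambient_atlas A).
Local Notation gt := (ambient_metric A g alpha).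
Local Notation MT := (R * (R * M))%type.
Implicit Types (P Q : MT) (X Y v w : 'rV[R]_(1 + (1 + n))).

Lemma charted_ambient : charted B.
Proof. exact: charted_prod (charted_line) (charted_prod charted_line hA). Qed.
Let hB := charted_ambient.
Let hLA : charted LA := charted_prod charted_line hA.

Lemma ambient_open delta : open (ambient delta : set MT).
Proof.
have -> : (ambient delta : set MT) = (fst @^-1` [set t | 0 < t]) `&`
    ((fun Q => Q.2.1) @^-1` ([set r | - delta < r] `&` [set r | r < delta])).
  apply/seteqP; split=> Q; first by move=> [? /andP[]].
  by move=> [? [? ?]]; split=> //; apply/andP.
apply: openI; apply: open_comp.
- by move=> Q _; exact: cvg_fst.
- exact: open_gt.
- move=> Q _; apply: (@continuous_comp _ _ _ snd (fst : R * M -> R)).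
    exact: cvg_snd.
  exact: cvg_fst.
- by apply: openI; [exact: open_gt|exact: open_lt].
Qed.

Lemma tocoord_ambient P Q X : cdom A P.2.2 Q.2.2 -> tocoord B P Q X
  = row_mx (lsubmx X) (row_mx (lsubmx (rsubmx X)) (tocoord A P.2.2 Q.2.2 (mcomp X))).
Proof.
move=> PQ; rewrite (tocoord_prod charted_line hLA); last by split=> //; split.
rewrite line_tocoord; congr row_mx; rewrite (tocoord_prod charted_line hA); last by split.
by rewrite line_tocoord.
Qed.

Lemma const_vfield_ambient P Q X : cdom A P.2.2 Q.2.2 -> const_vfield B P X Q
  = row_mx (lsubmx X) (row_mx (lsubmx (rsubmx X)) (const_vfield A P.2.2 (mcomp X) Q.2.2)).
Proof.
move=> PQ; rewrite (const_vfield_prod charted_line hLA); last by split=> //; split.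
rewrite line_const_vfield; congr row_mx.
rewrite (const_vfield_prod charted_line hA); last by split.
by rewrite line_const_vfield.
Qed.

Lemma der_time Q X : mdiff (A := B) (fun Q => Q.1) Q /\ der B (fun Q => Q.1) Q X = tcomp X.
Proof.
have [d e] := line_dfun (Q.1) (lsubmx X).
have [d' e'] := dfun_fst (B := LA) (p := Q) X d.
by split; [exact: d'|rewrite /tcomp -e -e'].
Qed.

Lemma der_rho Q X : mdiff (A := B) (fun Q => Q.2.1) Q /\ der B (fun Q => Q.2.1) Q X = rcomp X.
Proof.
have [d e] := line_dfun (Q.2.1) (lsubmx (rsubmx X)).
have [d' e'] := dfun_fst (B := A) (p := Q.2) (rsubmx X) d.
have [d2 e2] := dfun_snd (A := line_atlas R) (p := Q) X d'.
by split; [exact: d2|rewrite /rcomp -e -e' -e2].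
Qed.

Lemma ambient_metricE Q X Y : bform (gt Q) X Y =
  (Q.2.1 * tcomp X + Q.1 * rcomp X) * tcomp Y
  + tcomp X * (Q.2.1 * tcomp Y + Q.1 * rcomp Y)
  + Q.1 ^+ 2 * bform (g Q.2.2) (mcomp X *m alpha Q.2.1 Q.2.2) (mcomp Y).
Proof.
have dtE Z : dfun B (fun s : MT => s.1 : R) Q Z = tcomp Z := (der_time Q Z).2.
have drtE Z : dfun B (fun s : MT => s.2.1 * s.1 : R) Q Z = Q.2.1 * tcomp Z + Q.1 * rcomp Z.
  rewrite -[LHS]/(der B (fun s : MT => s.2.1 * s.1) Q Z).
  rewrite (derM hB Z (der_rho Q Z).1 (der_time Q Z).1) (der_rho Q Z).2 (der_time Q Z).2.
  by rewrite addrC (mulrC (rcomp Z)).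
rewrite /ambient_metric bform_form_mx => [|a Z Z' W|a Z W W'].
- by rewrite !drtE !dtE.
- rewrite !drtE !dtE -!/(mcomp _) !compE mulmxDl -scalemxAl bformDl bformZl.
  by move: (bform _ _ _) (bform _ _ _) => b1 b2; ring.
- rewrite !drtE !dtE -!/(mcomp _) !compE bformDr bformZr.
  by move: (bform _ _ _) (bform _ _ _) => b1 b2; ring.
Qed.

(** The square of [t] is written as a product, the form to which the product rule is applied in
    [ambient_frame]. *)
Lemma ambient_metric_comp Q X Y X' Y' mX mY :
  tcomp X' = tcomp X -> tcomp Y' = tcomp Y -> rcomp X' = rcomp X -> rcomp Y' = rcomp Y ->
  mcomp X' = mX -> mcomp Y' = mY ->
  (Q.2.1 * tcomp X + Q.1 * rcomp X) * tcomp Y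
    + tcomp X * (Q.2.1 * tcomp Y + Q.1 * rcomp Y)
    + Q.1 * Q.1 * bform (g Q.2.2) (mX *m alpha Q.2.1 Q.2.2) mY = bform (gt Q) X' Y'.
Proof.
by move=> tX tY rX rY mX' mY'; rewrite (ambient_metricE Q X' Y') tX tY rX rY mX' mY' expr2.
Qed.

Lemma ambient_metric_sym Q X Y : bform (gt Q) X Y = bform (gt Q) Y X.
Proof.
rewrite !ambient_metricE (selfa Q.2.1) (metric_sym rg).
by move: (bform _ _ _) => b; ring.
Qed.

Lemma ambient_metric0 Q X Y : Q.2.1 = 0 -> bform (gt Q) X Y =
  Q.1 * (rcomp X * tcomp Y + tcomp X * rcomp Y)
  + Q.1 ^+ 2 * bform (g Q.2.2) (mcomp X) (mcomp Y).
Proof.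
by move=> Q0; rewrite ambient_metricE Q0 alpha0 mulmx1; move: (bform _ _ _) => b; ring.
Qed.

(** Along rho = 0 the metric pairs [d_t] with [d_rho]: testing against either detects the component
    along the other, and lifts detect the part tangent to M. *)
Lemma ambient_metric_inj Q X Y : Q.2.1 = 0 -> 0 < Q.1 ->
  (forall Z, bform (gt Q) X Z = bform (gt Q) Y Z) -> X = Y.
Proof.
move=> Q0 Q1 XY; have Qn0 : Q.1 != 0 by rewrite gt_eqF.
apply: ambient_vec_eq.
- have := XY d_rho; rewrite !ambient_metric0 // !compE !bform0r !mulr0 !addr0 !mulr1 !add0r.
  exact: mulfI.
- have := XY d_t; rewrite !ambient_metric0 // !compE !bform0r !mulr0 !addr0 !mulr1.
  exact: mulfI.
apply: (metric_inj rg (p := Q.2.2)) => v.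
have := XY (lift_vec v); rewrite !ambient_metric0 // !compE !mulr0 !addr0 !mulr0 !add0r.
by apply: mulfI; rewrite expf_neq0.
Qed.

Section Frame.
Context (P : MT).
Local Notation p := (P.2.2).
Local Notation E v := (const_vfield B P v).

(** The part of the metric tangent to M on coordinate fields, without the factor [t ^+ 2], as a
    function of rho and the point. *)
Let H (v w : 'rV[R]_n) (r : R * M) : R := bform (g r.2)
  (const_vfield A p v r.2 *m alpha r.1 r.2) (const_vfield A p w r.2).

(** Joint smoothness of the family makes the components of [alpha] applied to a frame field
    differentiable in rho and the point together; the metric pairs them with fields that do not
    depend on rho. *)
Lemma mdiff_family (v w : 'rV[R]_n) : mdiff (A := LA) (H v w) P.2.
Proof.
have oI := cdom_open hA p; have pp := cdom_refl hA p.
have sE x := smooth_const_vfield hA p x.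
pose a r := tocoord A p r.2 (const_vfield A p v r.2 *m alpha r.1 r.2).
have da : mdiff (A := LA) a P.2.
  have /class_CS[da _] := salpha oI (sE v) P.2 p 1%N.
  by apply: da; exists P.2 => //; split => //; split.
pose f k q := bform (g q) (const_vfield A p (basis_vec k) q) (const_vfield A p w q).
have df k : mdiff (A := LA) (fun r => f k r.2) P.2.
  have sf := smooth_metric rg oI (sE (basis_vec k)) (sE w).
  exact: (dfun_snd (A := line_atlas R) (p := P.2) 0 (smooth_mdiff hA sf pp)).1.
have nH : \forall r \near P.2, \sum_k (a r) 0 k * f k r.2 = H v w r.
  have nI : nbhs P.2 (cdom LA P.2).
    by apply: open_nbhs_nbhs; split; [exact: (cdom_open hLA)|exact: (cdom_refl hLA)].
  apply: filterS nI => r [_ pr].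
  rewrite /H [X in bform _ X _](frame_sum hA _ pr) bform_suml.
  by apply: eq_bigr => k _; rewrite bformZl.
apply: (mdiff_ext hLA nH); apply: mdiff_sum => k; apply: mdiffM; last exact: df.
exact: ((mdiff_coord _ _).1 da k).
Qed.

Let G X Y Q : R := bform (gt Q) (E X Q) (E Y Q).

Lemma ambient_frame X Y Z : mdiff (A := B) (G X Y) P /\
  der B (G X Y) P Z = (rcomp Z * tcomp X + tcomp Z * rcomp X) * tcomp Y
    + tcomp X * (rcomp Z * tcomp Y + tcomp Z * rcomp Y)
    + (2 * P.1 * tcomp Z * H (mcomp X) (mcomp Y) P.2
       + P.1 ^+ 2 * der LA (H (mcomp X) (mcomp Y)) P.2 (rsubmx Z)).
Proof.
have nG : \forall Q \near P, (Q.2.1 * tcomp X + Q.1 * rcomp X) * tcomp Y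
    + tcomp X * (Q.2.1 * tcomp Y + Q.1 * rcomp Y)
    + Q.1 * Q.1 * H (mcomp X) (mcomp Y) Q.2 = G X Y Q.
  have nI : nbhs P (cdom B P).
    by apply: open_nbhs_nbhs; split; [exact: (cdom_open hB)|exact: (cdom_refl hB)].
  apply: filterS nI => Q [_ [_ pQ]].
  have eX := const_vfield_ambient X pQ; have eY := const_vfield_ambient Y pQ.
  have tX : tcomp (E X Q) = tcomp X by rewrite eX tcomp_row.
  have tY : tcomp (E Y Q) = tcomp Y by rewrite eY tcomp_row.
  have rX : rcomp (E X Q) = rcomp X by rewrite eX rcomp_row.
  have rY : rcomp (E Y Q) = rcomp Y by rewrite eY rcomp_row.
  have mX : mcomp (E X Q) = const_vfield A p (mcomp X) Q.2.2 by rewrite eX mcomp_row.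
  have mY : mcomp (E Y Q) = const_vfield A p (mcomp Y) Q.2.2 by rewrite eY mcomp_row.
  exact: (ambient_metric_comp Q tX tY rX rY mX mY).
have dt := (der_time P Z).1; have dr := (der_rho P Z).1.
have [dH eH] := dfun_snd (A := line_atlas R) (p := P) Z (mdiff_family (mcomp X) (mcomp Y)).
have dc (a : R) : mdiff (A := B) (fun=> a) P := mdiff_cst a P.
have dl a b : mdiff (A := B) (fun Q : MT => Q.2.1 * a + Q.1 * b) P.
  exact: mdiffD (mdiffM dr (dc a)) (mdiffM dt (dc b)).
have el a b : der B (fun Q : MT => Q.2.1 * a + Q.1 * b) P Z = rcomp Z * a + tcomp Z * b.
  rewrite (derD Z (mdiffM dr (dc a)) (mdiffM dt (dc b))) (derM hB Z dr (dc a)).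
  by rewrite (derM hB Z dt (dc b)) !der_cst !mulr0 !addr0 (der_rho P Z).2 (der_time P Z).2.
have d1 := mdiffM (dl (tcomp X) (rcomp X)) (dc (tcomp Y)).
have d2 := mdiffM (dc (tcomp X)) (dl (tcomp Y) (rcomp Y)).
have d3 := mdiffM (mdiffM dt dt) dH.
split; first exact: (mdiff_ext hB nG (mdiffD (mdiffD d1 d2) d3)).
rewrite -(der_ext hB Z nG) (derD Z (mdiffD d1 d2) d3) (derD Z d1 d2).
rewrite (derM hB Z (dl _ _) (dc _)) (derM hB Z (dc _) (dl _ _)) !el !der_cst.
rewrite (derM hB Z (mdiffM dt dt) dH) (derM hB Z dt dt) (der_time P Z).2.
rewrite [der B (fun Q => H _ _ Q.2) P Z]eH -/(der LA _ _ _).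
by move: (H _ _ _) (der LA _ _ _) => x y; ring.
Qed.

Lemma mcomp_frame0 (w : 'rV[R]_n) (v : 'rV[R]_(1 + n)) :
  H 0 w P.2 = 0 /\ der LA (H 0 w) P.2 v = 0 /\ H w 0 P.2 = 0 /\ der LA (H w 0) P.2 v = 0.
Proof.
have c0 q : const_vfield A p 0 q = 0.
  exact: derive0.
have -> : H 0 w = fun=> 0 by apply/funext => r; rewrite /H c0 mul0mx bform0l.
have -> : H w 0 = fun=> 0 by apply/funext => r; rewrite /H c0 bform0r.
by rewrite der_cst.
Qed.

Context {nt : @covariant R MT (1 + (1 + n))} {delta : R}.
Context (lc : levi_civita B (ambient delta) gt nt).

(** In Koszul's formula the terms with the [d_t] component of [X] cancel. What remains is the
    derivative of [t ^+ 2] along [d_t], that is [2 t] times the product of the parts tangent to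
    M. *)
Lemma nabla_dt X : ambient delta P -> P.2.1 = 0 -> rcomp X = 0 ->
  nt P X (const_vfield B P d_t) = P.1^-1 *: lift_vec (mcomp X).
Proof.
move=> aP P0 rX; have [t0 _] := aP; have tn : P.1 != 0 by rewrite gt_eqF.
apply: (ambient_metric_inj P0 t0) => y.
have k := koszul_frame hB ambient_metric_sym (ambient_open (delta := delta)) lc X d_t y aP.
have e1 : der B (G d_t y) P X = _ := (ambient_frame d_t y X).2.
have e2 : der B (G X y) P d_t = _ := (ambient_frame X y d_t).2.
have e3 : der B (G X d_t) P y = _ := (ambient_frame X d_t y).2.
have [H1 [H2 _]] := mcomp_frame0 (mcomp y) (rsubmx X).
have [_ [_ [H3 H4]]] := mcomp_frame0 (mcomp X) (rsubmx y).
have d0 : der LA (H (mcomp X) (mcomp y)) P.2 (rsubmx d_t) = 0.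
  by rewrite /d_t row_mxKr; exact: dfun0.
have hE : H (mcomp X) (mcomp y) P.2 = bform (g p) (mcomp X) (mcomp y).
  by rewrite /H P0 alpha0 mulmx1 !const_vfield_id.
rewrite !compE rX H1 H2 in e1; rewrite !compE rX d0 hE in e2.
rewrite !compE rX H3 H4 in e3.
have kE : 2 * bform (gt P) (nt P X (E d_t)) y
  = der B (G d_t y) P X + der B (G X y) P d_t - der B (G X d_t) P y := k.
rewrite [RHS](ambient_metric0 _ _ P0) !compE bformZl.
exact: (nabla_dt_alg tn kE e1 e2 e3).
Qed.

End Frame.
End AmbientMetric.

(** * Immersions with a lightlike normal frame *)

Lemma sub_alg (V : zmodType) (a b c : V) : a - b - c - a = - b - c.
Proof. by rewrite addrAC [a - b - a]addrAC subrr add0r. Qed.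

Lemma second_ff_alg (R : realType) k (d h1 h2 c k1 k2 : R) (e x : 'rV[R]_k) :
  d = h1 + h2 ->
  d *: e - c *: x - (h1 *: e - k1 *: x) - (h2 *: e - k2 *: x) = - (c - k1 - k2) *: x.
Proof. by move=> ->; apply/rowP => i; rewrite !mxE; ring. Qed.

Lemma derN (R : realType) (M : topologicalType) n (A : atlas R M n) (hA : charted A)
    (f : M -> R) p v : mdiff (A := A) f p ->
  mdiff (A := A) (fun q => - f q) p /\ der A (fun q => - f q) p v = - der A f p v.
Proof.
move=> df; have e : \forall q \near p, 0 - f q = - f q by apply: nearW => q; exact: sub0r.
split; first exact: (mdiff_ext hA e (mdiffB (mdiff_cst 0 p) df)).
by rewrite -(der_ext hA v e) (derB hA v (mdiff_cst 0 p) df) der_cst sub0r.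
Qed.

Lemma gauss_alg (F : realFieldType) (x d1 d2 d3 b1 b2 b3 : F)
    (aVWX aVXW aWVX aWXV aXVW aXWV : F) :
  2 * x = d1 + d2 - d3 + b1 - b2 - b3 ->
  d1 = aVWX + aVXW -> d2 = aWVX + aWXV -> d3 = aXVW + aXWV ->
  b1 = aVWX - aWVX -> b2 = aVXW - aXVW -> b3 = aWXV - aXWV -> aVWX = x.
Proof.
move=> k e1 e2 e3 e4 e5 e6; apply: (@mulfI F 2); first by rewrite pnatr_eq0.
by rewrite k e1 e2 e3 e4 e5 e6; ring.
Qed.

Lemma cov_alg (F : zmodType) (a x y b g : F) : a = x + y -> a = b -> y = g -> x = b - g.
Proof. by move=> -> <- ->; rewrite addrK. Qed.

Lemma bform_sub2 (R : realType) n (C : 'M[R]_n) u v w z :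
  bform C (u - v - w) z = bform C u z - bform C v z - bform C w z.
Proof. by rewrite !bformBl. Qed.

(** [k] is the product of the curvature with [xi]; it vanishes because the connection is compatible
    with the induced metric and has no torsion. *)
Lemma curv_alg1 (F : comRingType) (k c1 c2 c3 d1 d2 h1 h2 b l1 l2 : F) :
  k = c1 - c2 - c3 -> c1 = - d1 - h1 -> c2 = - d2 - h2 -> c3 = - b ->
  d1 = l1 + h2 -> d2 = l2 + h1 -> b = l1 - l2 -> k = 0.
Proof. by move=> -> -> -> -> -> -> ->; ring. Qed.

Lemma curv_alg2 (F : comRingType) (k c1 c2 c3 d1 d2 h1 h2 b b' : F) :
  k = c1 - c2 - c3 -> c1 = d1 + h1 -> c2 = d2 + h2 -> c3 = b -> b' = - b ->
  k = - (d2 - d1 - h1 + h2 - b').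
Proof. by move=> -> -> -> -> ->; ring. Qed.

Section NullFrame.
Context {R : realType} {M N : topologicalType} {n m : nat}.
Context {A : atlas R M n} {B : atlas R N m} (hA : charted A) (hB : charted B).
Context {O : set N} (oO : open O) {gt : N -> 'M[R]_m} {nt : @covariant R N m}.
Context (lc : levi_civita B O gt nt).
Context {Psi : M -> N} (sPsi : smooth_map A B Psi) (PsiO : forall q, O (Psi q)).
Local Notation T := (tmap A B Psi).
Local Notation ca := (cov_along A B nt Psi).
Local Notation E y a := (const_vfield B y (basis_vec a)).
Local Notation along_diff := (along_diff A B Psi).
Local Notation ip p := (bform (gt (Psi p))).
Context (gt_sym : forall p Y Z, ip p Y Z = ip p Z Y).
Context (gt_diff : forall p a b, mdiff (A := B)
  (fun Q => bform (gt Q) (E (Psi p) a Q) (E (Psi p) b Q)) (Psi p)).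
Context {h : M -> 'M[R]_n} (rh : riemannian_metric A h).
Context (isom : forall p v w, ip p (T p v) (T p w) = bform (h p) v w).
Context {xi eta : M -> 'rV[R]_m}.
Context (xi_diff : forall p, along_diff xi p) (eta_diff : forall p, along_diff eta p).
Context (xi_T : forall p v, ip p (xi p) (T p v) = 0).
Context (eta_T : forall p v, ip p (eta p) (T p v) = 0).
Context (eta_eta : forall p, ip p (eta p) (eta p) = 0).
Context (xi_xi : forall p, ip p (xi p) (xi p) = 0).
Context (xi_eta : forall p, ip p (xi p) (eta p) = -1).
Context (splitting : forall p Y, exists w,
  Y = T p w - ip p Y (eta p) *: xi p - ip p Y (xi p) *: eta p).
Context (cov_xi : forall p v, ca p v xi = T p v).
Implicit Types (p q : M) (v w : 'rV[R]_n) (Y : 'rV[R]_m).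
Let cn := levi_civita_connection lc.

(** [tan_part] is a choice by [xget] from a set given by orthogonality. [splitting] provides an
    element of this set, and positivity of the induced metric makes it the only one. *)
Lemma tan_part_splitting p Y :
  Y = T p (tan_part A B gt Psi p Y) - ip p Y (eta p) *: xi p - ip p Y (xi p) *: eta p.
Proof.
have [w Yw] := splitting p Y.
pose S : set 'rV[R]_n := [set w | forall v, ip p (Y - T p w) (T p v) = 0].
have Sw : S w.
  move=> v; have e : Y - T p w = - ip p Y (eta p) *: xi p - ip p Y (xi p) *: eta p.
    by rewrite {1}Yw sub_alg scaleNr.
  by rewrite e bformDl bformZl bformNl bformZl xi_T eta_T !mulr0 oppr0 addr0.
have uS w' : S w' -> w' = w.
  move=> Sw'; apply: (metric_inj rh (p := p)) => v; rewrite -!isom.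
  have e x : S x -> ip p (T p x) (T p v) = ip p Y (T p v).
    by move=> Sx; apply/esym/subr0_eq; rewrite -bformBl; exact: Sx.
  by rewrite (e w' Sw') (e w Sw).
have -> : tan_part A B gt Psi p Y = w by apply: uS; exact: (xgetPex 0 (ex_intro _ w Sw)).
exact: Yw.
Qed.

(** The frame is lightlike with product -1, so each coefficient is minus the product with the
    opposite frame vector. *)
Lemma normal_partE p Y :
  normal_part A B gt Psi p Y = - (ip p Y (eta p) *: xi p) - ip p Y (xi p) *: eta p.
Proof.
rewrite /normal_part {1}(tan_part_splitting p Y).
exact: sub_alg.
Qed.

Lemma tan_part_ip p Y v : bform (h p) (tan_part A B gt Psi p Y) v = ip p Y (T p v).
Proof.
rewrite -isom {2}(tan_part_splitting p Y) !bformBl !bformZl xi_T eta_T.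
by rewrite !mulr0 !subr0.
Qed.

Lemma ip_der p v (Y Z : M -> 'rV[R]_m) : along_diff Y p -> along_diff Z p ->
  der A (fun q => ip q (Y q) (Z q)) p v = ip p (ca p v Y) (Z p) + ip p (Y p) (ca p v Z).
Proof.
move=> dY dZ; exact: (cov_along_metric hA hB oO lc sPsi PsiO v (gt_diff p) dY dZ).2.
Qed.

Lemma tmap_field_diff O0 p (W : M -> 'rV[R]_n) : open O0 -> O0 p ->
  smooth_vfield A O0 W -> along_diff (fun q => T q (W q)) p.
Proof.
move=> oO0 Op sW; have Pp : cdom B (Psi p) (Psi p) := cdom_refl hB _.
apply: (along_diffP hA hB oO cn sPsi PsiO Pp) => b.
have s := along_coord_tmap hA hB sPsi oO0 Op sW b.
exact: (smooth_mdiff hA s).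
Qed.

(** The product of [eta] and [xi] is constant, and the derivative of [xi] is tangent, hence
    orthogonal to [eta]. *)
Lemma cov_eta_xi p v : ip p (ca p v eta) (xi p) = 0.
Proof.
have d := ip_der v (eta_diff p) (xi_diff p).
have c : (fun q => ip q (eta q) (xi q)) = fun=> -1.
  by apply/funext => q; rewrite gt_sym xi_eta.
by rewrite c der_cst cov_xi eta_T addr0 in d.
Qed.

Lemma cov_eta_eta p v : ip p (ca p v eta) (eta p) = 0.
Proof.
have d := ip_der v (eta_diff p) (eta_diff p).
have c : (fun q => ip q (eta q) (eta q)) = fun=> 0 by apply/funext => q; exact: eta_eta.
rewrite c der_cst [X in _ + X]gt_sym -mulr2n in d.
by move/esym/eqP: d; rewrite mulrn_eq0 => /eqP.
Qed.

(** So [eta] is parallel for the normal connection, as [xi] is by [cov_xi]. *)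
Lemma cov_eta_tangent p v : ca p v eta = T p (tan_part A B gt Psi p (ca p v eta)).
Proof.
by rewrite {1}(tan_part_splitting p (ca p v eta)) cov_eta_xi cov_eta_eta !scale0r !subr0.
Qed.

Section Field.
Context {O0 : set M} (oO0 : open O0) {W : M -> 'rV[R]_n} (sW : smooth_vfield A O0 W).
Context {p : M} (Op : O0 p).

Lemma cov_tmap_xi v : ip p (ca p v (fun q => T q (W q))) (xi p) = - bform (h p) v (W p).
Proof.
have d := ip_der v (tmap_field_diff oO0 Op sW) (xi_diff p).
have c : (fun q => ip q (T q (W q)) (xi q)) = fun=> 0.
  by apply/funext => q; rewrite gt_sym xi_T.
rewrite c der_cst cov_xi isom (metric_sym rh) in d.
by apply/eqP; rewrite -addr_eq0; apply/eqP.
Qed.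

Lemma cov_tmap_eta v :
  ip p (ca p v (fun q => T q (W q))) (eta p) = - ip p (ca p v eta) (T p (W p)).
Proof.
have d := ip_der v (tmap_field_diff oO0 Op sW) (eta_diff p).
have c : (fun q => ip q (T q (W q)) (eta q)) = fun=> 0.
  by apply/funext => q; rewrite gt_sym eta_T.
rewrite c der_cst [X in _ + X]gt_sym in d.
by apply/eqP; rewrite -addr_eq0; apply/eqP.
Qed.

End Field.

Context {Dh : M -> 'M[R]_n}.
Context (DhE : forall p, Dh p = form_mx (fun v w => bform (h p)
  (v *m weingarten A B gt nt Psi eta p) w)).

(** [weingarten] records the operator on basis vectors; linearity of [cov_along] in the direction
    extends it to all [v]. *)
Lemma shape_form p v w : bform (Dh p) v w = - ip p (ca p v eta) (T p w).
Proof.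
have caE : ca p v eta = \sum_i v 0 i *: ca p (basis_vec i) eta.
  have lin a x y : ca p (a *: x + y) eta = a *: ca p x eta + ca p y eta.
    exact: (cov_along_lin hA hB oO cn sPsi PsiO a x y (eta_diff p)).
  have c0 : ca p 0 eta = 0 := cov_along0v hA hB oO cn sPsi PsiO (eta_diff p).
  rewrite {1}[v]row_sum_delta.
  elim/big_rec2: _ => // i y1 y2 _ <-; exact: lin.
rewrite DhE bform_form_mx => [|a x y z|a x y z].
- rewrite caE bform_suml -sumrN mulmx_sum_row bform_suml; apply: eq_bigr => i _.
  by rewrite rowK !bformZl bformNl tan_part_ip mulrN.
- by rewrite mulmxDl -scalemxAl bformDl bformZl.
- by rewrite bformDr bformZr.
Qed.

Lemma second_ffE (V W : M -> 'rV[R]_n) p : smooth_vfield A setT W ->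
  second_ff A B gt nt Psi V W p
  = bform (h p) (V p) (W p) *: eta p - bform (Dh p) (V p) (W p) *: xi p.
Proof.
move=> sW; rewrite /second_ff normal_partE (cov_tmap_eta openT sW I).
by rewrite (cov_tmap_xi openT sW I) -shape_form scaleNr opprK addrC.
Qed.

Context (sDh : smooth_form A setT Dh).
Context {nabla : @covariant R M n} (lcn : levi_civita A setT h nabla).
Local Notation svf := (smooth_vfield A setT).
Implicit Types (U V W : M -> 'rV[R]_n).
Let sT : (setT : set M) `<=` setT. Proof. by []. Qed.

(** Both frame vectors are parallel in the normal bundle, so only the coefficients of the second
    fundamental form are differentiated. *)
Lemma cov_normal_second_ff U V W p : svf V -> svf W ->
  cov_normal A B gt nt Psi U (second_ff A B gt nt Psi V W) p
  = der A (fun q => bform (h q) (V q) (W q)) p (U p) *: eta p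
    - der A (fun q => bform (Dh q) (V q) (W q)) p (U p) *: xi p.
Proof.
move=> sV sW; rewrite /cov_normal.
have -> : second_ff A B gt nt Psi V W = fun q => bform (h q) (V q) (W q) *: eta q
    + (- bform (Dh q) (V q) (W q)) *: xi q.
  by apply/funext => q; rewrite (second_ffE V q sW) scaleNr.
have dh := smooth_mdiff hA (smooth_metric rh openT sV sW) I : mdiff _ p.
have d0 := smooth_mdiff hA (sDh openT sT sV sW) I : mdiff _ p.
have [dD eD] := derN hA (U p) d0.
have [d1 e1] := cov_alongZ hA hB sPsi (nt := nt) (U p) dh (eta_diff p).
have [d2 e2] := cov_alongZ hA hB sPsi (nt := nt) (U p) dD (xi_diff p).
rewrite (cov_alongD hA hB sPsi (U p) d1 d2) e1 e2 eD cov_xi.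
rewrite normal_partE !bformDl !bformZl eta_eta xi_eta xi_xi [bform _ (eta p) _]gt_sym xi_eta.
rewrite cov_eta_xi cov_eta_eta [bform _ (T p _) (eta p)]gt_sym eta_T.
rewrite [bform _ (T p _) (xi p)]gt_sym xi_T !mulr0 !addr0 !add0r mulrN1 opprK mulrN1.
by rewrite !scaleNr opprK addrC.
Qed.

(** The coefficient of [eta] is the covariant derivative of the induced metric, which is zero. *)
Lemma cov_second_ffE U V W p : svf U -> svf V -> svf W ->
  cov_second_ff A B gt nt Psi nabla U V W p
  = - (der A (fun q => bform (Dh q) (V q) (W q)) p (U p)
       - bform (Dh p) (nabla p (U p) V) (W p) - bform (Dh p) (V p) (nabla p (U p) W)) *: xi p.
Proof.
move=> sU sV sW; rewrite /cov_second_ff (cov_normal_second_ff _ _ sV sW).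
have sUW := smooth_cov lcn.1 openT sT sU sW.
rewrite (second_ffE _ p sW) (second_ffE _ p sUW).
exact: second_ff_alg (lc_metric lcn openT sT (U p) sV sW I).
Qed.

Lemma cov_second_ff_skew U V W p : svf U -> svf V -> svf W ->
  cov_second_ff A B gt nt Psi nabla U V W p - cov_second_ff A B gt nt Psi nabla V U W p
  = skew_derivative A nabla Dh V U W p *: xi p.
Proof.
move=> sU sV sW; rewrite !cov_second_ffE // -scalerBl; congr (_ *: _).
rewrite /skew_derivative -(lc_torsion lcn openT sT sV sU I) bformBl /cov.
by ring.
Qed.

Section GaussFields.
Context {O1 : set M} (oO1 : open O1) {p : M} (Op : O1 p).
Local Notation svf1 := (smooth_vfield A O1).
Let a (Y Z S : M -> 'rV[R]_n) : R := ip p (ca p (Y p) (fun q => T q (Z q))) (T p (S p)).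

Lemma field_metric (Y Z S : M -> 'rV[R]_n) : svf1 Z -> svf1 S ->
  der A (fun q => bform (h q) (Z q) (S q)) p (Y p) = a Y Z S + a Y S Z.
Proof.
move=> sZ sS.
have d := ip_der (Y p) (tmap_field_diff oO1 Op sZ) (tmap_field_diff oO1 Op sS).
have c : (fun q => ip q (T q (Z q)) (T q (S q))) = fun q => bform (h q) (Z q) (S q).
  by apply/funext => q; exact: isom.
by rewrite c [X in _ + X]gt_sym in d.
Qed.

Lemma field_torsion (Y Z S : M -> 'rV[R]_n) : svf1 Y -> svf1 Z ->
  bform (h p) (lie_bracket A Y Z p) (S p) = a Y Z S - a Z Y S.
Proof.
move=> sY sZ; have t := cov_along_torsion hA hB oO lc sPsi PsiO oO1 sY sZ Op.
by rewrite -isom -t bformBl.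
Qed.

(** By [field_metric] and [field_torsion] the numbers [a] obey the two identities of a Levi-Civita
    connection of [h]. Koszul's expression is determined by these, and [nabla] has the same one. *)
Lemma gauss_fields V W X : svf1 V -> svf1 W -> svf1 X ->
  a V W X = bform (h p) (nabla p (V p) W) (X p).
Proof.
move=> sV sW sX; have s1 : O1 `<=` setT by [].
have k := koszul (metric_sym rh) lcn oO1 s1 sV sW sX Op.
exact: (gauss_alg k (field_metric V sW sX) (field_metric W sV sX) (field_metric X sV sW)
  (field_torsion X sV sW) (field_torsion W sV sX) (field_torsion V sW sX)).
Qed.

End GaussFields.

Lemma gauss V W p x : svf V -> svf W ->
  ip p (ca p (V p) (fun q => T q (W q))) (T p x) = bform (h p) (nabla p (V p) W) x.
Proof.
move=> sV sW; have sI : cdom A p `<=` setT by [].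
have k := gauss_fields (cdom_open hA p) (cdom_refl hA p) (smooth_vfield_subset sI sV)
  (smooth_vfield_subset sI sW) (smooth_const_vfield hA p x).
have XE : const_vfield A p x p = x := const_vfield_id hA p x.
by rewrite XE in k.
Qed.

(** The derivative of [eta] is tangent, so only the tangential part of the derivative of [T W]
    counts, and by [gauss] that is nabla_V W. *)
Lemma cov_eta_gauss U V W p : svf V -> svf W ->
  ip p (ca p (V p) (fun q => T q (W q))) (ca p (U p) eta)
  = - bform (Dh p) (U p) (nabla p (V p) W).
Proof.
move=> sV sW; have g := gauss p (tan_part A B gt Psi p (ca p (U p) eta)) sV sW.
rewrite -cov_eta_tangent (metric_sym rh) tan_part_ip in g.
by rewrite shape_form opprK.
Qed.

Section Curvature.
Context {W : M -> 'rV[R]_n} (sW : svf W).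
Let Y q := T q (W q).

(** Lets metric compatibility be applied to the first covariant derivative as a field along
    [Psi]. *)
Lemma cov_tmap_diff V p : svf V -> along_diff (fun q => ca q (V q) Y) p.
Proof.
move=> sV.
have sY := along_coord_tmap hA hB sPsi openT (p := p) I sW.
exact: (cov_along_twice hA hB oO cn sPsi PsiO openT I sY 0 sV).1.
Qed.

(** The product of the first derivative with [xi] is - h(V, W) by [cov_tmap_xi]; it is
    differentiated once more, and [gauss] evaluates the term with the derivative of [xi]. *)
Lemma second_cov_xi U V p : svf V -> ip p (ca p (U p) (fun q => ca q (V q) Y)) (xi p)
  = - der A (fun q => bform (h q) (V q) (W q)) p (U p) - bform (h p) (nabla p (V p) W) (U p).
Proof.
move=> sV; have d := ip_der (U p) (cov_tmap_diff p sV) (xi_diff p).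
have c : (fun q => ip q (ca q (V q) Y) (xi q)) = fun q => - bform (h q) (V q) (W q).
  by apply/funext => q; exact: (cov_tmap_xi openT sW I).
have dh := smooth_mdiff hA (smooth_metric rh openT sV sW) I : mdiff _ p.
have e0 : der A (fun q => ip q (ca q (V q) Y) (xi q)) p (U p)
    = - der A (fun q => bform (h q) (V q) (W q)) p (U p).
  by rewrite c; exact: (derN hA (U p) dh).2.
have e1 : ip p (ca p (V p) Y) (ca p (U p) xi) = bform (h p) (nabla p (V p) W) (U p).
  by rewrite cov_xi; exact: gauss.
exact: (cov_alg d e0 e1).
Qed.

Lemma second_cov_eta U V p : svf V -> ip p (ca p (U p) (fun q => ca q (V q) Y)) (eta p)
  = der A (fun q => bform (Dh q) (V q) (W q)) p (U p) + bform (Dh p) (U p) (nabla p (V p) W).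
Proof.
move=> sV; have d := ip_der (U p) (cov_tmap_diff p sV) (eta_diff p).
have c : (fun q => ip q (ca q (V q) Y) (eta q)) = fun q => bform (Dh q) (V q) (W q).
  by apply/funext => q; rewrite (cov_tmap_eta openT sW I) -shape_form.
have e0 : der A (fun q => ip q (ca q (V q) Y) (eta q)) p (U p)
    = der A (fun q => bform (Dh q) (V q) (W q)) p (U p) by rewrite c.
have := cov_alg d e0 (cov_eta_gauss U p sV sW); by rewrite opprK.
Qed.

(** The curvature is the commutator of induced derivatives. Its product with [xi] is zero and its
    product with [eta] is minus the skew derivative of [Dh], which [normal_partE] turns into the
    coefficient of [xi]. *)
Lemma curv_normal_part U V p : svf U -> svf V ->
  normal_part A B gt Psi p (curv B nt (Psi p) (T p (U p)) (T p (V p)) (T p (W p)))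
  = skew_derivative A nabla Dh V U W p *: xi p.
Proof.
move=> sU sV.
have sY := along_coord_tmap hA hB sPsi openT (p := p) I sW.
have e : curv B nt (Psi p) (T p (U p)) (T p (V p)) (T p (W p))
    = ca p (U p) (fun q => ca q (V q) Y) - ca p (V p) (fun q => ca q (U q) Y)
      - ca p (lie_bracket A U V p) Y.
  exact: (cov_along_curvature hA hB oO cn sPsi PsiO openT I sY sU sV).
have bE : lie_bracket A U V p = nabla p (U p) V - nabla p (V p) U.
  by rewrite -(lc_torsion lcn openT sT sU sV I).
have bE' : lie_bracket A V U p = nabla p (V p) U - nabla p (U p) V.
  by rewrite -(lc_torsion lcn openT sT sV sU I).
have eip Z : ip p (curv B nt (Psi p) (T p (U p)) (T p (V p)) (T p (W p))) Z
    = ip p (ca p (U p) (fun q => ca q (V q) Y)) Z - ip p (ca p (V p) (fun q => ca q (U q) Y)) Z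
      - ip p (ca p (lie_bracket A U V p) Y) Z.
  by rewrite e; exact: bform_sub2.
have sc1 := second_cov_xi U p sV; have sc2 := second_cov_xi V p sU.
have sc3 := cov_tmap_xi openT sW (p := p) I (lie_bracket A U V p).
have sd1 := second_cov_eta U p sV; have sd2 := second_cov_eta V p sU.
have sd3 := cov_tmap_eta openT sW (p := p) I (lie_bracket A U V p).
rewrite -shape_form in sd3.
have m1 := lc_metric lcn openT sT (U p) sV sW (p := p) I.
have m2 := lc_metric lcn openT sT (V p) sU sW (p := p) I.
have hb : bform (h p) (lie_bracket A U V p) (W p)
    = bform (h p) (nabla p (U p) V) (W p) - bform (h p) (nabla p (V p) U) (W p).
  by rewrite bE bformBl.
have Db : bform (Dh p) (lie_bracket A V U p) (W p)
    = - bform (Dh p) (lie_bracket A U V p) (W p).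
  by rewrite -bformNl bE bE' opprB.
rewrite [bform _ (V p) _](metric_sym rh) in m1.
rewrite [bform _ (U p) _](metric_sym rh) in m2.
have exi : ip p (curv B nt (Psi p) (T p (U p)) (T p (V p)) (T p (W p))) (xi p) = 0.
  exact: (curv_alg1 (eip (xi p)) sc1 sc2 sc3 m1 m2 hb).
have eeta : ip p (curv B nt (Psi p) (T p (U p)) (T p (V p)) (T p (W p))) (eta p)
    = - skew_derivative A nabla Dh V U W p.
  exact: (curv_alg2 (eip (eta p)) sd1 sd2 sd3 Db).
by rewrite normal_partE exi eeta scale0r subr0 scaleNr opprK.
Qed.

End Curvature.
End NullFrame.

(** [smooth_fun] speaks of chart representatives; composing with the continuous chart map recovers
    [f] near each point. *)
Lemma smooth_continuous (R : realType) (M : topologicalType) n (A : atlas R M n)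
    (hA : charted A) (f : M -> R) : smooth_fun A setT f -> continuous f.
Proof.
move=> sf p; have pp := cdom_refl hA p.
have d := differentiable_continuous (smooth_mdiff hA sf I : mdiff f p).
have c : ((f \o cinv A p) \o cmap A p) @ p --> ((f \o cinv A p) \o cmap A p) p.
  exact: (continuous_comp (cmap_continuous hA pp) d).
have fE : ((f \o cinv A p) \o cmap A p) p = f p by rewrite /= (cmapK hA pp).
rewrite fE in c; apply: cvg_trans c; apply: near_eq_cvg.
have nI : nbhs p (cdom A p) by apply: open_nbhs_nbhs; split=> //; exact: (cdom_open hA).
by apply: filterS nI => q pq; rewrite /= (cmapK hA pq).
Qed.

Lemma ambient_comp3 (R : realType) n (a b : R) (X Y Z : 'rV[R]_(1 + (1 + n))) :
  [/\ tcomp (X + a *: Y + b *: Z) = tcomp X + a * tcomp Y + b * tcomp Z,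
      rcomp (X + a *: Y + b *: Z) = rcomp X + a * rcomp Y + b * rcomp Z &
      mcomp (X + a *: Y + b *: Z) = mcomp X + a *: mcomp Y + b *: mcomp Z].
Proof. by split; rewrite !compE. Qed.

Lemma isometry_alg (F : comRingType) (x y a b r s k c d : F) :
  y = x * (r * b + a * s) + k * c -> r = 0 -> s = 0 -> c = d -> y = k * d.
Proof. by move=> -> -> -> ->; ring. Qed.

(** * The immersion into the ambient space and its normal frame *)

Section Immersion.
Context {R : realType} {M : topologicalType} {n : nat} {A : atlas R M n}.
Context (hA : charted A) {u : M -> R} (su : smooth_fun A setT u).
Local Notation B := (ambient_atlas A).
Local Notation MT := (R * (R * M))%type.
Local Notation Psi := (Psi_u u).
Local Notation T := (tmap A B Psi).
Implicit Types (p q : M) (v w : 'rV[R]_n).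
Let hB := charted_ambient hA.

Lemma Psi_ambient delta p : 0 < delta -> ambient delta (Psi p).
Proof. by move=> d0; split; [exact: expR_gt0|rewrite /= oppr_lt0 d0]. Qed.

Lemma Psi_coord (y : MT) q i : (cmap B y (Psi q)) 0 i = match fintype.split i with
  | inl _ => expR (u q)
  | inr k => match fintype.split k with inl _ => 0 | inr j => (cmap A y.2.2 q) 0 j end end.
Proof.
rewrite /= row_mx_coord; case: (fintype.split i) => [j|k]; first by rewrite mxE.
by rewrite row_mx_coord; case: (fintype.split k) => // j; rewrite mxE.
Qed.

Lemma Psi_smooth : smooth_map A B Psi.
Proof.
split.
  move=> q.
  have c1 : expR (u x) @[x --> q] --> expR (u q).
    apply: (@continuous_comp _ _ _ u expR); first exact: (smooth_continuous hA su).
    exact: continuous_expR.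
  have c2 : ((0 : R), x) @[x --> q] --> ((0 : R), q).
    have c3 : (0 : R) @[x --> q] --> (0 : R) by exact: cvg_cst.
    have c4 : x @[x --> q] --> q by exact: cvg_id.
    exact: (cvg_pair c3 c4).
  exact: (cvg_pair c1 c2).
move=> y i; rewrite (funext (fun q => Psi_coord y q i)).
case: (fintype.split i) => [_|k].
  exact: (smooth_fun_subset (@subsetT _ _) (smooth_exp hA openT su)).
case: (fintype.split k) => [_|j]; first exact: smooth_cst.
by apply: smooth_fun_subset ((smooth_map_id hA).2 y.2.2 j) => q [_ []].
Qed.

Lemma tmap_Psi p v : T p v = (expR (u p) * der A u p v) *: d_t + lift_vec v.
Proof.
have Pp : cdom B (Psi p) (Psi p) := cdom_refl hB _.
have -> : (expR (u p) * der A u p v) *: d_t + lift_vec v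
    = row_mx (const_mx (expR (u p) * der A u p v)) (row_mx 0 v).
  apply: ambient_vec_eq; rewrite ?tcomp_row ?rcomp_row ?mcomp_row !compE ?mxE.
  - by rewrite mulr1 addr0.
  - by rewrite mulr0 addr0.
  - by rewrite scaler0 add0r.
apply/rowP => i; have := tmap_coord hA hB Psi_smooth v i Pp.
rewrite (tocoord_id hB) => ->; rewrite (funext (fun q => Psi_coord (Psi p) q i)).
rewrite row_mx_coord; case: (fintype.split i) => [j|k].
  by rewrite mxE (der_exp hA v (smooth_mdiff hA su I)).
rewrite row_mx_coord; case: (fintype.split k) => [j|j]; first by rewrite mxE der_cst.
have pp : cdom A p (id p) := cdom_refl hA p.
have := tmap_coord hA hA (smooth_map_id hA) v j pp.
by rewrite (tocoord_id hA) (tmap_id hA).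
Qed.

Section Products.
Context {g : M -> 'M[R]_n} (rg : riemannian_metric A g).
Context {alpha : R -> M -> 'M[R]_n} (salpha : smooth_family A alpha).
Context (selfa : forall rho, self_adjoint g (alpha rho)).
Context (alpha0 : forall p, alpha 0 p = 1%:M).
Local Notation gt := (ambient_metric A g alpha).
Local Notation G := (grad A g u).
Local Notation NG := (grad_sqnorm A g u).
Local Notation xi := (@xi_u R M n u).
Local Notation eta := (eta_u A g u).

Lemma ipE p X Y : bform (gt (Psi p)) X Y =
  expR (u p) * (rcomp X * tcomp Y + tcomp X * rcomp Y)
  + expR (u p) ^+ 2 * bform (g p) (mcomp X) (mcomp Y).
Proof. exact: (ambient_metric0 hA alpha0 (Q := Psi p) X Y erefl). Qed.

Lemma tmap_comp p v : [/\ tcomp (T p v) = expR (u p) * der A u p v,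
  rcomp (T p v) = 0 & mcomp (T p v) = v].
Proof. by split; rewrite tmap_Psi !compE ?mulr1 ?mulr0 ?scaler0 ?add0r ?addr0. Qed.

Lemma xi_comp p : [/\ tcomp (xi p) = expR (u p), rcomp (xi p) = 0 & mcomp (xi p) = 0].
Proof. by rewrite /xi_u !compE mulr1 mulr0 scaler0. Qed.

(** The exponentials become powers of [expR (u p)], so that [field] can settle the products with
    [eta]. *)
Lemma eta_comp p : [/\ tcomp (eta p) = (expR (u p))^-1 * (NG p / 2),
  rcomp (eta p) = - (expR (u p))^-2 & mcomp (eta p) = (expR (u p))^-2 *: G p].
Proof.
have e2 : expR (- (2 * u p)) = (expR (u p))^-2.
  by rewrite expRN expRM_natl.
rewrite /eta_u e2 expRN -scaleNr !compE !mulr1 !mulr0 !addr0 !add0r.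
by rewrite !scaler0 !add0r.
Qed.

Lemma ip_TT p v w : bform (gt (Psi p)) (T p v) (T p w) = bform (conformal u g p) v w.
Proof.
have [t1 r1 m1] := tmap_comp p v; have [t2 r2 m2] := tmap_comp p w.
rewrite bform_conformal expRM_natl.
exact: (isometry_alg (ipE p (T p v) (T p w)) r1 r2 (congr2 (bform (g p)) m1 m2)).
Qed.

Lemma ip_xi p Y : bform (gt (Psi p)) (xi p) Y = expR (u p) ^+ 2 * rcomp Y.
Proof.
have [t r m] := xi_comp p; rewrite ipE t r m bform0l; ring.
Qed.

Lemma ip_eta p Y : bform (gt (Psi p)) (eta p) Y
  = - ((expR (u p))^-1 * tcomp Y) + NG p / 2 * rcomp Y + bform (g p) (G p) (mcomp Y).
Proof.
have [t r m] := eta_comp p; have e0 : expR (u p) != 0 by rewrite gt_eqF ?expR_gt0.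
rewrite ipE t r m bformZl; move: (bform _ _ _) => b; field; exact: e0.
Qed.

Lemma ip_xi_T p v : bform (gt (Psi p)) (xi p) (T p v) = 0.
Proof. by have [t r m] := tmap_comp p v; rewrite ip_xi r mulr0. Qed.

Lemma ip_eta_T p v : bform (gt (Psi p)) (eta p) (T p v) = 0.
Proof.
have [t r m] := tmap_comp p v; have e0 : expR (u p) != 0 by rewrite gt_eqF ?expR_gt0.
rewrite ip_eta t r m (metric_grad rg v (smooth_mdiff hA su I)) mulr0 addr0 mulKf //.
by rewrite addNr.
Qed.

Lemma ip_xi_xi p : bform (gt (Psi p)) (xi p) (xi p) = 0.
Proof. by have [t r m] := xi_comp p; rewrite ip_xi r mulr0. Qed.

Lemma ip_xi_eta p : bform (gt (Psi p)) (xi p) (eta p) = -1.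
Proof.
have [t r m] := eta_comp p; have e0 : expR (u p) != 0 by rewrite gt_eqF ?expR_gt0.
by rewrite ip_xi r mulrN mulfV // expf_neq0.
Qed.

Lemma ip_eta_eta p : bform (gt (Psi p)) (eta p) (eta p) = 0.
Proof.
have [t r m] := eta_comp p; have e0 : expR (u p) != 0 by rewrite gt_eqF ?expR_gt0.
rewrite ip_eta t r m bformZr -/(NG p); move: (NG p) => b; field; exact: e0.
Qed.

Lemma Psi_splitting p Y : exists w, Y = T p w - bform (gt (Psi p)) Y (eta p) *: xi p
  - bform (gt (Psi p)) Y (xi p) *: eta p.
Proof.
have sym := ambient_metric_sym hA rg selfa.
(* The [d_rho] component of [Y] can only come from [eta] and so fixes the coefficient of [eta]. That
   multiple of [eta] has [- rcomp Y *: G p] as its part tangent to M, which the witness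
   compensates. *)
rewrite !(sym _ Y) ip_xi ip_eta; exists (rcomp Y *: G p + mcomp Y).
have [t1 r1 m1] := xi_comp p; have [t2 r2 m2] := eta_comp p.
have [t3 r3 m3] := tmap_comp p (rcomp Y *: G p + mcomp Y).
have e0 : expR (u p) != 0 by rewrite gt_eqF ?expR_gt0.
rewrite -scaleNr -[- (_ *: eta p)]scaleNr.
apply: ambient_vec_eq; set Z := _ + _ + _;
  have [eT eR eM] := ambient_comp3 _ _ _ _ _ : [/\ tcomp Z = _, rcomp Z = _ & mcomp Z = _].
- rewrite eT t1 t2 t3 -(metric_grad rg _ (smooth_mdiff hA su I)) bformDr bformZr -/(NG p).
  move: (bform _ _ _) (NG p) => b c; field; exact: e0.
- rewrite eR r1 r2 r3; field; exact: e0.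
- rewrite eM m1 m2 m3 scaler0 addr0 scalerA.
  have -> : - (expR (u p) ^+ 2 * rcomp Y) * (expR (u p))^-2 = - rcomp Y by field; exact: e0.
  by rewrite scaleNr addrAC subrr add0r.
Qed.

Context {nt : @covariant R MT (1 + (1 + n))} {delta : R} (delta0 : 0 < delta).
Context (lc : levi_civita B (ambient delta) gt nt).
Local Notation ca := (cov_along B B nt Psi).
Let cn := levi_civita_connection lc.
Let PO q : ambient delta (Psi q) := Psi_ambient q delta0.
Let oO : open (ambient delta : set MT) := ambient_open (delta := delta).

(** The components along [d_t] and [d_rho] are the same in all charts; only the part tangent to M
    undergoes a coordinate change. *)
Lemma along_diff_ambient p (Y : M -> 'rV[R]_(1 + (1 + n))) :
  mdiff (A := A) (fun q => tcomp (Y q)) p -> mdiff (A := A) (fun q => rcomp (Y q)) p ->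
  mdiff (A := A) (fun q => tocoord A p q (mcomp (Y q))) p ->
  along_diff A B Psi Y p.
Proof.
move=> dt dr dm.
have Pp : cdom B (Psi p) (Psi p) := cdom_refl hB _.
apply: (along_diffP hA hB oO cn Psi_smooth PO Pp) => b.
have nI : nbhs p (cdom A p).
  by apply: open_nbhs_nbhs; split; [exact: (cdom_open hA)|exact: (cdom_refl hA)].
have e q : cdom A p q -> along_coord B Psi (Psi p) Y b q = match fintype.split b with
  | inl _ => tcomp (Y q)
  | inr k => match fintype.split k with
    | inl _ => rcomp (Y q) | inr j => (tocoord A p q (mcomp (Y q))) 0 j end end.
  move=> pq; have PQ : cdom A (Psi p).2.2 (Psi q).2.2 by [].
  rewrite /along_coord (tocoord_ambient hA (Y q) PQ).
  rewrite row_mx_coord; case: (fintype.split b) => [j|k]; first by rewrite ord1.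
  by rewrite row_mx_coord; case: (fintype.split k) => // j; rewrite ord1.
apply: (mdiff_ext hA) (filterS (fun q pq => esym (e q pq)) nI) _.
case: (fintype.split b) => [//|k]; case: (fintype.split k) => [//|j].
exact: ((mdiff_coord _ _).1 dm j).
Qed.

Lemma eta_diff p : along_diff A B Psi eta p.
Proof.
have e0 q : expR (u q) != 0 by rewrite gt_eqF ?expR_gt0.
have sE : smooth_fun A setT (fun q => expR (u q)) := smooth_exp hA openT su.
have sG : smooth_vfield A setT G := smooth_grad hA rg su.
have s1 : smooth_fun A setT (fun q => (expR (u q))^-1).
  exact: (smooth_inv hA openT (fun q _ => e0 q) sE).
have s2 : smooth_fun A setT (fun q => (expR (u q))^-2).
  have -> : (fun q => (expR (u q))^-2) = fun q => (expR (u q))^-1 * (expR (u q))^-1.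
    by apply/funext => q; rewrite -exprVn expr2.
  exact: (smoothM hA openT s1 s1).
have sN : smooth_fun A setT (fun q => NG q / 2).
  have sc : smooth_fun A setT (fun=> 2^-1 : R) by exact: smooth_cst.
  exact: (smoothM hA openT (smooth_metric rg openT sG sG) sc).
apply: along_diff_ambient.
- have -> : (fun q => tcomp (eta q)) = fun q => (expR (u q))^-1 * (NG q / 2).
    by apply/funext => q; have [] := eta_comp q.
  exact: (smooth_mdiff hA (smoothM hA openT s1 sN) I).
- have -> : (fun q => rcomp (eta q)) = fun q => - (expR (u q))^-2.
    by apply/funext => q; have [] := eta_comp q.
  exact: (derN hA 0 (smooth_mdiff hA s2 I)).1.
have -> : (fun q => tocoord A p q (mcomp (eta q)))
    = fun q => tocoord A p q ((expR (u q))^-2 *: G q).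
  by apply/funext => q; have [_ _ ->] := eta_comp q.
exact: (smooth_vfield_diff hA openT (smooth_vfieldZ hA openT s2 sG) I).
Qed.

(** [xi] is [expR (u q)] times the coordinate field [d_t]. In the Leibniz rule the derivative of the
    factor supplies the [d_t] part of [T p v], and in the other term the factor cancels against the
    1 / t of [nabla_dt], leaving the lift of [v]. *)
Lemma xi_cov p v : along_diff A B Psi xi p /\ cov_along A B nt Psi p v xi = T p v.
Proof.
pose Z := const_vfield B (Psi p) d_t.
have nI : nbhs p (cdom A p).
  by apply: open_nbhs_nbhs; split; [exact: (cdom_open hA)|exact: (cdom_refl hA)].
have nZ : \forall q \near p, expR (u q) *: Z (Psi q) = xi q.
  apply: filterS nI => q pq.
  have PQ : cdom A (Psi p).2.2 (Psi q).2.2 by [].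
  congr (_ *: _); rewrite /Z (const_vfield_ambient hA d_t PQ).
  apply: ambient_vec_eq; rewrite ?tcomp_row ?rcomp_row ?mcomp_row //.
  rewrite mcomp_dt; exact: derive0.
have oZ : open (cdom B (Psi p) `&` ambient delta).
  exact: (openI (cdom_open hB (Psi p)) oO).
have Zp : (cdom B (Psi p) `&` ambient delta) (Psi p).
  by split; [exact: (cdom_refl hB)|exact: PO].
have sZ : smooth_vfield B (cdom B (Psi p) `&` ambient delta) Z.
  exact: (smooth_vfield_subset (@subIsetl _ _ _) (smooth_const_vfield hB (Psi p) d_t)).
have [dZ eZ] := cov_along_comp hA hB cn Psi_smooth v oZ (@subIsetr _ _ _) sZ Zp.
have du := smooth_mdiff hA su I : mdiff u p.
have dE : mdiff (A := A) (fun q => expR (u q)) p := mdiff_exp du.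
have [d e] := cov_alongZ hA hB Psi_smooth (nt := nt) v dE dZ.
split; first exact: (along_diff_ext hA nZ d).
have [t r m] := tmap_comp p v.
rewrite -(cov_along_ext hA v nZ) e eZ (der_exp hA v du).
rewrite (nabla_dt hA rg salpha selfa alpha0 lc (PO p) erefl r) m.
have e0 : expR (u p) != 0 by rewrite gt_eqF ?expR_gt0.
have ZE : Z (Psi p) = d_t := const_vfield_id hB (Psi p) d_t.
have lE : expR (u p) *: ((Psi p).1^-1 *: lift_vec v) = lift_vec v.
  by rewrite scalerA mulfV ?scale1r.
by rewrite ZE lE -tmap_Psi.
Qed.

Lemma frame_diff p (a b : 'I_(1 + (1 + n))) : mdiff (A := B)
  (fun Q => bform (gt Q) (const_vfield B (Psi p) (basis_vec a) Q)
                         (const_vfield B (Psi p) (basis_vec b) Q)) (Psi p).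
Proof. exact: (ambient_frame hA rg salpha (Psi p) (basis_vec a) (basis_vec b) 0).1. Qed.

End Products.
End Immersion.

(** * Conformal classes and the conclusion *)

Lemma conformal_conformal (R : realType) (M : topologicalType) n (u v : M -> R)
    (g : M -> 'M[R]_n) : conformal u (conformal v g) = conformal (fun q => u q + v q) g.
Proof. by apply/funext => q; rewrite /conformal scalerA -expRD mulrDr. Qed.

Lemma conformal_class (R : realType) (M : topologicalType) n (A : atlas R M n)
    (c : set (M -> 'M[R]_n)) g u : charted A -> conformal_structure A c -> c g ->
  smooth_fun A setT u -> riemannian_metric A g /\ c (conformal u g).
Proof.
move=> hA [g0 rg0 ->] [v sv ->] su; split; first exact: conformal_riemannian.
exists (fun q => u q + v q); last exact: conformal_conformal.
exact: (smoothD hA openT su sv).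
Qed.

Theorem lemma5p1 (R : realType) (M : topologicalType) (A : atlas R M 2)
    (c : set (M -> 'M[R]_2)) (g : M -> 'M[R]_2) (nabla : @covariant R M 2)
    (alpha : R -> M -> 'M[R]_2) (delta : R)
    (nablat : @covariant R (R * (R * M))%type (1 + (1 + 2)))
    (D : (M -> 'M[R]_2) -> (M -> 'M[R]_2)) :
  manifold A ->
  conformal_structure A c -> c g ->
  levi_civita A setT g nabla ->
  admissible A c alpha -> nonsingular_below delta alpha ->
  (forall p, \tr (family_deriv alpha 0 p) = scal A g nabla p) ->
  let B := ambient_atlas A in
  let gt := ambient_metric A g alpha in
  levi_civita B (ambient delta) gt nablat ->
  mobius_structure A c D ->
  (forall u, smooth_fun A setT u -> forall p,
     D (conformal u g) p
     = form_mx (fun v w => bform (conformal u g p)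
         (v *m weingarten A B gt nablat (Psi_u u) (eta_u A g u) p) w)) ->
  forall u, smooth_fun A setT u ->
  forall nablau, levi_civita A setT (conformal u g) nablau ->
  forall U V W : M -> 'rV[R]_2,
    smooth_vfield A setT U -> smooth_vfield A setT V -> smooth_vfield A setT W ->
  forall p,
    let Psi := Psi_u u in
    let T := tmap A B Psi p in
    cotton_york g nabla D V U W p *: xi_u u p
      = cov_second_ff A B gt nablat Psi nablau U V W p
        - cov_second_ff A B gt nablat Psi nablau V U W p
    /\ normal_part A B gt Psi p (curv B nablat (Psi p) (T (U p)) (T (V p)) (T (W p)))
      = cotton_york g nabla D V U W p *: xi_u u p.
Proof.
move=> [_ _ h1 h2 h3] cc cg lc [salpha selfac alpha0 _] [delta0 _] _ B gt lct mD DhE.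
move=> u su nablau lcu U V W sU sV sW p Psi T.
have hA : charted A by split.
have selfa rho : self_adjoint g (alpha rho) by exact: selfac.
have [rg cu] := conformal_class hA cc cg su.
have rgu : riemannian_metric A (conformal u g) := conformal_riemannian hA rg su.
have [sD symD mob] := mD g cg; have [trD trans] := mob nabla lc.
have [sDh _ _] := mD _ cu.
(* The Cotton-York tensor is taken for [g], while both geometric quantities are expressed by the
   metric [conformal u g] that the immersion induces; invariance joins the two. *)
have skew : cotton_york g nabla D V U W p
    = skew_derivative A nablau (D (conformal u g)) V U W p.
  rewrite (cotton_york_skew hA rg lc p sD sU sV sW).
  by rewrite (skew_derivative_invariant hA rg lc su lcu sD symD trD (trans u su) p sU sV sW).
have hB := charted_ambient hA; have oO := @ambient_open R M delta.
have sP := Psi_smooth hA su; have PO q := @Psi_ambient R M u delta q delta0.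
have sym q := ambient_metric_sym hA rg selfa (Psi q).
have fr := frame_diff hA (u := u) rg salpha.
have xd q := (xi_cov hA su rg salpha selfa alpha0 delta0 lct q 0).1.
have xc q v := (xi_cov hA su rg salpha selfa alpha0 delta0 lct q v).2.
have ed := eta_diff hA su rg delta0 lct.
rewrite skew; split.
  apply/esym.
  exact: (cov_second_ff_skew hA hB oO lct sP PO sym fr rgu (ip_TT hA su alpha0) xd ed
    (ip_xi_T hA su alpha0) (ip_eta_T hA su rg alpha0) (ip_eta_eta hA alpha0)
    (ip_xi_xi hA alpha0) (ip_xi_eta hA alpha0) (Psi_splitting hA su rg selfa alpha0) xc
    (DhE u su) sDh lcu p sU sV sW).
exact: (curv_normal_part hA hB oO lct sP PO sym fr rgu (ip_TT hA su alpha0) xd ed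
  (ip_xi_T hA su alpha0) (ip_eta_T hA su rg alpha0) (ip_eta_eta hA alpha0)
  (ip_xi_eta hA alpha0) (Psi_splitting hA su rg selfa alpha0) xc (DhE u su) lcu sW p sU sV).
Qed.
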